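(* Let $(\boldsymbol u_h,p_h,\boldsymbol J_h,\phi_h)\in\boldsymbol V_{h,0}^k\times Q_h^{k-1}\times\boldsymbol D_h^{k-1}\times S_h^{k-2}$ be a solution of the following discrete problem: for all $(\boldsymbol v_h,q_h,\boldsymbol d_h,\varphi_h)\in\boldsymbol V_{h,0}^k\times Q_h^{k-1}\times\boldsymbol D_h^{k-1}\times S_h^{k-2}$, $$\mathcal O(\boldsymbol u_h;\boldsymbol u_h,\boldsymbol v_h)_h+R_e^{-1}(\nabla\boldsymbol u_h,\nabla\boldsymbol v_h)_h+\gamma(\operatorname{div}\boldsymbol u_h,\operatorname{div}\boldsymbol v_h)_h-(p_h,\operatorname{div}\boldsymbol v_h)_h-\alpha(\boldsymbol J_h\times\boldsymbol B,\boldsymbol v_h)_h=(\boldsymbol f_h,\boldsymbol v_h)_h,$$ $$(\boldsymbol J_h,\boldsymbol d_h)_h-(\phi_h,\operatorname{div}\boldsymbol d_h)_h-(\boldsymbol u_h\times\boldsymbol B,\boldsymbol d_h)_h=(\boldsymbol g_h,\boldsymbol d_h)_h,$$ $$-(\operatorname{div}\boldsymbol u_h,q_h)_h=0,\qquad-(\operatorname{div}\boldsymbol J_h,\varphi_h)_h=0.$$ Then $\boldsymbol J_h$ is exactly divergence-free, namely $\operatorname{div}\boldsymbol J_h=0$ on $\Omega_h$.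
   Context: $k\ge2$. $\widehat{\mathcal T}_h$ is a conforming, shape-regular, quasi-uniform straight-edged tetrahedral mesh occupying a polyhedral domain $\widehat\Omega_h\subset\mathbb R^3$ of mesh size $h$; $\boldsymbol M_h$ is a continuous piecewise polynomial map of degree $k$ on $\widehat{\mathcal T}_h$, $\Omega_h=\boldsymbol M_h(\widehat\Omega_h)$. $\mathbb J_{\boldsymbol M_h}$ is its Jacobian matrix. It is assumed ($h$ sufficiently small) that $\boldsymbol M_h$ is bijective, $\mathbb J_{\boldsymbol M_h}$ and $\mathbb J_{\boldsymbol M_h^{-1}}$ are bounded (element by element in $W^{k,\infty}$), and $\det\mathbb J_{\boldsymbol M_h}\ge\delta$ for a constant $\delta>0$ independent of $h$. Spaces ($P_m$ = polynomials of degree $\le m$): $\boldsymbol V_{h,0}^k=\{\hat{\boldsymbol v}\circ\boldsymbol M_h^{-1}:\hat{\boldsymbol v}\in\boldsymbol H_0^1(\widehat\Omega_h),\hat{\boldsymbol v}|_{\hat K}\in(P_k(\hat K))^3\ \forall\hat K\in\widehat{\mathcal T}_h\}$; $Q_h^{k-1}=\{\hat q\circ\boldsymbol M_h^{-1}:\hat q\in H^1(\widehat\Omega_h),\hat q|_{\hat K}\in P_{k-1}(\hat K)\ \forall\hat K\}$; $\boldsymbol D_h^{k-1}=\{(\tfrac1{\det\mathbb J_{\boldsymbol M_h}}\mathbb J_{\boldsymbol M_h}\hat{\boldsymbol d})\circ\boldsymbol M_h^{-1}:\hat{\boldsymbol d}\in\boldsymbol H(\operatorname{div},\widehat\Omega_h),\hat{\boldsymbol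 d}|_{\hat K}\in(P_{k-1}(\hat K))^3\ \forall\hat K\}$; $S_h^{k-2}=\{\hat\varphi\circ\boldsymbol M_h^{-1}:\hat\varphi\in L^2(\widehat\Omega_h),\hat\varphi|_{\hat K}\in P_{k-2}(\hat K)\ \forall\hat K\}$. $(\cdot,\cdot)_h$ is the $L^2(\Omega_h)$ inner product; $R_e,\alpha,\gamma>0$ are constants; $\boldsymbol B\in\boldsymbol L^\infty(\Omega_h)$; $\boldsymbol f_h,\boldsymbol g_h\in\boldsymbol L^2(\Omega_h)$ are given; $\mathcal O(\boldsymbol w;\boldsymbol u,\boldsymbol v)_h=\frac12(\boldsymbol w\cdot\nabla\boldsymbol u,\boldsymbol v)_h-\frac12(\boldsymbol w\cdot\nabla\boldsymbol v,\boldsymbol u)_h$. *)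

(* Defs.v *)
From HB Require Import structures.
From mathcomp Require Import all_boot all_order all_algebra.
From mathcomp Require Import all_classical all_reals all_analysis.
From mathcomp Require mpoly. Import -(notations) mpoly.
Set Implicit Arguments.
Unset Strict Implicit.
Unset Printing Implicit Defensive.
Import Order.TTheory GRing.Theory Num.Theory numFieldNormedType.Exports.
Local Open Scope classical_set_scope.
Local Open Scope ring_scope.

(* Points and vectors of R^3 are row vectors 'rV[R]_3.  The library's        *)
(* jacobian is made for row vectors: 'D_v M x = v *m jacobian M x, i.e. it   *)
(* is the transpose of the usual Jacobian matrix DM(x), and DM(x) d is       *)
(* written d *m jacobian M x.                                                *)

(* Lebesgue measure on R^3 is the product measure on R * R * R; subsets of   *)
(* and functions on 'rV[R]_3 are pulled back along the isomorphism row3.     *)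
Notation leb3 R :=
  ((@lebesgue_measure R \x @lebesgue_measure R) \x @lebesgue_measure R)%E.

Section Space3.
Variable R : realType.
Implicit Types (U : set 'rV[R]_3) (f g : 'rV[R]_3 -> R)
  (u v w : 'rV[R]_3 -> 'rV[R]_3).

Definition row3 (p : measurableTypeR R * measurableTypeR R * measurableTypeR R)
    : 'rV[R]_3 :=
  \row_(i < 3) nth 0 [:: p.1.1; p.1.2; p.2] i.

Definition dotv (a b : 'rV[R]_3) : R := \sum_(i < 3) a 0 i * b 0 i.

(* The indices i + 1 and i + 2 are taken modulo 3. *)
Definition crossv (a b : 'rV[R]_3) : 'rV[R]_3 :=
  \row_(i < 3) (a 0 (i + 1) * b 0 (i + 2%:R) - a 0 (i + 2%:R) * b 0 (i + 1)).

Definition enorm (a : 'rV[R]_3) : R := Num.sqrt (dotv a a).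

Definition meas3 U f := measurable_fun (row3 @^-1` U) (f \o row3).

Definition int3 U f : R := (\int[leb3 R]_(p in row3 @^-1` U) f (row3 p))%R.

Definition ae3 U (P : 'rV[R]_3 -> Prop) : Prop :=
  {ae leb3 R, forall p, U (row3 p) -> P (row3 p)}.

(* Elements of L^2 and L^oo are represented by measurable functions whose    *)
(* values outside U are irrelevant.                                          *)
Definition L2 U f : Prop :=
  meas3 U f /\
  (leb3 R).-integrable (row3 @^-1` U) (fun p => ((f (row3 p)) ^+ 2)%:E).

Definition Linfty U f : Prop :=
  meas3 U f /\ exists C : R, ae3 U (fun x => `|f x| <= C).

Definition comp v (i : 'I_3) : 'rV[R]_3 -> R := fun x => v x 0 i.

Definition L2v U v : Prop := forall i, L2 U (comp v i).
Definition Linftyv U v : Prop := forall i, Linfty U (comp v i).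

Definition ip U f g : R := int3 U (fun x => f x * g x).
Definition ipv U u v : R := int3 U (fun x => dotv (u x) (v x)).
Definition ipm U (F G : 'rV[R]_3 -> 'M[R]_3) : R :=
  int3 U (fun x => \sum_(i < 3) \sum_(j < 3) F x i j * G x i j).

Definition pderiv (i : 'I_3) f : 'rV[R]_3 -> R := fun x => 'D_(delta_mx 0 i) f x.
Definition grad f : 'rV[R]_3 -> 'rV[R]_3 := fun x => \row_i pderiv i f x.

Fixpoint Cn (n : nat) f : Prop :=
  continuous f /\
  if n is m.+1 then
    forall i : 'I_3, (forall x, derivable f x (delta_mx 0 i)) /\ Cn m (pderiv i f)
  else True.

Definition test_fun U f : Prop :=
  [/\ forall n, Cn n f,
      compact (closure [set x | f x != 0]) &
      closure [set x | f x != 0] `<=` U].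

Definition is_wpartial U (i : 'I_3) f g : Prop :=
  forall psi, test_fun U psi -> ip U f (pderiv i psi) = - ip U g psi.

(* v and its distributional divergence g are both in L^2(U). *)
Definition is_wdiv U v g : Prop :=
  [/\ L2v U v, L2 U g &
      forall psi, test_fun U psi -> ipv U v (grad psi) = - ip U g psi].

Definition H1 U f : Prop :=
  L2 U f /\ forall i, exists g, L2 U g /\ is_wpartial U i f g.
Definition Hdiv U v : Prop := exists g, is_wdiv U v g.

(* The weak derivatives of f in H^1 and the weak divergence of v in H(div),  *)
(* unique up to null sets (and 0 outside these spaces).                      *)
Definition wpartial U (i : 'I_3) f : 'rV[R]_3 -> R :=
  xget (fun=> 0) [set g | L2 U g /\ is_wpartial U i f g].
Definition wdiv U v : 'rV[R]_3 -> R := xget (fun=> 0) [set g | is_wdiv U v g].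

(* Entry (i, j) of the gradient is the j-th derivative of v_i. *)
Definition wgrad U v : 'rV[R]_3 -> 'M[R]_3 :=
  fun x => \matrix_(i, j) wpartial U j (comp v i) x.

(* Closure of the test functions in H^1. *)
Definition H10 U f : Prop :=
  H1 U f /\
  forall e : R, 0 < e -> exists psi, test_fun U psi /\
    int3 U (fun x => (f x - psi x) ^+ 2) +
    \sum_(i < 3) int3 U (fun x => (wpartial U i f x - pderiv i psi x) ^+ 2) < e.

(* All weak derivatives of f on U of order at most k are bounded by C. *)
Fixpoint Wkinf (k : nat) U (C : R) f : Prop :=
  [/\ meas3 U f, ae3 U (fun x => `|f x| <= C) &
      if k is m.+1 then
        forall i, exists g, is_wpartial U i f g /\ Wkinf m U C g
      else True].

Definition trilin U w u v : R :=
  2^-1 * ipv U (fun x => w x *m (wgrad U u x)^T) v -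
  2^-1 * ipv U (fun x => w x *m (wgrad U v x)^T) u.

Definition poly_on (m : nat) U f : Prop :=
  exists p : mpoly 3 R, (mmeasure mdeg p <= m.+1)%N /\
    forall x, U x -> f x = meval (x 0) p.
Definition polyv_on (m : nat) U v : Prop := forall i, poly_on m U (comp v i).

End Space3.

Section Mesh.
Variable R : realType.
Implicit Types (K L : 'M[R]_(4, 3)) (T : seq 'M[R]_(4, 3)).

(* A tetrahedron is given by the 4 x 3 matrix whose rows are its vertices;   *)
(* a mesh is a finite sequence of tetrahedra.                                *)
Definition nondegenerate K : Prop :=
  forall c : 'rV[R]_4, \sum_(i < 4) c 0 i = 0 -> c *m K = 0 -> c = 0.

Definition barycentric (c : 'rV[R]_4) : Prop :=
  (forall i, 0 <= c 0 i) /\ \sum_(i < 4) c 0 i = 1.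

Definition tet K : set 'rV[R]_3 :=
  [set x | exists c, barycentric c /\ x = c *m K].

(* Convex hull of the vertices of K that are also vertices of L. *)
Definition common_face K L : set 'rV[R]_3 :=
  [set x | exists c, [/\ barycentric c,
     forall i, (forall j, row i K != row j L) -> c 0 i = 0 & x = c *m K]].

Definition conforming T : Prop :=
  forall K L, K \in T -> L \in T -> tet K `&` tet L = common_face K L.

Definition region T : set 'rV[R]_3 := [set x | exists2 K, K \in T & tet K x].

(* The open polyhedral domain occupied by the mesh. *)
Definition Omega_hat T : set 'rV[R]_3 := (region T)°.

Definition diam (A : set 'rV[R]_3) : R :=
  sup [set r | exists x y, [/\ A x, A y & r = enorm (x - y)]].

Definition inradius (A : set 'rV[R]_3) : R :=
  sup [set r | 0 <= r /\ exists c, forall y, enorm (y - c) <= r -> A y].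

Definition mesh_size T : R := \big[Num.max/0]_(K <- T) diam (tet K).

(* sigma is the shape-regularity constant, tau that of quasi-uniformity. *)
Record admissible_mesh (sigma tau h : R) T : Prop := AdmissibleMesh {
  am_nondeg : forall K, K \in T -> nondegenerate K;
  am_conforming : conforming T;
  am_nonempty : Omega_hat T !=set0;
  am_connected : connected (Omega_hat T);
  am_size : h = mesh_size T;
  am_shape : forall K, K \in T -> diam (tet K) <= sigma * inradius (tet K);
  am_quasi_unif : forall K, K \in T -> h <= tau * diam (tet K)
}.

(* Minv is the inverse of M, seen as a bijection from the closed meshed      *)
(* region onto its image.                                                    *)
Record admissible_map (k : nat) (C delta : R) T
    (M Minv : 'rV[R]_3 -> 'rV[R]_3) : Prop := AdmissibleMap {
  ap_cont : {within region T, continuous M};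
  ap_poly : forall K, K \in T -> polyv_on k (tet K) M;
  ap_bij : forall x, region T x -> Minv (M x) = x;
  ap_jac : forall K, K \in T -> forall i j,
    Wkinf k (tet K)° C (fun x => jacobian M x i j);
  ap_jac_inv : forall K, K \in T -> forall i j,
    Wkinf k (M @` (tet K)°) C (fun y => jacobian Minv y i j);
  ap_det : forall K, K \in T -> forall x, (tet K)° x ->
    delta <= \det (jacobian M x)
}.

Definition Omega T (M : 'rV[R]_3 -> 'rV[R]_3) : set 'rV[R]_3 :=
  M @` Omega_hat T.

Definition piola (M d : 'rV[R]_3 -> 'rV[R]_3) : 'rV[R]_3 -> 'rV[R]_3 :=
  fun x => (\det (jacobian M x))^-1 *: (d x *m jacobian M x).

Section Spaces.
Variables (T : seq 'M[R]_(4, 3)) (M Minv : 'rV[R]_3 -> 'rV[R]_3).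

(* Piecewise polynomials are functions up to null sets, hence prescribed     *)
(* only in the interiors of the elements.                                    *)
Definition pw_poly (m : nat) (q : 'rV[R]_3 -> R) : Prop :=
  forall K, K \in T -> poly_on m (tet K)° q.
Definition pw_polyv (m : nat) (v : 'rV[R]_3 -> 'rV[R]_3) : Prop :=
  forall K, K \in T -> polyv_on m (tet K)° v.

Definition V_space (k : nat) (v : 'rV[R]_3 -> 'rV[R]_3) : Prop :=
  exists vh : 'rV[R]_3 -> 'rV[R]_3,
    [/\ forall i, H10 (Omega_hat T) (comp vh i), pw_polyv k vh &
        forall y, Omega T M y -> v y = vh (Minv y)].

Definition Q_space (m : nat) (q : 'rV[R]_3 -> R) : Prop :=
  exists qh : 'rV[R]_3 -> R,
    [/\ H1 (Omega_hat T) qh, pw_poly m qh &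
        forall y, Omega T M y -> q y = qh (Minv y)].

(* The Jacobian of M is not defined on the faces of the elements; there the  *)
(* values of d are arbitrary, subject to measurability.                      *)
Definition D_space (m : nat) (d : 'rV[R]_3 -> 'rV[R]_3) : Prop :=
  exists dh : 'rV[R]_3 -> 'rV[R]_3,
    [/\ Hdiv (Omega_hat T) dh, pw_polyv m dh,
        forall i, meas3 (Omega T M) (comp d i) &
        forall K, K \in T -> forall y, (M @` (tet K)°) y ->
          d y = piola M dh (Minv y)].

Definition S_space (m : nat) (s : 'rV[R]_3 -> R) : Prop :=
  exists sh : 'rV[R]_3 -> R,
    [/\ L2 (Omega_hat T) sh, pw_poly m sh &
        forall y, Omega T M y -> s y = sh (Minv y)].

End Spaces.
End Mesh.

(* Main.v *)
(* Let dh be the pull-back of J to the mesh and q its elementwise divergence, a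
   piecewise polynomial of degree at most k - 2.  The pull-back w of a test
   function psi on Omega_h is Lipschitz with compact support in the meshed
   domain.  Since the faces of the elements and their images are null sets, the
   Piola transform gives
     int J . grad psi = int dh . grad w = - int q w,
   because dh lies in H(div) and w is a limit of test functions whose gradients
   converge boundedly, pointwise inside the elements.  So div J is
   (q / det) o M^-1, and the last discrete equation, tested with q o M^-1, which
   belongs to the scalar space, says that int q^2 = 0.  Hence int q w = 0 for
   every psi.

   Approximation is by the quasi-interpolants sum_z w(z / n) eta(n x - z), where
   the translates of the smooth bump eta reproduce affine functions, so that
   gradients converge wherever w is differentiable and no mollification is
   needed.  The change of variables formula comes from Riemann sums: the image
   of a small cube lies between two slightly dilated copies of its image under
   the linearized map. *)

(* The obstacle is that [M] and [dh] are smooth only inside the elements: a pulled-back test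
   function has kinks along the faces and [q] jumps across them. No trace or jump on a face is ever
   computed. Membership of [dh] in H(div) enters through its weak divergence [gh], in two ways. Test
   functions supported inside the elements show that [gh] and [q] have the same integrals against
   every bounded continuous function on the open elements. Test functions crossing the faces, taken
   as approximations of a pull-back, then bring in [gh] where elementwise integration by parts would
   leave face terms. The weak divergence of [J] is a chosen representative, so its existence must be
   proved before the discrete equation can be used. It is never identified pointwise: the
   discontinuous function [q o M^-1] is itself approximated by test functions, on the image of the
   open elements. The integral of [q^2] carries no weight because the factor [1 / det] in the
   divergence of a Piola transform cancels the Jacobian determinant; hence a scalar space without
   such a factor is the right one to test with. *)
From HB Require Import structures.
Require Import Defs.
From mathcomp Require Import all_boot all_order all_algebra perm.
From mathcomp Require Import all_classical all_reals all_analysis.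
From mathcomp Require mpoly.
Import -(notations) mpoly.
From mathcomp Require Import measurable_realfun ring lra.
Set Implicit Arguments.
Unset Strict Implicit.
Unset Printing Implicit Defensive.
Import Order.TTheory GRing.Theory Num.Theory numFieldNormedType.Exports.
Local Open Scope classical_set_scope.
Local Open Scope ring_scope.

(** * Lebesgue measure on R^3 under linear maps *)

Section Pushforward.
Context {R : realType} d1 d2 (T1 : measurableType d1) (T2 : measurableType d2).
Variables (m : {measure set T1 -> \bar R}) (f : T1 -> T2).
Hypothesis mf : measurable_fun setT f.

Definition image_measure : {measure set T2 -> \bar R} :=
  measure_function_pushforward__canonical__measure_function_Measure m mf.

Lemma image_measureE A : image_measure A = m (f @^-1` A). Proof. by []. Qed.
End Pushforward.

(** Cavalieri's principle: the product measure integrates the measures of the sections. It serves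
    shears in the last coordinate, which scale every section by the same factor. *)
Lemma product_measure1_scale (R : realType) d1 d2 (T1 : measurableType d1)
    (T2 : measurableType d2) (m1 : {measure set T1 -> \bar R})
    (m2 : {sigma_finite_measure set T2 -> \bar R}) (A B : set (T1 * T2)) (c : R) :
  0 <= c -> measurable A ->
  (forall x, m2 (xsection B x) = c%:E * m2 (xsection A x))%E ->
  ((m1 \x m2) B = c%:E * (m1 \x m2) A)%E.
Proof.
move=> c0 mA AB; rewrite /product_measure1 -ge0_integralZl_EFin//.
- by apply: eq_integral => x _; exact: AB.
- exact: measurable_fun_xsection.
Qed.

Section Volume.
Context {R : realType}.
Notation E := ('rV[R]_3).
Notation mR := (measurableTypeR R).
Notation X := (mR * mR * mR)%type.
Notation leb := (@lebesgue_measure R).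
Notation mu := (leb3 R).

Definition mset (A : set E) : Prop := measurable (@row3 R @^-1` A).
Definition vol (A : set E) : \bar R := mu (@row3 R @^-1` A).
Definition coords (x : E) : X := (x 0 0, x 0 1, x 0 2%:R).
Definition box (A : 'I_3 -> set R) : set E := [set x | forall i, A i (x 0 i)].

Lemma ord3P (P : 'I_3 -> Prop) : P 0 -> P 1 -> P 2%:R -> forall i, P i.
Proof.
move=> P0 P1 P2 [[|[|[|//]]] h].
- by rewrite (_ : Ordinal h = 0)//; exact/val_inj.
- by rewrite (_ : Ordinal h = 1)//; exact/val_inj.
- by rewrite (_ : Ordinal h = 2%:R)//; exact/val_inj.
Qed.

Lemma row3_0 (p : X) : row3 p 0 0 = p.1.1. Proof. by rewrite mxE. Qed.

Lemma row3_1 (p : X) : row3 p 0 1 = p.1.2. Proof. by rewrite mxE. Qed.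

Lemma row3_2 (p : X) : row3 p 0 2%:R = p.2. Proof. by rewrite mxE. Qed.

Lemma coordsK : cancel coords (@row3 R).
Proof. by move=> x; apply/rowP; apply: ord3P; rewrite mxE. Qed.

Lemma row3K : cancel (@row3 R) coords.
Proof. by move=> [[a b] c]; rewrite /coords row3_0 row3_1 row3_2. Qed.

Lemma row3_box (A : 'I_3 -> set R) :
  @row3 R @^-1` box A = (A 0 `*` A 1) `*` A 2%:R.
Proof.
rewrite eqEsubset; split => [p /= bp|[[a b] c] /= [[A0 A1] A2]].
  by have := (bp 0, bp 1, bp 2%:R); rewrite row3_0 row3_1 row3_2 => -[[]].
by apply: ord3P; rewrite !mxE.
Qed.

Lemma sum3E (V : nmodType) (F : 'I_3 -> V) :
  \sum_i F i = F 0 + F 1 + F 2%:R.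
Proof.
rewrite !big_ord_recr big_ord0 /= add0r; congr (F _ + F _ + F _); exact/val_inj.
Qed.

Lemma measurable_row3_coord i : measurable_fun setT (fun p : X => row3 p 0 i : mR).
Proof.
move: i; apply: ord3P; under eq_fun do rewrite ?(row3_0, row3_1, row3_2).
- by apply: (measurableT_comp (f := fst)) => //; exact: measurable_fst.
- by apply: (measurableT_comp (f := snd)) => //; exact: measurable_snd.
- exact: measurable_snd.
Qed.

Lemma measurable_coords d (T : measurableType d) (F : T -> E) :
  (forall i, measurable_fun setT (fun p => F p 0 i : mR)) ->
  measurable_fun setT (coords \o F).
Proof.
move=> mF; apply: measurable_fun_pair; last exact: mF.
by apply: measurable_fun_pair; exact: mF.
Qed.

Lemma mset_box (A : 'I_3 -> set R) :
  (forall i, measurable (A i : set mR)) -> mset (box A).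
Proof.
by move=> mA; rewrite /mset row3_box; apply: measurableX => //; exact: measurableX.
Qed.

Lemma vol_box (A : 'I_3 -> set R) : (forall i, measurable (A i : set mR)) ->
  vol (box A) = (\prod_i leb (A i))%E.
Proof.
move=> mA; rewrite /vol row3_box.
rewrite [LHS](product_measure1E (leb \x leb)%E leb) //; last exact: measurableX.
rewrite [X in (X * _)%E](product_measure1E leb leb) // !big_ord_recr big_ord0 /= mul1e.
by congr (leb (A _) * leb (A _) * leb (A _))%E; exact/val_inj.
Qed.

Section BoxSystem.
Let G : set (set X) := [set C | exists A : 'I_3 -> set R,
  (forall i, measurable (A i : set mR)) /\ C = @row3 R @^-1` box A].

Let mG : @measurable _ X = <<s G >>.
Proof.
rewrite eqEsubset; split; last first.
  apply: smallest_sub; first exact: sigma_algebra_measurable.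
  by move=> _ [A [mA ->]]; exact: mset_box.
have GX (A B C : set R) : measurable (A : set mR) -> measurable (B : set mR) ->
    measurable (C : set mR) -> G ((A `*` B) `*` C).
  move=> mA mB mC; exists (fun i => nth setT [:: A; B; C] i); split.
    by move=> [[|[|[|//]]] h] /=.
  by rewrite row3_box.
rewrite measurable_prod_measurableType; apply: smallest_sub.
  exact: smallest_sigma_algebra.
move=> _ [A mA [C mC <-]].
have -> : A `*` C = (fst @^-1` A) `&` (setT `*` C).
  by rewrite eqEsubset; split => [[a c] [] //|[a c] [/= ? []]].
apply: (@measurableI _ (g_sigma_algebraType G)); last first.
  by apply: sub_gen_smallest; rewrite -setXTT; exact: GX.
move: A mA.
(* Good sets: the plane sets whose cylinder lies in the generated sigma-algebra form a sigma-algebra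
   containing the rectangles. *)
suff H : @measurable _ (mR * mR)%type `<=` [set A | <<s G >> (fst @^-1` A)].
  by move=> A /H.
rewrite measurable_prod_measurableType; apply: smallest_sub.
  split => /=.
  - by rewrite preimage_set0; exact: (@measurable0 _ (g_sigma_algebraType G)).
  - move=> A; rewrite setTD preimage_setC.
    exact: (@measurableC _ (g_sigma_algebraType G)).
  - move=> F mF; rewrite preimage_bigcup.
    exact: (@bigcupT_measurable _ (g_sigma_algebraType G)).
move=> _ [A mA [B mB <-]] /=; apply: sub_gen_smallest.
have -> : (fst @^-1` (A `*` B) : set X) = (A `*` B) `*` setT.
  by rewrite eqEsubset; split => [[[a b] c] //=|[[a b] c] /= []].
exact: GX.
Qed.

(* The boxes form a pi-system generating the Borel sets of the triple product. *)
Lemma leb3_unique (m : {measure set X -> \bar R}) :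
  (forall A : 'I_3 -> set R, (forall i, measurable (A i : set mR)) ->
    m (@row3 R @^-1` box A) = (\prod_i leb (A i))%E) ->
  forall A : set E, mset A -> vol A = m (@row3 R @^-1` A).
Proof.
move=> mbox A; apply: (@measure_unique _ _ _ G
  (fun n => @row3 R @^-1` box (fun=> `[-n%:R, n%:R]%classic))) => //.
- move=> _ _ [B [mB ->]] [C [mC ->]]; exists (fun i => B i `&` C i); split.
    by move=> i; exact: measurableI.
  rewrite eqEsubset; split => [p [bB bC] i|p bBC]; first by split; [exact: bB|exact: bC].
  by split => i; have [] := bBC i.
- by move=> n; exists (fun=> `[-n%:R, n%:R]%classic); split.
- rewrite -subTset => p _; pose N := Num.bound (\sum_i `|row3 p 0 i|).
  exists N => //= i.
  change (is_true (row3 p 0 i \in `[- N%:R, N%:R])).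
  rewrite in_itv /= -ler_norml ltW// (le_lt_trans _ (archi_boundP _)) ?sumr_ge0//.
  by rewrite (bigD1 i)//= lerDl sumr_ge0.
- by move=> B [C [mC ->]]; rewrite [LHS]vol_box// mbox.
- move=> k; rewrite [X in (X < _)%E](vol_box (A := fun=> `[-k%:R, k%:R]%classic))//.
  have -> : leb `[-k%:R, k%:R]%classic = (k%:R + k%:R)%:E.
    rewrite (lebesgue_measure_itv `[-k%:R, k%:R : R]) /= lte_fin.
    case: ifPn => [_|]; first by rewrite -EFinD opprK.
    rewrite -leNgt => k0; congr EFin; have := ler0n R k; lra.
  by rewrite !big_ord_recr big_ord0 /= -!EFinM ltry.
Qed.

End BoxSystem.

Lemma leb_affine (a b : R) (A : set R) : a != 0 -> measurable (A : set mR) ->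
  leb ((fun x => a * x + b) @^-1` A) = (`|a|^-1%:E * leb A)%E.
Proof.
move=> a0 mA.
have mf : measurable_fun setT ((fun x => a * x + b) : mR -> mR).
  by apply: measurable_funD => //; exact: measurable_funM.
have an : (0 <= `|a|) by [].
pose m := [the {measure set _ -> \bar R} of mscale (NngNum an) (image_measure leb mf)].
suff /(_ _ mA) -> : forall B, measurable (B : set mR) -> leb B = m B.
  by rewrite /m /= /mscale /= muleA -EFinM mulVf ?normr_eq0// mul1e.
apply: lebesgue_measure_unique => _ [[x y] /= _ <-].
rewrite /m /= /mscale /= (image_measureE leb mf).
have [a_gt0|a_lt0|] := ltgtP 0 a; last by move=> a_0; rewrite -a_0 eqxx in a0.
  have -> : (fun t : R => a * t + b) @^-1` `]x, y]%classic =
      `](x - b) / a, (y - b) / a]%classic.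
    apply/seteqP; split => z /=; rewrite !in_itv /= ltr_pdivrMr// ler_pdivlMr//.
      by move=> /andP[? ?]; apply/andP; split; lra.
    by move=> /andP[? ?]; apply/andP; split; lra.
  rewrite (lebesgue_measure_itv `]x, y]) [X in (_ * X)%E](lebesgue_measure_itv `](x - b) / a, (y - b) / a]).
  rewrite /= !lte_fin ltr_pM2r ?invr_gt0// ltrD2r.
  case: ifPn => _; last by rewrite mule0.
  by rewrite -!EFinD -EFinM gtr0_norm//; congr EFin; field; rewrite gt_eqF.
(* A negative slope exchanges the end points, so the preimage of a left-open interval is right-open;
   the length is the same. *)
have -> : (fun t : R => a * t + b) @^-1` `]x, y]%classic =
    `[(y - b) / a, (x - b) / a[%classic.
  apply/seteqP; split => z /=; rewrite !in_itv /= ltr_ndivlMr// ler_ndivrMr//.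
    by move=> /andP[? ?]; apply/andP; split; lra.
  by move=> /andP[? ?]; apply/andP; split; lra.
rewrite (lebesgue_measure_itv `]x, y]) [X in (_ * X)%E](lebesgue_measure_itv `[(y - b) / a, (x - b) / a[).
rewrite /= !lte_fin ltr_nM2r ?invr_lt0// ltrD2r.
case: ifPn => _; last by rewrite mule0.
by rewrite -!EFinD -EFinM ltr0_norm//; congr EFin; field; rewrite lt_eqF.
Qed.

Lemma row3_preimage (A : set E) (F : E -> E) :
  @row3 R @^-1` (F @^-1` A) = (coords \o F \o @row3 R) @^-1` (@row3 R @^-1` A).
Proof. by rewrite eqEsubset; split => p /=; rewrite coordsK. Qed.

Definition mmap (F : E -> E) :=
  forall i, measurable_fun setT (fun p : X => F (row3 p) 0 i : mR).

Lemma mset_preimage (A : set E) (F : E -> E) : mmap F -> mset A -> mset (F @^-1` A).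
Proof.
move=> mF mA; rewrite /mset row3_preimage -[X in measurable X]setTI.
have /= := @measurable_coords _ _ (F \o @row3 R) mF; apply => //.
Qed.

(** Both sides are measures in [A]: the volume, and [c] times a pushforward of it. Agreement on
    boxes suffices, and translations and permutations pull boxes back to boxes. *)
Lemma scales_box (F : E -> E) (c : R) : 0 <= c -> mmap F ->
  (forall A : 'I_3 -> set R, (forall i, measurable (A i : set mR)) ->
    (\prod_i leb (A i) = c%:E * vol (F @^-1` box A))%E) ->
  forall A : set E, mset A -> vol A = (c%:E * vol (F @^-1` A))%E.
Proof.
move=> c0 mF h A mA.
pose mF' := measurable_coords (F := F \o @row3 R) mF.
pose m := [the {measure set X -> \bar R} of mscale (NngNum c0) (image_measure mu mF')].
rewrite (leb3_unique (m := m)) => [|B mB|//]; first by rewrite /vol row3_preimage.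
by rewrite [RHS](h B mB) /vol row3_preimage.
Qed.

Lemma vol_shift (v : E) (A : set E) : mset A -> vol ((fun x => x + v) @^-1` A) = vol A.
Proof.
move=> mA; rewrite -[LHS]mul1e; apply/esym/scales_box => //.
  move=> i; under eq_fun do rewrite mxE.
  by apply: measurable_funD => //; exact: measurable_row3_coord.
move=> B mB; rewrite mul1e.
rewrite (_ : _ @^-1` _ = box (fun i => (fun t => 1 * t + v 0 i) @^-1` B i)); last first.
  rewrite eqEsubset; split => x h i.
    by rewrite /= mul1r; have := h i; rewrite mxE.
  by have := h i; rewrite /= mul1r mxE.
have mf (i : 'I_3) : measurable_fun setT ((fun t => 1 * t + v 0 i) : mR -> mR).
  by apply: measurable_funD => //; exact: measurable_funM.
rewrite vol_box => [|i]; last by rewrite -[X in measurable X]setTI; exact: mf.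
by apply: eq_bigr => i _; rewrite leb_affine ?oner_eq0// normr1 invr1 mul1e.
Qed.

Lemma mmap_mulmx (L : 'M[R]_3) : mmap (fun x => x *m L).
Proof.
move=> i; under eq_fun do rewrite mxE.
by apply: measurable_sum => j; apply: measurable_funM => //; exact: measurable_row3_coord.
Qed.

Lemma vol_perm (s : {perm 'I_3}) (A : set E) : mset A ->
  vol ((fun x => x *m perm_mx s) @^-1` A) = vol A.
Proof.
move=> mA; rewrite -[LHS]mul1e; apply/esym/scales_box => //.
  exact: mmap_mulmx.
move=> B mB; rewrite mul1e.
have xs (x : E) i : (x *m perm_mx s) 0 (s i) = x 0 i.
  by rewrite -[s in perm_mx s]invgK -col_permE mxE permK.
rewrite (_ : _ @^-1` _ = box (B \o s)); last first.
  rewrite eqEsubset; split => x h i; first by rewrite /= -xs; exact: h.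
  by rewrite -[i](permKV s) xs; exact: h.
by rewrite vol_box => [|i] //=; rewrite (reindex_inj (@perm_inj _ s)).
Qed.

(* In the product measure the last coordinate is integrated first. *)
Lemma vol_shear (a b c : R) (A : set E) : c != 0 -> mset A ->
  vol ((fun x : E => \row_j if j == 2%:R then a * x 0 0 + b * x 0 1 + c * x 0 2%:R
                            else x 0 j) @^-1` A) = (`|c|^-1%:E * vol A)%E.
Proof.
move=> c0 mA.
set B := _ @^-1` A.
have h : forall x, (leb (xsection (@row3 R @^-1` B) x) =
    (`|c|^-1)%:E * leb (xsection (@row3 R @^-1` A) x))%E.
  move=> -[x y].
  rewrite -(leb_affine (a * x + b * y) c0)//; last exact: measurable_xsection.
  have rE z : \row_j (if j == 2%:R
      then a * row3 (x, y, z) 0 0 + b * row3 (x, y, z) 0 1 + c * row3 (x, y, z) 0 2%:R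
      else row3 (x, y, z) 0 j) = row3 (x, y, c * z + (a * x + b * y)).
    by apply/rowP; apply: ord3P; rewrite !mxE //= addrC.
  by congr (leb _); rewrite /xsection eqEsubset; split => z; rewrite /= !in_setE /= /B /= rE.
have c1 : (0 <= `|c|^-1) by [].
exact: (@product_measure1_scale R _ _ _ _ (leb \x leb)%E leb (@row3 R @^-1` A)
  (@row3 R @^-1` B) (`|c|^-1) c1 mA h).
Qed.

(* The matrices scaling volumes by their determinant form a group; by the LUP
   decomposition it is generated by permutations and single-column changes. *)
Definition lin_ok (L : 'M[R]_3) := L \in unitmx /\ forall A : set E, mset A ->
  vol ((fun x => x *m L) @^-1` A) = (`|\det L|^-1%:E * vol A)%E.

Lemma lin_ok_mul (L K : 'M[R]_3) : lin_ok L -> lin_ok K -> lin_ok (L *m K).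
Proof.
move=> [uL hL] [uK hK]; split; first by rewrite unitmx_mul uL.
move=> A mA; have -> : (fun x => x *m (L *m K)) @^-1` A =
    (fun x => x *m L) @^-1` ((fun x => x *m K) @^-1` A).
  by rewrite eqEsubset; split => x; rewrite /= mulmxA.
rewrite hL; last exact: mset_preimage (mmap_mulmx K) mA.
by rewrite hK// muleA -EFinM det_mulmx normrM invfM.
Qed.

Lemma lin_ok_perm (s : {perm 'I_3}) : lin_ok (perm_mx s).
Proof.
split=> [|A mA]; first exact: unitmx_perm.
by rewrite vol_perm// det_perm normrX normrN1 expr1n invr1 mul1e.
Qed.

(** Acting on row vectors, this matrix changes only coordinate [j]; for the last coordinate it is
    the map of [vol_shear]. *)
Definition col_mx1 (j : 'I_3) (v : 'I_3 -> R) : 'M[R]_3 :=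
  \matrix_(i, k) if k == j then v i else (i == k)%:R.

Lemma lin_ok_col2 (v : 'I_3 -> R) : v 2%:R != 0 -> lin_ok (col_mx1 2%:R v).
Proof.
move=> v2; have detE : \det (col_mx1 2%:R v) = v 2%:R.
  rewrite -det_tr det_trig; last first.
    apply/is_trig_mxP => i k ik; rewrite !mxE ifF; last first.
      by apply/negbTE; apply: contraTneq ik => ->; rewrite -leqNgt; case: k.
    by rewrite -val_eqE/= gtn_eqF.
  by rewrite !big_ord_recr big_ord0 /= !mxE /= !mul1r; congr v; exact/val_inj.
split => [|A mA]; first by rewrite unitmxE detE unitfE.
rewrite detE -(vol_shear (v 0) (v 1) v2 mA); congr vol.
have xE (x : E) : x *m col_mx1 2%:R v = \row_j (if j == 2%:R
    then v 0 * x 0 0 + v 1 * x 0 1 + v 2%:R * x 0 2%:R else x 0 j).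
  apply/rowP => j; rewrite !mxE sum3E !mxE; case: ifPn => // j2; first by ring.
  by move: j j2; apply: ord3P => //= _; ring.
by rewrite eqEsubset; split => x; rewrite /= xE.
Qed.

(** Conjugation by the transposition of [j] and the last index moves the special column to the last
    place. *)
Lemma lin_ok_col (j : 'I_3) (v : 'I_3 -> R) : v j != 0 -> lin_ok (col_mx1 j v).
Proof.
move=> vj; pose s := tperm j (2%:R : 'I_3).
have -> : col_mx1 j v = perm_mx s *m col_mx1 2%:R (v \o s) *m perm_mx s.
  apply/matrixP => i k; rewrite -row_permE -[X in _ *m perm_mx X]invgK -col_permE.
  rewrite !mxE /= tpermK tpermV (inj_eq (@perm_inj _ s)).
  by rewrite -[k == j](inj_eq (@perm_inj _ s)) tpermL.
apply: lin_ok_mul; last exact: lin_ok_perm.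
by apply: lin_ok_mul; [exact: lin_ok_perm|apply: lin_ok_col2; rewrite /= tpermR].
Qed.

Lemma lup_decomposition n (L : 'M[R]_n.+1) : exists s A B,
    [/\ perm_mx s *m L = A *m B, \det A = 1,
        forall i j : 'I_n.+1, (i <= j)%N -> A i j = (i == j)%:R &
        forall i j : 'I_n.+1, (j < i)%N -> B i j = 0].
Proof.
have := @cormen_lup_correct _ _ L; have := cormen_lup_perm L.
have := cormen_lup_lower L; have := cormen_lup_upper L; have := cormen_lup_detL L.
case: (cormen_lup L) => -[P A] B /= dA hB hA pP PL.
by have /is_perm_mxP[s sP] := pP; exists s, A, B; rewrite -sP.
Qed.

Lemma lin_ok_unit (L : 'M[R]_3) : L \in unitmx -> lin_ok L.
Proof.
move=> uL; have [s [A [B [PL dA hA hB]]]] := lup_decomposition L.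
have -> : L = perm_mx s^-1 *m (A *m B).
  by rewrite -PL mulmxA -perm_mxM mulVg perm_mx1 mul1mx.
have uB : B \in unitmx.
  move: uL; rewrite !unitmxE -(mul1r (\det B)) -dA -det_mulmx -PL det_mulmx.
  by rewrite -unitmxE => uL; rewrite unitrM -!unitmxE unitmx_perm.
have Bi i : B i i != 0.
  move: uB; rewrite unitmxE -det_tr det_trig; last first.
    by apply/is_trig_mxP => k l kl; rewrite mxE hB.
  rewrite unitfE; apply: contraNneq => Bi0; rewrite (bigD1 i)//= mxE Bi0 mul0r //.
apply: lin_ok_mul; first exact: lin_ok_perm.
apply: lin_ok_mul.
(* A triangular matrix is the product of its single-column matrices, from left to right if it is
   lower triangular and from right to left if upper. The last column of [A] is trivial and
   contributes no factor. *)
- have -> : A = col_mx1 0 (A^~ 0) *m col_mx1 1 (A^~ 1).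
    apply/matrixP => i k; rewrite mxE sum3E !mxE.
    by move: i k; apply: ord3P; apply: ord3P; rewrite /= ?(hA 0 0)// ?(hA 0 1)// ?(hA 0 2%:R)//
      ?(hA 1 1)// ?(hA 1 2%:R)// ?(hA 2%:R 2%:R)//=; ring.
  by apply: lin_ok_mul; apply: lin_ok_col; rewrite hA //= oner_eq0.
- have -> : B = col_mx1 2%:R (B^~ 2%:R) *m col_mx1 1 (B^~ 1) *m col_mx1 0 (B^~ 0).
    apply/matrixP => i k; rewrite mxE sum3E !mxE !sum3E !mxE.
    by move: i k; apply: ord3P; apply: ord3P; rewrite /=;
      rewrite ?(hB 1 0)// ?(hB 2%:R 0)// ?(hB 2%:R 1)//; ring.
  by do 2?apply: lin_ok_mul; exact: lin_ok_col.
Qed.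

Lemma vol_linear (L : 'M[R]_3) (A : set E) : L \in unitmx -> mset A ->
  vol ((fun x => x *m L) @^-1` A) = (`|\det L|^-1%:E * vol A)%E.
Proof. by move=> /lin_ok_unit[_]; exact. Qed.

End Volume.

(** * Integration over subsets of R^3 *)

Section MeasurePreserving.
Context {R : realType} d (T : measurableType d) (m : {measure set T -> \bar R}).
Variables (phi : T -> T) (f : T -> R).
Hypothesis mphi : measurable_fun setT phi.
Hypothesis phiE : forall A, measurable A -> m (phi @^-1` A) = m A.
Hypothesis fi : m.-integrable setT (EFin \o f).

Lemma Rintegral_measure_preserving :
  (\int[m]_x f (phi x) = \int[m]_x f x)%R.
Proof.
have /integrableP[mf foo] := fi.
have fphi : m.-integrable (phi @^-1` setT) ((EFin \o f) \o phi).
  rewrite preimage_setT; apply/integrableP; split; first exact: measurableT_comp.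
  apply: le_lt_trans foo.
  rewrite -[X in (_ <= X)%E](@eq_measure_integral _ _ _ _ m (pushforward m phi)) => [|A mA _];
    last exact: phiE.
  have mn : measurable_fun setT (fun x => `|(EFin \o f) x|)%E by exact: measurableT_comp.
  by rewrite (ge0_integral_pushforward mphi m measurableT mn)// preimage_setT.
congr fine; have := integral_pushforward mphi mf fphi measurableT.
rewrite preimage_setT => <-; apply: eq_measure_integral => A mA _; exact: phiE.
Qed.
End MeasurePreserving.

Section MeasureTools.
Context {R : realType}.
Notation E := ('rV[R]_3).
Notation mR := (measurableTypeR R).
Notation X := (mR * mR * mR)%type.
Notation leb := (@lebesgue_measure R).
Notation mu := (leb3 R).
Implicit Types (U V : set E) (f g : E -> R) (c x y : E) (r : R).

Lemma coord_norm x i : `|x 0 i| <= `|x|.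
Proof.
rewrite [leRHS]/Num.norm /= mx_normrE; apply/bigmax_geP; right => /=.
by exists (0, i).
Qed.

Lemma norm_le x r : 0 <= r -> (forall i, `|x 0 i| <= r) -> `|x| <= r.
Proof.
move=> r0 h; rewrite [leLHS]/Num.norm /= mx_normrE; apply/bigmax_leP; split => //=.
by move=> [i j] _ /=; rewrite ord1.
Qed.

Lemma norm_lt x r : 0 < r -> (forall i, `|x 0 i| < r) -> `|x| < r.
Proof.
move=> r0 h; rewrite [ltLHS]/Num.norm /= mx_normrE; apply/bigmax_ltP; split => //=.
by move=> [i j] _ /=; rewrite ord1.
Qed.

Definition cube c r : set E := [set x | forall i, `|x 0 i - c 0 i| <= r].

Lemma cubeP c r x : 0 <= r -> cube c r x <-> `|x - c| <= r.
Proof.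
move=> r0; split => [h|h i].
  by apply: norm_le => // i; rewrite !mxE; exact: h.
by apply: le_trans h; have := coord_norm (x - c) i; rewrite !mxE.
Qed.

Lemma ballE_norm c r : ball c r = [set x | `|x - c| < r].
Proof. by rewrite -ball_normE eqEsubset; split => x /=; rewrite distrC. Qed.

Lemma ball_coord c r x : 0 < r -> ball c r x <-> (forall i, `|x 0 i - c 0 i| < r).
Proof.
move=> r0; rewrite ballE_norm /=; split => [h i|h].
  by apply: le_lt_trans h; have := coord_norm (x - c) i; rewrite !mxE.
by apply: norm_lt => // i; rewrite !mxE; exact: h.
Qed.

(** The norm on row vectors is the maximum norm, so balls are boxes and [cube] is a closed ball. *)
Lemma ball_box c r : 0 < r ->
  ball c r = box (fun i => `]c 0 i - r, c 0 i + r[%classic).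
Proof.
move=> r0; rewrite eqEsubset; split => x.
  move=> /(ball_coord _ _ r0) h i; have := h i; rewrite /= in_itv /= ltr_distl.
  by [].
move=> h; apply/ball_coord => // i; have := h i; rewrite /= in_itv /= ltr_distl.
by [].
Qed.

Lemma cube_box c r : cube c r = box (fun i => `[c 0 i - r, c 0 i + r]%classic).
Proof.
rewrite eqEsubset; split => x h i; have := h i; rewrite /= in_itv /= ler_distl; by [].
Qed.

Lemma mset_ball c r : mset (ball c r).
Proof.
have [r0|r0] := ltP 0 r; first by rewrite ball_box//; exact: mset_box.
rewrite ballE_norm (_ : [set x | _] = set0) ?/mset ?preimage_set0//.
by rewrite -subset0 => x /=; apply/negP; rewrite -leNgt (le_trans r0).
Qed.

Lemma mset_cube c r : mset (cube c r).
Proof. by rewrite cube_box; apply: mset_box. Qed.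

Lemma vol_cube c r : 0 <= r -> vol (cube c r) = ((2 * r) ^+ 3)%:E.
Proof.
move=> r0; rewrite cube_box vol_box//.
rewrite (eq_bigr (fun=> (2 * r)%:E)) => [|i _].
  by rewrite !big_ord_recr big_ord0 /= -!EFinM; congr EFin; ring.
rewrite lebesgue_measure_itv /= lte_fin; case: ifPn => [_|].
  by rewrite -EFinD; congr EFin; ring.
by rewrite -leNgt => h; congr EFin; lra.
Qed.

Lemma mset_setI U V : mset U -> mset V -> mset (U `&` V).
Proof. by move=> mU mV; rewrite /mset preimage_setI; exact: measurableI. Qed.

Lemma mset_setU U V : mset U -> mset V -> mset (U `|` V).
Proof. by move=> mU mV; rewrite /mset preimage_setU; exact: measurableU. Qed.

Lemma mset_setC U : mset U -> mset (~` U).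
Proof. by move=> mU; rewrite /mset -preimage_setC; exact: measurableC. Qed.

Lemma mset_setD U V : mset U -> mset V -> mset (U `\` V).
Proof. by move=> mU mV; rewrite setDE; apply: mset_setI => //; exact: mset_setC. Qed.

Lemma mset_setT : mset [set: E].
Proof. by rewrite /mset preimage_setT. Qed.

Lemma mset_bigcup (I : Type) (F : I -> set E) : countable [set: I] ->
  (forall i, mset (F i)) -> mset (\bigcup_i F i).
Proof.
by move=> cI mF; rewrite /mset preimage_bigcup; exact: countable_bigcupT_measurable.
Qed.

Lemma vol_le U V : mset U -> mset V -> U `<=` V -> (vol U <= vol V)%E.
Proof. by move=> mU mV UV; apply: le_measure; rewrite ?inE// => p /=; exact: UV. Qed.

Lemma vol0_sub U V : mset U -> mset V -> U `<=` V -> vol V = 0%E -> vol U = 0%E.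
Proof.
move=> mU mV UV V0; apply/eqP; rewrite eq_le measure_ge0 andbT -V0; exact: vol_le.
Qed.

(** A countable base of the topology. It links the two structures at play: measurable sets come from
    the product of three lines, open sets from the norm of row vectors. *)
Definition ratball (q : {ffun 'I_3 -> rat} * nat) : set E :=
  ball (\row_i ratr (q.1 i) : E) q.2.+1%:R^-1.

Lemma ratball_near x (e : R) : 0 < e -> exists q, ratball q x /\ ratball q `<=` ball x e.
Proof.
move=> e0; pose n := Num.bound (2 / e).
have ne : n.+1%:R^-1 < e / 2.
  rewrite invf_plt ?posrE ?divr_gt0// invf_div.
  by rewrite (lt_trans (archi_boundP _)) ?ltr_nat// divr_ge0// ltW.
have r0 : 0 < n.+1%:R^-1 :> R by [].
pose d : R := n.+1%:R^-1; rewrite -/d in ne r0.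
have /choice[f fP] i : exists q : rat, `|ratr q - x 0 i| < d.
  have [|q] := @rat_in_itvoo R (x 0 i - d) (x 0 i + d); first by lra.
  by rewrite in_itv /= => qi; exists q; rewrite ltr_distl.
exists ([ffun i => f i], n); split.
  by apply/ball_coord => // i; rewrite /= mxE ffunE distrC.
move=> y /ball_coord /= /(_ r0) yf; apply/ball_coord => // i.
have := yf i; have := fP i; rewrite /= mxE ffunE -/d => h1 h2.
have -> : y 0 i - x 0 i = (y 0 i - ratr (f i)) + (ratr (f i) - x 0 i) by ring.
by rewrite (le_lt_trans (ler_normD _ _))//; lra.
Qed.

Lemma open_ratball U : open U ->
  U = \bigcup_q (if `[< ratball q `<=` U >] then ratball q else set0).
Proof.
move=> oU; rewrite eqEsubset; split => [x Ux|x [q _]].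
  have /nbhs_ballP[e /= e0 xe] : nbhs x U by move: oU; rewrite openE => /(_ x Ux).
  have [q [qx qe]] := ratball_near x e0.
  by exists q => //; rewrite ifT//; apply/asboolP; exact: subset_trans xe.
by case: ifPn => // /asboolP; exact.
Qed.

Lemma mset_open U : open U -> mset U.
Proof.
move=> /open_ratball ->; apply: mset_bigcup => [|q]; first exact: countableP.
by case: ifPn => _; [exact: mset_ball|rewrite /mset preimage_set0].
Qed.

Lemma mset_closed U : closed U -> mset U.
Proof. by rewrite -openC => /mset_open/mset_setC; rewrite setCK. Qed.

Lemma meas3_preimage U f :
  (forall a, mset (U `&` [set x | a < f x])) -> meas3 U f.
Proof.
move=> h; apply: (measurability _ (RGenOInfty.measurableE R)).
move=> _ [_ [a ->] <-].
suff -> : @row3 R @^-1` U `&` (f \o @row3 R) @^-1` `]a, +oo[%classic =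
  @row3 R @^-1` (U `&` [set x | a < f x]) by exact: h.
by rewrite eqEsubset; split => p /=; rewrite in_itv /= andbT.
Qed.

Lemma meas3_open U f : open U -> {in U, continuous f} -> meas3 U f.
Proof.
move=> oU cf; apply: meas3_preimage => a; apply: mset_open.
rewrite openE => x [Ux afx]; apply: filterI; first by move: oU; rewrite openE; exact.
have : nbhs (f x) [set t | a < t] by apply: open_nbhs_nbhs; split => //; exact: open_gt.
by move=> /(cf x (mem_set Ux)).
Qed.

Lemma meas3_preim U f (B : set R) : mset U -> meas3 U f -> measurable (B : set mR) ->
  mset (U `&` f @^-1` B).
Proof. by move=> mU mf mB; have := mf mU B mB. Qed.

Lemma meas3S U V f : mset V -> U `<=` V -> meas3 V f -> meas3 U f.
Proof. by move=> mV UV; apply: measurable_funS => // p; exact: UV. Qed.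

Lemma eq_meas3 U f g : {in U, f =1 g} -> meas3 U f -> meas3 U g.
Proof.
move=> fg; apply: eq_measurable_fun => p; rewrite inE /= => Up.
by rewrite fg// inE.
Qed.

Lemma meas3_cst U (a : R) : meas3 U (fun=> a).
Proof. exact: measurable_cst. Qed.

Lemma meas3D U f g : meas3 U f -> meas3 U g -> meas3 U (fun x => f x + g x).
Proof. exact: measurable_funD. Qed.

Lemma meas3B U f g : meas3 U f -> meas3 U g -> meas3 U (fun x => f x - g x).
Proof. exact: measurable_funB. Qed.

Lemma meas3M U f g : meas3 U f -> meas3 U g -> meas3 U (fun x => f x * g x).
Proof. exact: measurable_funM. Qed.

Lemma meas3_sum (I : Type) (s : seq I) U (F : I -> E -> R) :
  (forall i, meas3 U (F i)) -> meas3 U (fun x => \sum_(i <- s) F i x).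
Proof.
move=> mF; elim: s => [|i s ih].
  by apply: eq_meas3 (@meas3_cst U 0) => x _; rewrite big_nil.
by apply: eq_meas3 (meas3D (mF i) ih) => x _; rewrite big_cons.
Qed.

Definition integ U f := mu.-integrable (@row3 R @^-1` U) (fun p => (f (row3 p))%:E).

Lemma integ_meas3 U f : integ U f -> meas3 U f.
Proof. by move=> /measurable_int/measurable_EFinP. Qed.

Lemma integ_le U f g : mset U -> meas3 U f -> (forall x, U x -> `|f x| <= g x) ->
  integ U g -> integ U f.
Proof.
move=> mU mf fg; apply: le_integrable => //; first exact/measurable_EFinP.
move=> p /= Up; rewrite lee_fin (le_trans (fg _ Up))//; exact: ler_norm.
Qed.

Lemma integ_cst U (a : R) : mset U -> (vol U < +oo)%E -> integ U (fun=> a).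
Proof.
move=> mU fU; apply: measurable_bounded_integrable => //.
exact: bounded_cst.
Qed.

Lemma integ_bounded U f (a : R) : mset U -> (vol U < +oo)%E -> meas3 U f ->
  (forall x, U x -> `|f x| <= a) -> integ U f.
Proof. by move=> mU fU mf fa; apply: (integ_le mU mf fa); exact: integ_cst. Qed.

Lemma integD U f g : mset U -> integ U f -> integ U g -> integ U (fun x => f x + g x).
Proof. by move=> mU fi gi; have := integrableD mU fi gi. Qed.

Lemma integB U f g : mset U -> integ U f -> integ U g -> integ U (fun x => f x - g x).
Proof. by move=> mU fi gi; have := integrableB mU fi gi. Qed.

Lemma integZ U f (a : R) : mset U -> integ U f -> integ U (fun x => a * f x).
Proof. by move=> mU fi; have := integrableZl mU a fi. Qed.

Lemma integ_norm U f : mset U -> integ U f -> integ U (fun x => `|f x|).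
Proof. by move=> mU /integrable_norm. Qed.

Lemma integS U V f : mset U -> mset V -> U `<=` V -> integ V f -> integ U f.
Proof. by move=> mU mV UV; apply: integrableS => // p; exact: UV. Qed.

Lemma eq_integ U f g : mset U -> {in U, f =1 g} -> integ U f -> integ U g.
Proof.
move=> mU fg; apply: (eq_integrable mU) => p; rewrite inE /= => Up.
by rewrite fg// inE.
Qed.

Lemma integ_mulb U f g (a : R) : mset U -> integ U f -> meas3 U g ->
  (forall x, U x -> `|g x| <= a) -> integ U (fun x => f x * g x).
Proof.
move=> mU fi mg ga; apply: (integ_le mU _ _ (integZ a mU (integ_norm mU fi))).
  by apply: meas3M => //; exact: integ_meas3.
by move=> x Ux; rewrite normrM mulrC ler_wpM2r// ga.
Qed.

Lemma L2_integ U f : mset U -> (vol U < +oo)%E -> L2 U f -> integ U f.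
Proof.
move=> mU fU [mf f2]; have fi : integ U (fun x => f x ^+ 2) by [].
apply: (integ_le mU mf _ (integD mU (integ_cst 1 mU fU) fi)) => x _.
(* The squares of [t - 1] and [t + 1] being nonnegative, [|t| <= 1 + t ^+ 2]. *)
have := sqr_ge0 (f x - 1); have := sqr_ge0 (f x + 1); have := sqr_ge0 (f x).
rewrite ler_norml !expr2; set t := f x => h0 h1 h2; apply/andP; split; lra.
Qed.

Lemma L2_bounded U f (a : R) : mset U -> (vol U < +oo)%E -> meas3 U f ->
  (forall x, U x -> `|f x| <= a) -> L2 U f.
Proof.
move=> mU fU mf fa; split => //.
suff : integ U (fun x => f x ^+ 2) by [].
apply: (integ_bounded (a := a ^+ 2)) => //.
  by under eq_fun do rewrite expr2; exact: meas3M.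
by move=> x Ux; rewrite normrX ler_sqr ?nnegrE ?fa// (le_trans _ (fa _ Ux)).
Qed.

Lemma eq_int3 U f g : {in U, f =1 g} -> int3 U f = int3 U g.
Proof. by move=> fg; apply: eq_Rintegral => p; rewrite inE /= => Up; rewrite fg// inE. Qed.

Lemma int3D U f g : mset U -> integ U f -> integ U g ->
  int3 U (fun x => f x + g x) = int3 U f + int3 U g.
Proof. by move=> mU fi gi; exact: RintegralD. Qed.

Lemma int3B U f g : mset U -> integ U f -> integ U g ->
  int3 U (fun x => f x - g x) = int3 U f - int3 U g.
Proof. by move=> mU fi gi; exact: RintegralB. Qed.

Lemma int3Z U f (a : R) : mset U -> integ U f ->
  int3 U (fun x => a * f x) = a * int3 U f.
Proof. by move=> mU fi; exact: RintegralZl. Qed.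

Lemma int3_dct U (F : nat -> E -> R) f g : mset U ->
  (forall n, meas3 U (F n)) -> meas3 U f -> integ U g ->
  (forall x, U x -> F n x @[n --> \oo] --> f x) ->
  (forall n x, U x -> `|F n x| <= g x) ->
  int3 U (F n) @[n --> \oo] --> int3 U f.
Proof.
move=> mU mF mf gi Ff Fg.
have [|||||fi _ cv] := @dominated_convergence _ _ _ mu _ mU (fun n p => (F n (row3 p))%:E)
  (fun p => (f (row3 p))%:E) (fun p => (g (row3 p))%:E).
- by move=> n; apply/measurable_EFinP; exact: mF.
- by apply/measurable_EFinP.
- by apply: aeW => p Up; apply: cvg_EFin; [exact: nearW|exact: Ff].
- by [].
- by apply: aeW => p Up n; rewrite lee_fin; exact: Fg.
apply: fine_cvg; rewrite fineK; first exact: cv.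
exact: integrable_fin_num.
Qed.

Lemma int3_null U V f : mset U -> mset V -> V `<=` U -> vol (U `\` V) = 0%E ->
  integ U f -> int3 U f = int3 V f.
Proof.
move=> mU mV VU UV0 fi.
have -> : V = U `\` (U `\` V).
  by rewrite setDD; exact/esym/setIidr.
congr fine; apply: negligible_integral => //.
exact: mset_setD.
Qed.

Lemma int3_ge0 U f : (forall x, U x -> 0 <= f x) -> 0 <= int3 U f.
Proof. by move=> f0; apply: Rintegral_ge0 => p; exact: f0. Qed.

Lemma int3_indic U V : mset U -> mset V -> V `<=` U -> int3 U \1_V = fine (vol V).
Proof.
move=> mU mV VU; rewrite /int3 /Rintegral (_ : (fun p => _) = fun p =>
  (\1_(@row3 R @^-1` V) p)%:E) => [|]; last by apply/funext => p; rewrite !indicE.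
by rewrite integral_indic// -preimage_setI setIidl.
Qed.

Lemma integ0 U : mset U -> integ U (fun=> 0).
Proof. by move=> mU; have := integrable0 mu (@row3 R @^-1` U). Qed.

Lemma integ_sum (I : Type) (s : seq I) U (F : I -> E -> R) : mset U ->
  (forall i, integ U (F i)) -> integ U (fun x => \sum_(i <- s) F i x).
Proof.
move=> mU Fi; elim: s => [|i s ih].
  by apply: eq_integ (integ0 mU) => // x _; rewrite big_nil.
by apply: eq_integ (integD mU (Fi i) ih) => // x _; rewrite big_cons.
Qed.

Lemma int3_sum (I : Type) (s : seq I) U (F : I -> E -> R) : mset U ->
  (forall i, integ U (F i)) ->
  int3 U (fun x => \sum_(i <- s) F i x) = \sum_(i <- s) int3 U (F i).
Proof.
move=> mU Fi; elim: s => [|i s ih].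
  rewrite big_nil (@eq_int3 _ _ (fun=> 0)) => [|x _]; last by rewrite big_nil.
  by rewrite /int3 Rintegral_cst// mul0r.
rewrite big_cons -ih -int3D//; last exact: integ_sum.
by apply: eq_int3 => x _; rewrite big_cons.
Qed.

Lemma vol_bounded U (r : R) : mset U -> (forall x, U x -> `|x| <= r) -> (vol U < +oo)%E.
Proof.
move=> mU Ur; have [r0|r0] := leP 0 r.
  apply: (@le_lt_trans _ _ (vol (cube 0 r))); last by rewrite vol_cube ?ltry.
  apply: vol_le => // [|x /Ur]; first exact: mset_cube.
  by move=> xr; apply/cubeP; rewrite ?subr0.
rewrite (_ : U = set0) /vol ?preimage_set0 ?measure0 ?ltry//.
by rewrite -subset0 => x /Ur /(le_trans (normr_ge0 _)); rewrite leNgt r0.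
Qed.

Lemma int3_shift (v : E) f : meas3 setT f -> integ setT f ->
  int3 setT (fun x => f (x + v)) = int3 setT f.
Proof.
move=> mf fi.
have mF : measurable_fun setT (coords \o (fun x => x + v) \o @row3 R).
  apply: (measurable_coords (F := (fun x => x + v) \o @row3 R)) => i.
  apply: (eq_measurable_fun (fun p : X => row3 p 0 i + v 0 i)) => [p _|].
    by rewrite /= [RHS]mxE.
  by apply: measurable_funD => //; exact: measurable_row3_coord.
rewrite /int3 !preimage_setT.
have pE : forall A : set X, measurable A ->
    mu ((coords \o (fun x => x + v) \o @row3 R) @^-1` A) = mu A.
  move=> A mA.
  have mA' : mset (coords @^-1` A).
    rewrite /mset (_ : _ @^-1` _ = A)// eqEsubset.
    by split => p; rewrite /= row3K.
  have := vol_shift v mA'; rewrite /vol => h.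
  rewrite (_ : A = @row3 R @^-1` (coords @^-1` A)).
    by rewrite -h; congr (mu _); rewrite eqEsubset; split => p; rewrite /= !row3K.
  by rewrite eqEsubset; split => p; rewrite /= row3K.
have fiE : mu.-integrable setT (EFin \o (f \o @row3 R)).
  by move: fi; rewrite /integ preimage_setT.
rewrite -[RHS](Rintegral_measure_preserving mF pE fiE).
by apply: eq_Rintegral => p _; rewrite /= coordsK.
Qed.
End MeasureTools.

(** * A smooth hat function on the line *)

Section Smooth1.
Context {R : realType}.
Implicit Types (f g : R -> R) (t : R).

Lemma is_derive_eps (V : normedModType R) (f : V -> R) (x v : V) (df : R) :
  (forall e : R, 0 < e -> exists2 d : R, 0 < d & forall h, `|h| < d ->
    `|f (h *: v + x) - f x - df * h| <= e * `|h|) ->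
  is_derive x v f df.
Proof.
move=> H.
have cv : h^-1 *: ((f \o shift x) (h *: v) - f x) @[h --> 0^'] --> df.
  apply/cvgrPdist_le => e e0; have [d d0 Hd] := H e e0.
  near=> h.
  have h0 : h != 0 by near: h; exact: nbhs_dnbhs_neq.
  have hd : `|h| < d.
    near: h; apply: (@nbhs_dnbhs _ 0); apply/nbhs_ballP; exists d => //= y.
    by rewrite /ball /= sub0r normrN.
  have := Hd h hd; rewrite -ler_pdivrMr ?normr_gt0// -normfV -normrM distrC.
  apply: le_trans; rewrite le_eqVlt; apply/orP; left; apply/eqP; congr `|_|.
  by rewrite /= /shift /= /GRing.scale /=; field.
split; first by apply: cvgP cv.
by apply: cvg_lim => //; exact: cv.
Unshelve. all: by end_near. Qed.

(** The derivative is an existential witness, so that closure under sums, products and inverses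
    follows by induction from explicit formulas. *)
Fixpoint smooth1 (n : nat) f : Prop :=
  continuous f /\ if n is m.+1 then
    exists2 f' : R -> R, forall t, is_derive t 1 f (f' t) & smooth1 m f' else True.

Lemma smooth1_cont n f : smooth1 n f -> continuous f.
Proof. by case: n => [|n] []. Qed.

Lemma smooth1W n f : smooth1 n.+1 f -> smooth1 n f.
Proof.
elim: n f => [|n ih] f [cf [f' df sf]]; first by split.
by split => //; exists f' => //; exact: ih.
Qed.

Lemma smooth1_cst n (a : R) : smooth1 n (fun=> a).
Proof.
elim: n a => [|n ih] a /=; split => //; try exact: cst_continuous.
by exists (fun=> 0) => [t|]; [exact: is_derive_cst|exact: ih].
Qed.

Lemma smooth1_id n : smooth1 n id.
Proof.
have ci : continuous (id : R -> R) by move=> t; exact: cvg_id.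
case: n => [|n]; split => //.
by exists (fun=> 1) => [t|]; [exact: is_derive_id|exact: smooth1_cst].
Qed.

Lemma smooth1D n f g : smooth1 n f -> smooth1 n g -> smooth1 n (fun t => f t + g t).
Proof.
elim: n f g => [|n ih] f g [cf sf] [cg sg]; split => //.
- by move=> t; exact: cvgD (cf t) (cg t).
- by move=> t; exact: cvgD (cf t) (cg t).
- case: sf => f' df sf'; case: sg => g' dg sg'.
  exists (fun t => f' t + g' t); last exact: ih.
  by move=> t; exact: is_deriveD.
Qed.

Lemma smooth1M n f g : smooth1 n f -> smooth1 n g -> smooth1 n (fun t => f t * g t).
Proof.
elim: n f g => [|n ih] f g sf sg.
  case: sf sg => cf _ [cg _]; split => // t; exact: cvgM (cf t) (cg t).
split.
  have cf : continuous f := smooth1_cont sf; have cg : continuous g := smooth1_cont sg.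
  by move=> t; exact: cvgM (cf t) (cg t).
have wf := smooth1W sf; have wg := smooth1W sg.
case: sf => _ [f' df sf']; case: sg => _ [g' dg sg'].
exists (fun t => f t * g' t + g t * f' t); last by apply: smooth1D; exact: ih.
by move=> t; exact: is_deriveM.
Qed.

Lemma smooth1V n f : (forall t, f t != 0) -> smooth1 n f -> smooth1 n (fun t => (f t)^-1).
Proof.
move=> f0; elim: n => [|n ih] sf.
  by case: sf => cf _; split => // t; apply: cvgV => //; exact: cf.
split; first by case: sf => cf _ t; apply: cvgV => //; exact: cf.
have wf := ih (smooth1W sf).
case: sf => _ [f' df sf'].
exists (fun t => - 1 * (((f t)^-1 * (f t)^-1) * f' t)).
  move=> t; have -> : -1 * ((f t)^-1 / f t * f' t) = - (f t) ^- 2 * f' t.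
    by rewrite expr2 invfM; ring.
  exact: is_deriveV (f0 t) (df t).
apply: smooth1M; first exact: smooth1_cst.
by apply: smooth1M => //; exact: smooth1M.
Qed.

Lemma is_derive_affine f (a b t d : R) :
  is_derive (a * t + b) 1 f d -> is_derive t 1 (fun t => f (a * t + b)) (a * d).
Proof.
move=> df.
have da : is_derive t 1 (fun t : R => a * t + b) a.
  apply: is_derive_eps => e e0; exists 1 => // h _.
  have -> : a * (h *: 1 + t) + b - (a * t + b) - a * h = 0 by rewrite /GRing.scale /=; ring.
  by rewrite normr0 mulr_ge0 // ltW.
rewrite mulrC; exact: (@is_derive1_comp R f (fun t : R => a * t + b) t _ _ df da).
Qed.

Lemma smooth1_affine n f (a b : R) : smooth1 n f -> smooth1 n (fun t => f (a * t + b)).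
Proof.
have ca : continuous (fun t : R => a * t + b).
  by move=> t; apply: cvgD; [apply: cvgMr; exact: cvg_id|exact: cvg_cst].
elim: n f => [|n ih] f [cf sf]; split => //; try by move=> t; apply: (continuous_comp (ca t)); exact: cf.
case: sf => f' df sf'; exists (fun t => a * f' (a * t + b)); first by move=> t; exact: is_derive_affine.
by apply: smooth1M; [exact: smooth1_cst|exact: ih].
Qed.

(** Raise [u / n <= expR (u / n)] to the power [n]. *)
Lemma expn_le_expR n (u : R) : 0 <= u -> u ^+ n <= n%:R ^+ n * expR u.
Proof.
move=> u0; case: n => [|n]; first by rewrite !expr0 mul1r -[leLHS]expR0 ler_expR.
have -> : expR u = expR (u / n.+1%:R) ^+ n.+1.
  by rewrite -expRM_natl; congr expR; rewrite mulrC divfK// pnatr_eq0.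
rewrite -exprMn lerXn2r ?nnegrE ?mulr_ge0 ?expR_ge0//.
by rewrite mulrC -ler_pdivrMr// (le_trans _ (expR_ge1Dx _))// lerDr.
Qed.

Lemma horner_le_exp (p : {poly R}) : exists2 C : R, 0 <= C &
  forall u : R, 0 <= u -> `|p.[u]| <= C * expR u.
Proof.
exists (\sum_(i < size p) `|p`_i| * i%:R ^+ i).
  by apply: sumr_ge0 => i _; rewrite mulr_ge0 ?exprn_ge0.
move=> u u0; rewrite horner_coef (le_trans (ler_norm_sum _ _ _))// mulr_suml.
apply: ler_sum => i _; rewrite normrM -mulrA ler_wpM2l// ger0_norm ?exprn_ge0//.
exact: expn_le_expR.
Qed.

Definition flat (p : {poly R}) t : R :=
  if 0 < t then p.[t^-1] * expR (- t^-1) else 0.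

Lemma is_derive_flat p t :
  is_derive t 1 (flat p) (flat ((p - p^`()) * 'X^2) t).
Proof.
have [t0|t0|->] := ltgtP t 0.
- rewrite {2}/flat ltNge (ltW t0) /=.
  have dc : is_derive t 1 (fun=> 0 : R) (0 : R) by exact: is_derive_cst.
  apply: near_eq_is_derive dc; near=> s.
  have s0 : s < 0 by near: s; exact: lt_nbhsl.
  by rewrite /flat ltNge (ltW s0).
- have dV : is_derive t 1 (fun s : R => s^-1) (- t ^- 2 * 1).
    have t1 : t != 0 by rewrite gt_eqF.
    exact: (@is_deriveV R id t 1 1 t1 (is_derive_id _ _)).
  have dN : is_derive t 1 (fun s : R => - s^-1) (- (- t ^- 2 * 1)) by exact: is_deriveN.
  have dp := is_derive1_comp (is_derive_poly p t^-1) dV.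
  have de := @is_derive1_comp R expR (fun s => - s^-1) t _ _ (is_derive_expR (- t^-1)) dN.
  have -> : flat ((p - p^`()) * 'X^2) t =
      p.[t^-1] * (expR (- t^-1) * (- (- t ^- 2 * 1))) +
      expR (- t^-1) * (p^`().[t^-1] * (- t ^- 2 * 1)).
    by rewrite /flat t0 hornerM hornerXn hornerD hornerN exprVn; ring.
  apply: near_eq_is_derive (is_deriveM dp de); near=> s.
  have s0 : 0 < s by near: s; exact: lt_nbhsr.
  by rewrite /flat s0.
- have -> : flat ((p - p^`()) * 'X^2) 0 = 0 by rewrite /flat ltxx.
  (* With [u = h^-1], the bound of [p.[u] * u ^+ 2] by [C * expR u] says that [flat p h] is at most
     [C * h ^+ 2], so its difference quotient at 0 tends to 0. *)
  have [C C0 HC] := horner_le_exp (p * 'X^2).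
  apply: is_derive_eps => e e0; exists (e / (C + 1)); first by rewrite divr_gt0//; lra.
  move=> h hd; rewrite /GRing.scale /= mulr1 addr0 mul0r subr0 {2}/flat ltxx subr0 /flat.
  case: ifPn => h0; last by rewrite normr0 mulr_ge0// ltW.
  have u0 : 0 <= h^-1 by rewrite invr_ge0 ltW.
  have := HC _ u0; rewrite hornerM hornerXn exprVn 2!normrM.
  rewrite expRN (gtr0_norm h0).
  move: (expR_gt0 h^-1); set x := expR _ => x0.
  rewrite [`|(h ^+ 2)^-1|]ger0_norm ?invr_ge0 ?sqr_ge0//.
  rewrite ler_pdivrMr ?exprn_gt0// => H.
  rewrite normfV (gtr0_norm x0) ler_pdivrMr//; apply: (le_trans H).
  rewrite gtr0_norm// ltr_pdivlMr in hd; last by lra.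
  rewrite [leLHS](_ : _ = (C * h) * h * x); last by ring.
  rewrite ler_wpM2r ?(ltW x0)// ler_wpM2r ?(ltW h0)//; lra.
Unshelve. all: by end_near. Qed.

Lemma smooth1_flat n p : smooth1 n (flat p).
Proof.
have cf q : continuous (flat q).
  move=> t; have [+ _] := is_derive_flat q t.
  by move=> /derivable1_diffP/differentiable_continuous.
elim: n p => [|n ih] p; split => //.
by exists (flat ((p - p^`()) * 'X^2)) => // t; exact: is_derive_flat.
Qed.

(* Equal to 0 on (-oo, 0] and to t - 1/2 on [1, +oo); its second difference
   [hat] is a C^oo analogue of the piecewise linear hat function. *)
Definition ramp (t : R) : R :=
  (t - 2^-1) * (flat 1 t / (flat 1 t + flat 1 (1 - t))).

Lemma flat1_ge0 t : 0 <= flat 1 t.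
Proof. by rewrite /flat; case: ifP => // _; rewrite hornerE mul1r expR_ge0. Qed.

Lemma flat1_gt0 t : 0 < t -> 0 < flat 1 t.
Proof. by move=> t0; rewrite /flat t0 hornerE mul1r expR_gt0. Qed.

Lemma flat1_le0 t : t <= 0 -> flat 1 t = 0.
Proof. by move=> t0; rewrite /flat ltNge t0. Qed.

Lemma smooth1_ramp n : smooth1 n ramp.
Proof.
apply: smooth1M; first by apply: smooth1D; [exact: smooth1_id|exact: smooth1_cst].
have s1 : smooth1 n (fun t => flat 1 (1 - t)).
  have := @smooth1_affine n (flat 1) (-1) 1 (smooth1_flat _ _).
  by congr smooth1; apply/funext => t; congr flat; ring.
apply: smooth1M; first exact: smooth1_flat.
apply: smooth1V; last by apply: smooth1D => //; exact: smooth1_flat.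
move=> t; rewrite gt_eqF//; have [t0|t0] := ltP 0 t.
  by rewrite ltr_pwDl ?flat1_gt0 ?flat1_ge0.
by rewrite ltr_wpDl ?flat1_ge0 ?flat1_gt0//; lra.
Qed.

Lemma ramp_le0 t : t <= 0 -> ramp t = 0.
Proof. by move=> t0; rewrite /ramp flat1_le0// mul0r mulr0. Qed.

Lemma ramp_ge1 t : 1 <= t -> ramp t = t - 2^-1.
Proof.
move=> t1; rewrite /ramp (flat1_le0 (t := 1 - t)); last by lra.
by rewrite addr0 divff ?mulr1// gt_eqF// flat1_gt0//; lra.
Qed.

(* Locked: otherwise [ring] tries to unfold the derivative. *)
Definition ramp' : R -> R := locked (fun t => 'D_1 ramp t).

Lemma ramp'E t : ramp' t = 'D_1 ramp t.
Proof. by rewrite /ramp' -lock. Qed.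

Lemma is_derive_ramp t : is_derive t 1 ramp (ramp' t).
Proof. by have [_ [r' dr _]] := smooth1_ramp 1; have [d _] := dr t; split; rewrite ?ramp'E. Qed.

Lemma smooth1_ramp' n : smooth1 n ramp'.
Proof.
have [_ [r' dr]] := smooth1_ramp n.+1; congr smooth1.
by apply/funext => t; rewrite ramp'E; case: (dr t).
Qed.

Lemma ramp'_lt0 t : t < 0 -> ramp' t = 0.
Proof.
move=> t0; rewrite ramp'E -(@near_eq_derive _ _ _ (fun=> 0 : R)); first exact: derive_cst.
by near=> s; rewrite ramp_le0// ltW//; near: s; exact: lt_nbhsl.
Unshelve. all: by end_near. Qed.

Lemma ramp'_gt1 t : 1 < t -> ramp' t = 1.
Proof.
move=> t1; have [_ dE] : is_derive t 1 (fun t : R => 1 * t - 2^-1) (1 * 1).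
  by apply: (@is_derive_affine id); exact: is_derive_id.
rewrite ramp'E -[RHS]mulr1 -dE; apply: near_eq_derive.
by near=> s; rewrite mul1r ramp_ge1// ltW//; near: s; exact: lt_nbhsr.
Unshelve. all: by end_near. Qed.

Definition hat (t : R) : R := ramp (t + 1) - 2 * ramp t + ramp (t - 1).
Definition hat' (t : R) : R := ramp' (t + 1) - 2 * ramp' t + ramp' (t - 1).

Lemma smooth1_diff2 n f : smooth1 n f -> smooth1 n (fun t => f (t + 1) - 2 * f t + f (t - 1)).
Proof.
move=> sf; have h b : smooth1 n (fun t => f (t + b)).
  by have := smooth1_affine 1 b sf; congr smooth1; apply/funext => t; rewrite mul1r.
have := smooth1D (smooth1D (h 1) (smooth1M (smooth1_cst n (-2)) sf)) (h (-1)).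
by congr smooth1; apply/funext => t; ring.
Qed.

Lemma smooth1_hat n : smooth1 n hat.
Proof. exact: smooth1_diff2 (smooth1_ramp n). Qed.

Lemma smooth1_hat' n : smooth1 n hat'.
Proof. exact: smooth1_diff2 (smooth1_ramp' n). Qed.

Lemma is_derive_hat t : is_derive t 1 hat (hat' t).
Proof.
have h b : is_derive t 1 (fun t => ramp (t + b)) (ramp' (t + b)).
  have := @is_derive_affine ramp 1 b t (ramp' (1 * t + b)) (is_derive_ramp _).
  by rewrite !mul1r; under eq_fun do rewrite mul1r.
have d2 : is_derive t 1 (fun t => -2 * ramp t) (-2 * ramp' t).
  have := is_deriveM (is_derive_cst (-2 : R) t 1) (is_derive_ramp t).
  by rewrite scaler0 addr0.
have -> : hat = (fun t => (ramp (t + 1) + -2 * ramp t) + ramp (t - 1)).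
  by apply/funext => u; rewrite /hat; ring.
rewrite /hat' -mulNr; exact: is_deriveD (is_deriveD (h 1) d2) (h (-1)).
Qed.

(** The transition of [ramp] takes place on [0, 1], so its second difference lives on [-1, 2];
    further right three affine values cancel. *)
Lemma hat_out t : t <= -1 \/ 2 <= t -> hat t = 0.
Proof.
case=> ht; rewrite /hat.
  by rewrite !ramp_le0; [ring|lra|lra|lra].
by rewrite !ramp_ge1; [field|lra|lra|lra].
Qed.

(** Second differences telescope to first differences of [ramp] at the two ends. The condition
    [1 <= s] puts one end in the affine range, [s + 1 <= L%:R] puts the other where [ramp]
    vanishes. *)
Lemma sum_hat L s : 1 <= s -> s + 1 <= L%:R -> \sum_(j < L) hat (s - j%:R) = 1.
Proof.
move=> s1 sL.
have -> : \sum_(j < L) hat (s - j%:R) =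
    ramp (s + 1) - ramp s - ramp (s - L%:R + 1) + ramp (s - L%:R).
  elim: L {sL} => [|L ih]; first by rewrite big_ord0 subr0; ring.
  have -> : s - L.+1%:R = s - L%:R - 1 by rewrite -natr1 opprD addrA.
  by rewrite big_ord_recr /= ih /hat subrK; ring.
rewrite (ramp_ge1 s1) (@ramp_ge1 (s + 1)) ?(@ramp_le0 (s - L%:R)) ?(@ramp_le0 (s - L%:R + 1));
  by [field|lra|lra|lra].
Qed.

(** The inequalities are strict, unlike those of [hat_out], because [ramp'] is evaluated only away
    from the joints 0 and 1. *)
Lemma hat'_out t : t < -1 \/ 2 < t -> hat' t = 0.
Proof.
move=> [ht|ht]; rewrite /hat'.
  by rewrite !ramp'_lt0; [ring|lra|lra|lra].
by rewrite !ramp'_gt1; [ring|lra|lra|lra].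
Qed.

Lemma sum_hat' L s : 1 < s -> s + 1 < L%:R -> \sum_(j < L) hat' (s - j%:R) = 0.
Proof.
move=> s1 sL; have -> : \sum_(j < L) hat' (s - j%:R) =
    ramp' (s + 1) - ramp' s - ramp' (s - L%:R + 1) + ramp' (s - L%:R).
  elim: L {sL} => [|L ih]; first by rewrite big_ord0 subr0; ring.
  have -> : s - L.+1%:R = s - L%:R - 1 by rewrite -natr1 opprD addrA.
  by rewrite big_ord_recr /= ih /hat' subrK; ring.
rewrite (ramp'_gt1 s1) (@ramp'_gt1 (s + 1)) ?(@ramp'_lt0 (s - L%:R)) ?(@ramp'_lt0 (s - L%:R + 1));
  by [ring|lra|lra|lra].
Qed.

(** Summation by parts: the first moment telescopes too, with end terms weighted by [L]. *)
Lemma sum_hat'1 L s : 1 < s -> s + 1 < L%:R -> \sum_(j < L) j%:R * hat' (s - j%:R) = 1.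
Proof.
move=> s1 sL; have -> : \sum_(j < L) j%:R * hat' (s - j%:R) =
    ramp' s - L%:R * ramp' (s - L%:R + 1) + (L%:R - 1) * ramp' (s - L%:R).
  elim: L {sL} => [|L ih]; first by rewrite big_ord0 subr0; ring.
  have -> : s - L.+1%:R = s - L%:R - 1 by rewrite -natr1 opprD addrA.
  by rewrite big_ord_recr /= ih /hat' subrK -natr1; ring.
by rewrite (ramp'_gt1 s1) ?(@ramp'_lt0 (s - L%:R)) ?(@ramp'_lt0 (s - L%:R + 1)); [ring|lra|lra].
Qed.

Lemma bounded_out (h : R -> R) : continuous h ->
  (forall t, t < -1 \/ 2 < t -> h t = 0) -> exists2 H : R, 0 <= H & forall t, `|h t| <= H.
Proof.
move=> ch h0.
have : compact (h @` `[-1, 2]%classic).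
  apply: continuous_compact; last exact: segment_compact.
  exact: continuous_subspaceT.
move=> /compact_bounded [M [_ HM]]; exists (`|M| + 1) => // t.
have [tl|tl] := ltP t (-1); first by rewrite h0 ?normr0//; left.
have [tr|tr] := ltP 2 t; first by rewrite h0 ?normr0//; right.
apply: HM; first by rewrite ltr_pwDr// ler_norm.
by exists t => //=; rewrite in_itv /= tl tr.
Qed.

(* The indicator of [-2, 2] is dominated by the unit increments of the
   function clamped to [-3, 3], whose sum telescopes. *)
Lemma sum_window (h : R -> R) (H : R) L s : 0 <= H -> (forall t, `|h t| <= H) ->
  (forall t, t < -1 \/ 2 < t -> h t = 0) ->
  \sum_(j < L) `|h (s - j%:R)| <= 6 * H.
Proof.
move=> H0 hH h0; pose c t : R := Num.max (-3) (Num.min 3 t).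
have cP t : [/\ -3 <= c t, c t <= 3 & `|h t| <= H * (c (t + 1) - c t)].
  have cE u : c u = if u <= -3 then -3 else if 3 <= u then 3 else u.
    by rewrite /c /Num.max /Num.min; do ![case: ifPn]; lra.
  rewrite !cE; split; do ?[case: ifPn]; try lra; move=> *;
   (case: (ltP t (-1)) => t1; [by rewrite h0; [rewrite normr0 mulr_ge0//; lra|left]|]);
   (case: (ltP 2 t) => t2; [by rewrite h0; [rewrite normr0 mulr_ge0//; lra|right]|]);
   try lra; apply: (le_trans (hH t)); nra.
have -> : 6 * H = H * (3 - (-3)) by ring.
apply: (@le_trans _ _ (H * (c (s + 1) - c (s - L%:R + 1)))); last first.
  have [c1 c2 _] := cP (s + 1); have [c3 c4 _] := cP (s - L%:R + 1).
  by rewrite ler_wpM2l//; lra.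
elim: L => [|L ih]; first by rewrite big_ord0 subr0 subrr mulr0.
rewrite big_ord_recr /=.
have -> : s - L.+1%:R = s - L%:R - 1 by rewrite -natr1 opprD addrA.
have [_ _] := cP (s - L%:R); rewrite subrK => hc.
by apply: (le_trans (lerD ih hc)); rewrite -mulrDr ler_wpM2l//; lra.
Qed.
End Smooth1.

(** * Smooth quasi-interpolation on grids *)

Section SmoothFunctions.
Context {R : realType}.
Notation E := ('rV[R]_3).
Notation "''d_' i" := (delta_mx (0 : 'I_1) (i : 'I_3) : E) (at level 0, i at level 2).
Implicit Types (f g : E -> R) (x : E).

Lemma is_derive_line f x (v : E) (df : R) :
  is_derive (0 : R) 1 (fun h : R => f (h *: v + x)) df -> is_derive x v f df.
Proof.
move=> [d1 d2].
have eqf : (fun h : R => h^-1 *: (((fun h : R => f (h *: v + x)) \o shift 0) (h *: 1) -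
      (fun h : R => f (h *: v + x)) 0)) =
    (fun h : R => h^-1 *: ((f \o shift x) (h *: v) - f x)).
  by apply/funext => h; rewrite /= /shift /= addr0 scale0r add0r /GRing.scale /= mulr1.
split; first by move: d1; rewrite /derivable eqf.
by move: d2; rewrite /derive eqf.
Qed.

Definition pd i f f' := forall x, is_derive x 'd_i f (f' x).

Lemma pd_pderiv i f f' : pd i f f' -> pderiv i f = f'.
Proof. by move=> h; apply/funext => x; case: (h x). Qed.

Lemma pd_derivable i f f' : pd i f f' -> forall x, derivable f x 'd_i.
Proof. by move=> h x; case: (h x). Qed.

Lemma pd_cst i (a : R) : pd i (fun=> a) (fun=> 0).
Proof. by move=> x; exact: is_derive_cst. Qed.

Lemma pdD i f g f' g' : pd i f f' -> pd i g g' ->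
  pd i (fun x => f x + g x) (fun x => f' x + g' x).
Proof. by move=> hf hg x; exact: is_deriveD (hf x) (hg x). Qed.

Lemma pdM i f g f' g' : pd i f f' -> pd i g g' ->
  pd i (fun x => f x * g x) (fun x => f x * g' x + g x * f' x).
Proof. by move=> hf hg x; exact: is_deriveM (hf x) (hg x). Qed.

Lemma pd_sum i (I : Type) (s : seq I) (F F' : I -> E -> R) :
  (forall k, pd i (F k) (F' k)) ->
  pd i (fun x => \sum_(k <- s) F k x) (fun x => \sum_(k <- s) F' k x).
Proof.
move=> h; elim: s => [|k s ih].
  have -> : (fun x => \sum_(k <- [::]) F k x) = (fun=> 0).
    by apply/funext => x; rewrite big_nil.
  have -> : (fun x => \sum_(k <- [::]) F' k x) = (fun=> 0).
    by apply/funext => x; rewrite big_nil.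
  exact: pd_cst.
have -> : (fun x => \sum_(k <- k :: s) F k x) = (fun x => F k x + \sum_(k <- s) F k x).
  by apply/funext => x; rewrite big_cons.
have -> : (fun x => \sum_(k <- k :: s) F' k x) = (fun x => F' k x + \sum_(k <- s) F' k x).
  by apply/funext => x; rewrite big_cons.
exact: pdD.
Qed.

Lemma pd_coord (i j : 'I_3) (f f' : R -> R) (a b : R) :
  (forall t : R, is_derive t 1 f (f' t)) ->
  pd i (fun x => f (a * x 0 j + b)) (fun x => (i == j)%:R * (a * f' (a * x 0 j + b))).
Proof.
move=> df x; apply: is_derive_line.
have -> : (fun h : R => f (a * (h *: 'd_i + x) 0 j + b)) =
    (fun h => f ((a * (i == j)%:R) * h + (a * x 0 j + b))).
  by apply/funext => h; congr f; rewrite !mxE eqxx /= eq_sym; ring.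
have -> : (i == j)%:R * (a * f' (a * x 0 j + b)) =
    (a * (i == j)%:R) * f' (a * x 0 j + b) by ring.
apply: is_derive_affine; rewrite mulr0 add0r; exact: df.
Qed.

Lemma continuous_coord (j : 'I_3) : continuous (fun x : E => x 0 j).
Proof. exact: coord_continuous. Qed.

Lemma Cn_cont n f : Cn n f -> continuous f.
Proof. by case: n => [|n] []. Qed.

Lemma CnS n f : continuous f ->
  (forall i, exists2 f', pd i f f' & Cn n f') -> Cn n.+1 f.
Proof.
move=> cf h; split => // i; have [f' df cf'] := h i.
by split; [exact: pd_derivable df|rewrite (pd_pderiv df)].
Qed.

Lemma CnSP n f : Cn n.+1 f -> forall i, pd i f (pderiv i f) /\ Cn n (pderiv i f).
Proof.
move=> [_ h] i; by have [df cf] := h i; split => // x.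
Qed.

Lemma CnW n f : Cn n.+1 f -> Cn n f.
Proof.
elim: n f => [|n ih] f [cf h]; first by split.
by split => // i; have [? ?] := h i; split => //; exact: ih.
Qed.

Lemma Cn_cst n (a : R) : Cn n (fun=> a).
Proof.
have ca (b : R) : continuous (fun _ : E => b) by exact: cst_continuous.
elim: n a => [|n ih] a; first by split; first exact: ca.
apply: CnS => [|i]; first exact: ca.
by exists (fun=> 0); [exact: pd_cst|exact: ih].
Qed.

Lemma CnD n f g : Cn n f -> Cn n g -> Cn n (fun x => f x + g x).
Proof.
elim: n f g => [|n ih] f g hf hg.
  by case: hf hg => cf _ [cg _]; split => // x; exact: cvgD (cf x) (cg x).
apply: CnS => [x|i].
  by have cf : continuous f := Cn_cont hf; have cg : continuous g := Cn_cont hg;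
    exact: cvgD (cf x) (cg x).
have [df cf] := CnSP hf i; have [dg cg] := CnSP hg i.
by exists (fun x => pderiv i f x + pderiv i g x); [exact: pdD|exact: ih].
Qed.

Lemma CnM n f g : Cn n f -> Cn n g -> Cn n (fun x => f x * g x).
Proof.
elim: n f g => [|n ih] f g hf hg.
  by case: hf hg => cf _ [cg _]; split => // x; exact: cvgM (cf x) (cg x).
apply: CnS => [x|i].
  by have cf : continuous f := Cn_cont hf; have cg : continuous g := Cn_cont hg;
    exact: cvgM (cf x) (cg x).
have [df cf] := CnSP hf i; have [dg cg] := CnSP hg i.
exists (fun x => f x * pderiv i g x + g x * pderiv i f x); first exact: pdM.
by apply: CnD; apply: ih => //; exact: CnW.
Qed.

Lemma Cn_sum n (I : Type) (s : seq I) (F : I -> E -> R) :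
  (forall k, Cn n (F k)) -> Cn n (fun x => \sum_(k <- s) F k x).
Proof.
move=> h; elim: s => [|k s ih].
  have -> : (fun x => \sum_(k <- [::]) F k x) = (fun=> 0).
    by apply/funext => x; rewrite big_nil.
  exact: Cn_cst.
have -> : (fun x => \sum_(k <- k :: s) F k x) = (fun x => F k x + \sum_(k <- s) F k x).
  by apply/funext => x; rewrite big_cons.
exact: CnD.
Qed.

Lemma Cn_coord n (f : R -> R) (j : 'I_3) (a b : R) :
  smooth1 n f -> Cn n (fun x => f (a * x 0 j + b)).
Proof.
have ca : continuous (fun x : E => a * x 0 j + b).
  move=> x; apply: (@continuousD _ _ _ (fun x : E => a * x 0 j)); last exact: cst_continuous.
  by apply: continuousM; [exact: cst_continuous|exact: continuous_coord].
elim: n f => [|n ih] f [cf hf].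
  by split => // x; apply: (continuous_comp (ca x)); exact: cf.
apply: CnS => [x|i]; first by apply: (continuous_comp (ca x)); exact: cf.
case: hf => f' df sf'.
exists (fun x => (i == j)%:R * (a * f' (a * x 0 j + b))); first exact: pd_coord.
by apply: CnM; [exact: Cn_cst|apply: CnM; [exact: Cn_cst|exact: ih]].
Qed.
End SmoothFunctions.

(** * Tensor-product quasi-interpolants *)

Section QuasiInterpolant.
Context {R : realType}.
Notation E := ('rV[R]_3).
Variables (B n : nat).

Let N : R := n.+1%:R.
(** The margin of three nodes beyond [-B, B] on each side keeps in the grid every bump that meets a
    point with [|x| <= B]; it yields the strict bounds of [sB]. *)
Let off : nat := (n.+1 * B + 3)%N.
Let L : nat := (off + off)%N.
Let grid := {ffun 'I_3 -> 'I_L}.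

Definition node (z : grid) : E := \row_i (((z i)%:R - off%:R) / N).

Let s (x : E) (z : grid) (i : 'I_3) : R := N * x 0 i + off%:R - (z i)%:R.

(** The option treats the bump and its partial derivatives together: [None] is the tensor-product
    bump at [z], [Some i] its derivative in direction [i] in grid units, that is, without the factor
    [N]. *)
Definition hats (o : option 'I_3) (x : E) (z : grid) : R :=
  \prod_j (if Some j == o then @hat' R else @hat R) (s x z j).

(* As the integer translates of [hat] sum to 1 and their first moments are
   affine, [quasi] reproduces constants and its derivative [dquasi] those of
   affine functions. *)
Definition quasi (F : E -> R) (x : E) : R := \sum_(z : grid) F (node z) * hats None x z.
Definition dquasi i (F : E -> R) (x : E) : R :=
  \sum_(z : grid) F (node z) * (N * hats (Some i) x z).

Lemma prod3E (F : 'I_3 -> R) : \prod_i F i = F 0 * F 1 * F 2%:R.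
Proof.
rewrite !big_ord_recr big_ord0 /= mul1r; congr (F _ * F _ * F _); exact/val_inj.
Qed.

Let sE x z i : s x z i = N * x 0 i + (off%:R - (z i)%:R).
Proof. by rewrite /s addrA. Qed.

Lemma Cn_quasi k F : Cn k (quasi F).
Proof.
apply: Cn_sum => z; apply: CnM; first exact: Cn_cst.
have h j : Cn k (fun x : E => hat (s x z j)).
  have := @Cn_coord R k hat j N (off%:R - (z j)%:R) (smooth1_hat k).
  by congr Cn; apply/funext => x; rewrite sE.
have -> : hats None ^~ z = fun x => hat (s x z 0) * hat (s x z 1) * hat (s x z 2%:R).
  by apply/funext => x; rewrite /hats prod3E.
by apply: CnM => //; exact: CnM.
Qed.

Lemma pd_quasi i F : pd i (quasi F) (dquasi i F).
Proof.
apply: pd_sum => z.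
have h j : pd i (fun x : E => hat (s x z j)) (fun x => (i == j)%:R * (N * hat' (s x z j))).
  have := @pd_coord R i j hat hat' N (off%:R - (z j)%:R) (@is_derive_hat R).
  have -> : (fun x : E => hat (N * x 0 j + (off%:R - (z j)%:R))) = (fun x => hat (s x z j)).
    by apply/funext => x; rewrite sE.
  by congr pd; apply/funext => x; rewrite sE.
have -> : (fun x => F (node z) * hats None x z) =
    fun x => F (node z) * (hat (s x z 0) * hat (s x z 1) * hat (s x z 2%:R)).
  by apply/funext => x; rewrite /hats prod3E.
have := pdM (@pd_cst R i (F (node z))) (pdM (pdM (h 0) (h 1)) (h 2%:R)).
congr pd; apply/funext => x; rewrite /hats prod3E.
by move: i {h}; apply: ord3P; rewrite /=; ring.
Qed.

Lemma hats_sumE (g : 'I_3 -> R -> R) :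
  \sum_(z : grid) \prod_j g j (z j)%:R = \prod_j \sum_(k < L) g j k%:R.
Proof. by rewrite bigA_distr_bigA. Qed.

Let sB (x : E) i : `|x| <= B%:R -> 1 < N * x 0 i + off%:R /\ N * x 0 i + off%:R + 1 < L%:R.
Proof.
move=> xB; have N0 : 0 < N by rewrite /N ltr0n.
have /(le_trans (coord_norm x i)) := xB; rewrite ler_norml => /andP[x1 x2].
have offE : off%:R = N * B%:R + 3 :> R by rewrite /off natrD natrM.
have LE : L%:R = off%:R + off%:R :> R by rewrite /L natrD.
rewrite LE offE; have h1 : N * x 0 i <= N * B%:R by rewrite ler_wpM2l// ltW.
have h2 : - (N * B%:R) <= N * x 0 i by rewrite -mulrN ler_wpM2l// ltW.
by split; lra.
Qed.

Lemma sum_hats x : `|x| <= B%:R -> \sum_z hats None x z = 1.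
Proof.
move=> xB; rewrite /hats /s (hats_sumE (fun j t => hat (N * x 0 j + off%:R - t))).
by apply: big1 => j _; have [h1 h2] := sB j xB; rewrite sum_hat//; exact: ltW.
Qed.

Lemma sum_dhats i x : `|x| <= B%:R -> \sum_z hats (Some i) x z = 0.
Proof.
move=> xB; rewrite /hats /s (hats_sumE
  (fun j t => (if Some j == Some i then hat' else hat) (N * x 0 j + off%:R - t))).
rewrite (bigD1 i)//= eqxx; have [h1 h2] := sB i xB.
by rewrite sum_hat'// mul0r.
Qed.

Lemma sum_dhats1 i k x : `|x| <= B%:R ->
  \sum_(z : grid) (z k)%:R * hats (Some i) x z = (i == k)%:R.
Proof.
(* Absorbing the weight [z k] into the factor of index [k] lets the sum factorize. If [i] differs
   from [k], the factor of index [i] is a plain sum of [hat'] and vanishes. *)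
move=> xB; pose g (j : 'I_3) (t : R) := (if j == k then t else 1) *
  (if Some j == Some i then @hat' R else @hat R) (N * x 0 j + off%:R - t).
rewrite (eq_bigr (fun z : grid => \prod_j g j (z j)%:R)).
  rewrite hats_sumE {}/g; have [->|ik] := eqVneq i k.
    apply: big1 => j _; have [h1 h2] := sB j xB.
    have [->|jk] := eqVneq j k; first by rewrite eqxx sum_hat'1 //; have [] := sB k xB.
    rewrite ifN; last by rewrite (inj_eq (@Some_inj _)).
    by under eq_bigr do rewrite mul1r; rewrite sum_hat//; exact: ltW.
  rewrite (bigD1 i)//= (negbTE ik) eqxx; have [h1 h2] := sB i xB.
  by under eq_bigr do rewrite mul1r; rewrite sum_hat'// mul0r.
move=> z _; rewrite {}/g big_split /=; congr (_ * _).
by rewrite (bigD1 k)//= eqxx big1 ?mulr1// => j /negbTE ->.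
Qed.

Lemma hats_supp o x z : hats o x z != 0 -> `|node z - x| <= 2 / N.
Proof.
have N0 : 0 < N by rewrite /N ltr0n.
move=> h; apply: norm_le => [|i]; first by rewrite divr_ge0// ltW.
have si : `|s x z i| <= 2.
  rewrite leNgt; apply: contra h => h.
  have hs : s x z i < -1 \/ 2 < s x z i by move: h; rewrite ltr_normr => /orP[]; lra.
  apply/prodf_eq0; exists i => //; apply/eqP; case: ifP => _; first exact: hat'_out.
  by apply: hat_out; case: hs => /ltW; tauto.
rewrite !mxE (_ : _ - _ = - (s x z i) / N); last by rewrite /s; field; rewrite gt_eqF.
by rewrite normrM normrN ger0_norm ?invr_ge0 ?ler_wpM2r ?invr_ge0// ltW.
Qed.

Lemma quasi_supp F x : quasi F x != 0 ->
  exists z, F (node z) != 0 /\ `|node z - x| <= 2 / N.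
Proof.
move=> h; apply: contrapT => /forallNP H; move/eqP: h; apply.
apply: big1 => z _; have [->|Fz] := eqVneq (F (node z)) 0; first by rewrite mul0r.
have [->|hz] := eqVneq (hats None x z) 0; first by rewrite mulr0.
by exfalso; apply: (H z); split => //; exact: hats_supp hz.
Qed.

Lemma sum_hats_norm (H : R) o x : 0 <= H -> (forall t, `|@hat R t| <= H) ->
  (forall t, `|@hat' R t| <= H) -> \sum_z `|hats o x z| <= (6 * H) ^+ 3.
Proof.
move=> H0 hH h'H; rewrite /hats /s; under eq_bigr do rewrite normr_prod.
rewrite (hats_sumE (fun j t => `|(if Some j == o then hat' else hat) (N * x 0 j + off%:R - t)|)).
have -> : (6 * H) ^+ 3 = \prod_(j < 3) (6 * H) by rewrite prodr_const card_ord.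
apply: ler_prod => j _; rewrite sumr_ge0//=; case: ifP => _.
  by apply: sum_window => //; exact: hat'_out.
by apply: sum_window => // t ht; apply: hat_out; case: ht => /ltW; tauto.
Qed.

Section Errors.
Variables (F : E -> R) (x : E) (K e : R).
Hypotheses (xB : `|x| <= B%:R) (e0 : 0 <= e).
Hypothesis KP : forall o, \sum_z `|hats o x z| <= K.

(** Only nodes within [2 / N] of [x] contribute. The three estimates below apply this to [F] minus
    what is reproduced exactly, a constant or an affine function. *)
Let err o (G : E -> R) : (forall y, `|y - x| <= 2 / N -> `|G y| <= e) ->
  `|\sum_z G (node z) * hats o x z| <= K * e.
Proof.
move=> Ge; rewrite (le_trans (ler_norm_sum _ _ _))//.
apply: (@le_trans _ _ (\sum_z e * `|hats o x z|)); last first.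
  by rewrite -mulr_sumr mulrC ler_wpM2r.
apply: ler_sum => z _; rewrite normrM.
have [->|hz] := eqVneq (hats o x z) 0; first by rewrite normr0 !mulr0.
by rewrite ler_wpM2r// Ge//; exact: hats_supp hz.
Qed.

Lemma quasi_err (a : R) : (forall y, `|y - x| <= 2 / N -> `|F y - a| <= e) ->
  `|quasi F x - a| <= K * e.
Proof.
move=> /err -/(_ None); rewrite (_ : \sum_z _ = quasi F x - a)//.
under eq_bigr do rewrite mulrBl.
by rewrite sumrB -mulr_sumr sum_hats// mulr1.
Qed.

(** Constants have derivative 0, so any [a] may be subtracted from [F]. For a Lipschitz [F] the
    error [e] is of order [1 / N], which compensates the factor [N]. *)
Lemma dquasi_bound i (a : R) : (forall y, `|y - x| <= 2 / N -> `|F y - a| <= e) ->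
  `|dquasi i F x| <= K * (N * e).
Proof.
move=> /err -/(_ (Some i)); rewrite (_ : \sum_z _ = dquasi i F x / N) => [h|].
  have N0 : 0 < N by rewrite /N ltr0n.
  rewrite mulrCA mulrC -ler_pdivrMr//; apply: le_trans h.
  by rewrite normrM normfV (gtr0_norm N0).
under eq_bigr do rewrite mulrBl.
rewrite sumrB -mulr_sumr sum_dhats// mulr0 subr0 /dquasi mulr_suml.
by apply: eq_bigr => z _; rewrite [N * _]mulrC mulrA mulfK// pnatr_eq0.
Qed.

Lemma dquasi_err i (a : R) (G : E) :
  (forall y, `|y - x| <= 2 / N -> `|F y - a - dotv (y - x) G| <= e) ->
  `|dquasi i F x - G 0 i| <= K * (N * e).
Proof.
move=> /err -/(_ (Some i)); rewrite (_ : \sum_z _ = (dquasi i F x - G 0 i) / N) => [h|].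
  have N0 : 0 < N by rewrite /N ltr0n.
  rewrite mulrCA mulrC -ler_pdivrMr//; apply: le_trans h.
  by rewrite normrM normfV (gtr0_norm N0).
have N0 : N != 0 by rewrite pnatr_eq0.
(* The affine part in grid units: a multiple of [z k], whose moment is known, minus a term constant
   in [z], which the derivative kills. *)
have dE z : dotv (node z - x) G =
    \sum_k (G 0 k / N * (z k)%:R - G 0 k / N * (N * x 0 k + off%:R)).
  by apply: eq_bigr => k _; rewrite !mxE; field.
under eq_bigr do rewrite mulrBl mulrBl dE mulr_suml.
rewrite !sumrB -mulr_sumr sum_dhats// mulr0 subr0.
have -> : \sum_z F (node z) * hats (Some i) x z = dquasi i F x / N.
  by rewrite /dquasi mulr_suml; apply: eq_bigr => z _; rewrite [N * _]mulrC mulrA mulfK.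
have inner (k : 'I_3) : \sum_(z : grid) (G 0 k / N * (z k)%:R - G 0 k / N * (N * x 0 k + off%:R)) *
    hats (Some i) x z = G 0 k / N * (i == k)%:R.
  under eq_bigr do rewrite mulrBl -[X in X - _]mulrA.
  by rewrite sumrB -!mulr_sumr sum_dhats// mulr0 subr0 sum_dhats1.
rewrite exchange_big /=; under eq_bigr do rewrite inner.
rewrite (bigD1 i)//= eqxx big1 ?addr0 => [|k ki]; first by rewrite mulr1 mulrBl.
by rewrite eq_sym (negbTE ki) mulr0.
Qed.
End Errors.
End QuasiInterpolant.

(** * Approximation by test functions *)

Section Density.
Context {R : realType}.
Notation E := ('rV[R]_3).
Implicit Types (U O : set E) (f w : E -> R) (x y : E).

Lemma hats_const : exists2 K : R, 0 <= K &
  forall B n o x, \sum_z `|@hats R B n o x z| <= K.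
Proof.
have ch : continuous (@hat R) by case: (smooth1_hat (R := R) 0).
have ch' : continuous (@hat' R) by case: (smooth1_hat' (R := R) 0).
have [|H1 H10 hH1] := bounded_out ch.
  by move=> t ht; apply: hat_out; case: ht => /ltW; tauto.
have [H2 H20 hH2] := bounded_out ch' (@hat'_out R).
exists ((6 * (H1 + H2)) ^+ 3) => [|B n o x].
  by rewrite exprn_ge0// mulr_ge0// addr_ge0.
apply: sum_hats_norm; first exact: addr_ge0.
  by move=> t; apply: (le_trans (hH1 t)); rewrite lerDl.
by move=> t; apply: (le_trans (hH2 t)); rewrite lerDr.
Qed.

Lemma bounded_normE (U : set E) (r : R) : (forall x, U x -> `|x| <= r) -> bounded_set U.
Proof.
move=> Ur; exists r; split; first exact: num_real.
by move=> M rM x /Ur xr /=; apply: (le_trans xr); exact: ltW.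
Qed.

Lemma closed_inner (U : set E) (r : R) :
  closed [set x | forall y, `|y - x| < r -> U y].
Proof.
rewrite -openC (_ : ~` _ = \bigcup_(y in ~` U) ball y r).
  by apply: bigcup_open => y _; exact: ball_open.
rewrite eqEsubset; split => x.
  by move=> /existsNP[y] /not_implyP[yx Uy]; exists y => //; rewrite ballE_norm /= distrC.
by move=> [y Uy]; rewrite ballE_norm /= => xy /(_ y); rewrite distrC => /(_ xy).
Qed.

(** The factor 3 is the reach 2 of a bump plus 1 to spare: the support stays among the points at
    distance at least [1 / N] from the complement of [U], which form a closed set. *)
Lemma test_fun_quasi U B n f (r : R) : (forall x, U x -> `|x| <= r) ->
  (forall y x, f y != 0 -> `|x - y| < 3 / n.+1%:R -> U x) -> test_fun U (quasi B n f).
Proof.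
move=> Ur fU; set N : R := n.+1%:R in fU *.
have N0 : 0 < N by rewrite /N ltr0n.
pose C : set E := [set x | forall y, `|y - x| < N^-1 -> U y].
have CU : C `<=` U by move=> x; apply; rewrite subrr normr0 invr_gt0.
have cC : closed C by exact: closed_inner.
have sC : closure [set x | quasi B n f x != 0] `<=` C.
  rewrite [X in _ `<=` X](iffLR (closure_id C) cC); apply: closureS => x /= /quasi_supp[z [fz zx]] y yx.
  apply: (fU _ _ fz).
  have -> : y - node z = (y - x) + (x - node z) by rewrite addrA subrK.
  rewrite -/N distrC in zx; rewrite (le_lt_trans (ler_normD _ _))//.
  have -> : 3 / N = N^-1 + 2 / N by ring.
  exact: ltr_leD.
split; [move=> k; exact: Cn_quasi| |exact: subset_trans CU].
apply: subclosed_compact sC; first exact: closed_closure.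
apply: bounded_closed_compact => //.
by apply: (@bounded_normE _ r) => x /CU /Ur.
Qed.

Lemma inv_nat_lt (e : R) : 0 < e -> exists n0, forall n, (n0 <= n)%N -> n.+1%:R^-1 < e.
Proof.
move=> e0; exists (Num.bound e^-1) => n n0n.
rewrite invf_plt ?posrE//; apply: (lt_le_trans (archi_boundP _)); first by rewrite invr_ge0 ltW.
by rewrite ler_nat (leq_trans n0n).
Qed.

Lemma cont_eps f x : {for x, continuous f} -> forall e : R, 0 < e ->
  exists2 d : R, 0 < d & forall y, `|y - x| < d -> `|f y - f x| < e.
Proof.
move=> cf e e0.
have /nbhs_ballP[d /= d0 H] : nbhs x [set y | `|f y - f x| < e].
  by move/cvgrPdist_lt : cf => /(_ e e0); apply: filterS => y /=; rewrite distrC.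
by exists d => // y yx; apply: H; rewrite ballE_norm.
Qed.

(** Replacing [s] by 0 at the nodes too close to the complement of [U] gives compact support. At a
    fixed point of [U] the cut is out of reach for large [n], and continuity of [s] there
    suffices. *)
Lemma test_fun_density U (s : E -> R) (A : R) (B : nat) : open U ->
  (forall x, U x -> `|x| <= B%:R) -> (forall x, U x -> `|s x| <= A) ->
  {in U, continuous s} ->
  exists psi : nat -> E -> R, exists C : R,
    [/\ forall n, test_fun U (psi n), forall n x, U x -> `|psi n x| <= C &
        forall x, U x -> psi n x @[n --> \oo] --> s x].
Proof.
move=> oU UB sA cs; have [K K0 KP] := hats_const.
pose a n y := if `[< forall x, `|x - y| < 3 / n.+1%:R -> U x >] then s y else 0.
have aA n y : `|a n y| <= `|A|.
  rewrite /a; case: ifPn => [/asboolP h|_]; last by rewrite normr0.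
  rewrite (le_trans (sA _ _)) ?ler_norm//; apply: h.
  by rewrite subrr normr0 divr_gt0// ltr0n.
exists (fun n => quasi B n (a n)), (K * `|A|); split.
- move=> n; apply: (@test_fun_quasi U B n (a n) B%:R) => // y x; rewrite /a.
  by case: ifPn => [/asboolP h _|]; [exact: h|rewrite eqxx].
- move=> n x Ux; rewrite -[X in `|X|]subr0.
  apply: (@quasi_err R B n (a n) x K `|A| (UB _ Ux)) => // y _.
  by rewrite subr0.
- move=> x Ux; apply/cvgrPdist_le => e e0.
  have e1 : 0 < e / (K + 1) by rewrite divr_gt0// ltr_wpDl.
  have [d d0 dH] := cont_eps (cs x (mem_set Ux)) e1.
  have /nbhs_ballP[r /= r0 rU] : nbhs x U by move: oU; rewrite openE => /(_ x Ux).
  (* The 5 adds the reach 2 of a bump to the width 3 of the cut. *)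
  have m0 : 0 < Num.min d (r / 2) / 5 by rewrite divr_gt0// lt_min d0 divr_gt0.
  have [n0 n0P] := inv_nat_lt m0.
  near=> n; have nn0 : (n0 <= n)%N by near: n; exact: nbhs_infty_ge.
  have := n0P n nn0; rewrite ltr_pdivlMr// lt_min => /andP[h1 h2].
  have N0 : 0 < n.+1%:R^-1 :> R by rewrite invr_gt0 ltr0n.
  move: N0 h1 h2; set N : R := n.+1%:R^-1 => N0 h1 h2.
  rewrite distrC; apply: (@le_trans _ _ (K * (e / (K + 1)))); last first.
    by rewrite mulrCA ler_piMr ?(ltW e0)// ler_pdivrMr ?mul1r ?lerDl// ltr_wpDl.
  apply: (@quasi_err R B n (a n) x K (e / (K + 1)) (UB _ Ux) (ltW e1)) => // y yx.
  rewrite -/N in yx; rewrite /a ifT.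
    by apply/ltW/dH/(le_lt_trans yx); lra.
  apply/asboolP => z zy; apply: rU; rewrite ballE_norm /=.
  have -> : z - x = (z - y) + (y - x) by rewrite addrA subrK.
  by rewrite (le_lt_trans (ler_normD _ _))//; rewrite -/N in zy; lra.
Unshelve. all: by end_near. Qed.

Definition diffat w x (G : E) := forall e : R, 0 < e -> exists2 d : R, 0 < d &
  forall y, `|y - x| < d -> `|w y - w x - dotv (y - x) G| <= e * `|y - x|.

(** The local Lipschitz bound makes the gradients uniformly bounded. Where [w] is differentiable
    they converge, since the affine part is reproduced and the remainder on a grid patch is o(1 /
    N), against a factor [N]. *)
Lemma test_fun_grad_approx O w (G : E -> E) (U : set E) (A C r : R) (B : nat) :
  0 <= C -> 0 < r -> (forall x, O x -> `|x| <= B%:R) ->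
  (forall x, `|w x| <= A) ->
  (forall x y, `|y - x| < r -> `|w y - w x| <= C * `|y - x|) ->
  (forall y x, w y != 0 -> `|x - y| < r -> O x) ->
  U `<=` O -> (forall x, U x -> diffat w x (G x)) ->
  exists psi : nat -> E -> R, exists D : R,
    [/\ forall n, test_fun O (psi n),
        forall n x, O x -> `|psi n x| <= D,
        forall n i x, O x -> `|pderiv i (psi n) x| <= D,
        forall x, O x -> psi n x @[n --> \oo] --> w x &
        forall i x, U x -> pderiv i (psi n) x @[n --> \oo] --> G x 0 i].
Proof.
move=> C0 r0 OB wA wC wO UO dw; have [K K0 KP] := hats_const.
have r3 : 0 < r / 3 by rewrite divr_gt0.
have [n1 n1P] := inv_nat_lt r3.
have n1r n : 3 / (n + n1).+1%:R < r :> R.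
  by have := n1P _ (leq_addl n n1); rewrite ltr_pdivlMr// mulrC.
have A0 : 0 <= A by apply: le_trans (wA 0).
(* The shift by [n1] brings all bumps within the range [r] from the first index on, so the bounds
   hold for every [n]. *)
exists (fun n => quasi B (n + n1) w), (K * A + K * (2 * C)); split.
- move=> n; apply: (@test_fun_quasi O B (n + n1) w B%:R) => // y x wy xy.
  exact: (wO _ _ wy (lt_trans xy (n1r n))).
- move=> n x Ox; rewrite -[X in `|X|]subr0.
  apply: (@le_trans _ _ (K * A)); last by rewrite lerDl !mulr_ge0.
  by apply: (@quasi_err R B (n + n1) w x K A (OB _ Ox)) => // y _; rewrite subr0.
- move=> n i x Ox; rewrite (pd_pderiv (@pd_quasi R B (n + n1) i w)).
  apply: (@le_trans _ _ (K * (2 * C))); last by rewrite lerDr !mulr_ge0.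
  have N0 : 0 < (n + n1).+1%:R :> R by rewrite ltr0n.
  have -> : 2 * C = (n + n1).+1%:R * (C * (2 / (n + n1).+1%:R)).
    by rewrite mulrCA [X in C * X]mulrCA mulfV ?gt_eqF// mulr1 mulrC.
  apply: (@dquasi_bound R B (n + n1) w x K _ (OB _ Ox) _ _ i (w x)) => //.
    by rewrite mulr_ge0// divr_ge0// ltW.
  move=> y yx; apply: (le_trans (wC _ _ _)); last by rewrite ler_wpM2l.
  by apply: (le_lt_trans yx); apply: lt_trans (n1r n); rewrite ltr_pM2r ?invr_gt0// ltr_nat.
- move=> x Ox; apply/cvgrPdist_le => e e0.
  have e1 : 0 < e / (K * (2 * C) + 1) by rewrite divr_gt0// ltr_wpDl// !mulr_ge0.
  have [n0 n0P] := inv_nat_lt e1.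
  near=> n; have nn0 : (n0 <= n)%N by near: n; exact: nbhs_infty_ge.
  have := n0P (n + n1)%N (leq_trans nn0 (leq_addr _ _)).
  have N0 : 0 < (n + n1).+1%:R^-1 :> R by rewrite invr_gt0 ltr0n.
  have := n1r n; move: N0; set N : R := (n + n1).+1%:R^-1 => N0 h1 h2.
  rewrite distrC; apply: (@le_trans _ _ (K * (C * (2 * N)))); last first.
    rewrite ltr_pdivlMr ?ltr_wpDl// ?mulr_ge0// in h2.
    by apply: le_trans (ltW h2); nra.
  apply: (@quasi_err R B (n + n1) w x K _ (OB _ Ox)) => //.
    by rewrite !mulr_ge0// ltW.
  move=> y yx; rewrite -/N in yx; apply: (le_trans (wC _ _ _)); last by rewrite ler_wpM2l.
  by apply: (le_lt_trans yx); lra.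
- move=> i x Ux; apply/cvgrPdist_le => e e0.
  have e1 : 0 < e / (K * 2 + 1) by rewrite divr_gt0// ltr_wpDl// mulr_ge0.
  have [d d0 dH] := dw x Ux _ e1.
  have d3 : 0 < d / 3 by rewrite divr_gt0.
  have [n0 n0P] := inv_nat_lt d3.
  near=> n; have nn0 : (n0 <= n)%N by near: n; exact: nbhs_infty_ge.
  have := n0P (n + n1)%N (leq_trans nn0 (leq_addr _ _)); rewrite ltr_pdivlMr// => h1.
  have N0 : 0 < (n + n1).+1%:R :> R by rewrite ltr0n.
  rewrite distrC (pd_pderiv (@pd_quasi R B (n + n1) i w)).
  set e' := e / _ in e1 dH.
  apply: (@le_trans _ _ (K * ((n + n1).+1%:R * (e' * (2 / (n + n1).+1%:R))))); last first.
    have -> : (n + n1).+1%:R * (e' * (2 / (n + n1).+1%:R)) = e' * 2.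
      by rewrite mulrCA; congr (_ * _); rewrite mulrCA mulfV ?mulr1 ?gt_eqF.
    have eE : e = e' * (K * 2 + 1) by rewrite divfK// gt_eqF// ltr_wpDl// mulr_ge0.
    have -> : K * (e' * 2) = e' * (K * 2) by ring.
    by rewrite [leRHS]eE ler_wpM2l ?(ltW e1)// lerDl.
  apply: (@dquasi_err R B (n + n1) w x K _ (OB _ (UO _ Ux)) _ _ i (w x) (G x)) => //.
    by rewrite mulr_ge0 ?(ltW e1)// divr_ge0// ltW.
  move=> y yx; apply: (le_trans (dH _ _)); last by rewrite ler_wpM2l ?(ltW e1).
  apply: (le_lt_trans yx); have : 0 < (n + n1).+1%:R^-1 :> R by rewrite invr_gt0.
  by move: h1; set N : R := (n + n1).+1%:R^-1 => h1 N1; lra.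
Unshelve. all: by end_near. Qed.
End Density.

(** * Change of variables *)

(** Banach's fixed point theorem is applied to row vectors as a complete normed space. *)
HB.instance Definition _ (R : realType) :=
  Uniform_isComplete.Build 'rV[R]_3 (@cauchy_cvg 'rV[R]_3).

Lemma subrACA (V : zmodType) (a b x y : V) : (x - a) - (y - b) = (x - y) - (a - b).
Proof. by rewrite opprB opprB addrACA [RHS]addrACA [- a - y]addrC. Qed.

Section FixedPoint.
Context {R : realType}.

Lemma rV_fixed_point (U : set 'rV[R]_3) (f : 'rV[R]_3 -> 'rV[R]_3) (q : R) :
  closed U -> U !=set0 -> 0 <= q -> q < 1 -> (forall x, U x -> U (f x)) ->
  (forall x y, U x -> U y -> `|f x - f y| <= q * `|x - y|) ->
  exists2 p, U p & f p = p.
Proof.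
move=> cU U0 q0 q1 fU fq; have h : {homo f : x / U x >-> U x} by exact: fU.
have [|p Up pf] := @banach_fixed_point R 'rV[R]_3 U [the {fun U >-> U} of mkfun h] _ cU U0.
  exists (NngNum q0); split => //= -[x y] /= [Ux Uy]; exact: fq.
by exists p.
Qed.
End FixedPoint.

Lemma eps_cont (R : realType) (f : 'rV[R]_3 -> R) x :
  (forall e : R, 0 < e -> exists2 d : R, 0 < d & forall y, `|y - x| < d ->
    `|f y - f x| <= e) -> {for x, continuous f}.
Proof.
move=> h; have : f z @[z --> nbhs x] --> f x; last by [].
apply/cvgrPdist_le => e /h[d d0 dH].
by apply/nbhs_ballP; exists d => //= z; rewrite ballE_norm distrC => /dH.
Qed.

Section ChangeOfVariables.
Context {R : realType}.
Notation E := ('rV[R]_3).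
Notation mR := (measurableTypeR R).
Implicit Types (x y c v : E) (r e : R) (A : set E).
Variables (U : set E) (M Minv : E -> E) (D : E -> 'M[R]_3) (C : R).

(* A second-order Taylor estimate with the derivative taken at any third point
   [y]; [D x] acts on the right of row vectors. *)
Definition lin_est A := forall x x' y (rho : R), A x -> A x' -> A y ->
  `|x - y| <= rho -> `|x' - y| <= rho ->
  `|M x - M x' - (x - x') *m D y| <= C * rho * `|x - x'|.

Hypothesis oU : open U.
Hypothesis C0 : 0 < C.
Hypothesis est : forall x, U x -> exists2 r, 0 < r & ball x r `<=` U /\ lin_est (ball x r).
Hypothesis uD : forall x, U x -> D x \in unitmx.
Hypothesis iD : forall x v, U x -> `|v *m invmx (D x)| <= C * `|v|.
Hypothesis MK : forall x, U x -> Minv (M x) = x.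

(** The Taylor constant times the bound on the inverse derivative: [k * r] is the relative error of
    the linearization on a cube of radius [r]. *)
Let k : R := C * C.
Let k0 : 0 < k. Proof. exact: mulr_gt0. Qed.

Let err_inv (c x x' : E) (r : R) : U c -> `|M x - M x' - (x - x') *m D c| <= C * r * `|x - x'| ->
  `|(M x - M x') *m invmx (D c) - (x - x')| <= k * r * `|x - x'|.
Proof.
move=> Uc h.
have -> : (M x - M x') *m invmx (D c) - (x - x') =
    (M x - M x' - (x - x') *m D c) *m invmx (D c).
  by rewrite [RHS]mulmxBl mulmxK ?uD.
apply: (le_trans (iD _ Uc)); rewrite /k -!mulrA ler_wpM2l ?(ltW C0)//.
by rewrite [leRHS]mulrA.
Qed.

Lemma cube_image_sub c r : 0 < r -> cube c r `<=` U -> lin_est (cube c r) ->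
  forall x, cube c r x -> `|(M x - M c) *m invmx (D c)| <= r * (1 + k * r).
Proof.
move=> r0 cU ec x cx; have cc : cube c r c by apply/cubeP; rewrite ?subrr ?normr0 ltW.
have xc : `|x - c| <= r by apply/cubeP => //; exact: ltW.
have := @ec x c c r cx cc cc xc; rewrite subrr normr0 => /(_ (ltW r0)) /(err_inv (cU _ cc)) h.
rewrite -[_ *m _](subrK (x - c)) (le_trans (ler_normD _ _))// mulrDr mulr1 addrC.
apply: lerD => //; apply: (le_trans h).
by rewrite mulrC ler_wpM2r// mulr_ge0// ltW.
Qed.

(* [y] is reached by the fixed point of the simplified Newton map
   [x - (M x - y) (D c)^-1], a contraction of the cube. *)
Lemma cube_image_sup c r : 0 < r -> k * r <= 2^-1 -> cube c r `<=` U -> lin_est (cube c r) ->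
  forall y, `|(y - M c) *m invmx (D c)| <= r * (1 - 2 * k * r) ->
  exists2 x, `|x - c| < r & M x = y.
Proof.
move=> r0 kr cU ec y yc; have cc : cube c r c by apply/cubeP; rewrite ?subrr ?normr0 ltW.
have Uc := cU _ cc; have kr0 : 0 < k * r by rewrite mulr_gt0.
pose g x := x - (M x - y) *m invmx (D c).
have gg x x' : cube c r x -> cube c r x' -> `|g x - g x'| <= k * r * `|x - x'|.
  move=> cx cx'; have xc : `|x - c| <= r by apply/cubeP => //; exact: ltW.
  have xc' : `|x' - c| <= r by apply/cubeP => //; exact: ltW.
  have := err_inv Uc (ec x x' c r cx cx' cc xc xc'); apply: le_trans.
  have -> : (M x - M x') *m invmx (D c) =
      (M x - y) *m invmx (D c) - (M x' - y) *m invmx (D c).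
    by rewrite -mulmxBl opprB addrA subrK.
  by rewrite [leRHS]distrC /g subrACA.
have gc : `|g c - c| <= r * (1 - 2 * k * r).
  by rewrite /g addrAC subrr add0r -mulNmx opprB.
(* The margin [2 * k * r] pays once for the contraction error and leaves as much again, so the fixed
   point lies strictly inside the cube, hence in the half-open cell used later. *)
have gr x : cube c r x -> `|g x - c| <= r * (1 - k * r).
  move=> cx; have xc : `|x - c| <= r by apply/cubeP => //; exact: ltW.
  rewrite -(subrK (g c) (g x)) -addrA (le_trans (ler_normD _ _))//.
  apply: (@le_trans _ _ (k * r * r + r * (1 - 2 * k * r))); last by rewrite le_eqVlt; apply/orP; left; apply/eqP; ring.
  by apply: lerD => //; apply: (le_trans (gg _ _ cx cc)); rewrite ler_wpM2l// ltW.
have cub x : cube c r x <-> `|x - c| <= r by apply: cubeP; exact: ltW.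
have [||||x cx|x x' cx cx'|p cp gp] := @rV_fixed_point R (cube c r) g (k * r).
- have -> : cube c r = closed_ball c r.
    rewrite closed_ballE// eqEsubset; split => x; rewrite cub /closed_ball_ /=; by rewrite distrC.
  exact: closed_ball_closed.
- by exists c.
- exact: ltW.
- by rewrite (le_lt_trans kr)//; lra.
- apply/cub; apply: (le_trans (gr _ cx)).
  by rewrite ger_pMr//; lra.
- exact: gg.
exists p; first by rewrite -gp (le_lt_trans (gr _ cp))// gtr_pMr//; lra.
have : (M p - y) *m invmx (D c) = 0.
  by move: gp; rewrite /g => /eqP; rewrite subr_eq addrC -subr_eq subrr => /eqP <-.
move=> /(congr1 (mulmx^~ (D c))); rewrite /= mulmxKV ?uD// mul0mx => /eqP.
by rewrite subr_eq0 => /eqP.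
Qed.

Lemma ball_cube c r r' : r < r' -> cube c r `<=` ball c r'.
Proof.
move=> rr x cx; rewrite ballE_norm /=; have [r0|r0] := leP 0 r.
  by apply: le_lt_trans rr; apply/cubeP.
by have := cx 0; rewrite leNgt (lt_le_trans r0).
Qed.

Lemma open_image x e : U x -> 0 < e -> exists2 d, 0 < d &
  forall y, `|y - M x| < d -> exists x', [/\ U x', `|x' - x| < e & M x' = y].
Proof.
move=> Ux e0; have [r0 r00 [bU eb]] := est Ux.
(* With [k * r <= 4^-1] the cube image reaches at least half the linearized cube; the radius
   [r / (2 * C)] below is what the inverse derivative maps into that half. *)
pose r := Num.min (Num.min (r0 / 2) e) (4 * k)^-1.
have r_gt0 : 0 < r by rewrite !lt_min divr_gt0// e0 invr_gt0 mulr_gt0.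
have rr0 : r < r0 by rewrite (@le_lt_trans _ _ (r0 / 2)) ?ge_min ?lexx//; lra.
have re : r <= e by rewrite !ge_min lexx orbT.
have kr : k * r <= 4^-1.
  have : r <= (4 * k)^-1 by rewrite !ge_min lexx orbT.
  by rewrite -(ler_pM2l k0) => /le_trans -> //; rewrite invfM mulrCA mulfV ?mulr1// gt_eqF.
have cU : cube x r `<=` U by apply: subset_trans bU; exact: ball_cube.
have ce : lin_est (cube x r).
  by move=> y y' z rho cy cy' cz; apply: eb; exact: (ball_cube rr0).
exists (r / (2 * C)); first by rewrite divr_gt0// mulr_gt0.
move=> y yM; have [||x' x'x Mx'] := cube_image_sup r_gt0 _ cU ce (y := y).
- by lra.
- apply: (le_trans (iD _ Ux)); apply: (@le_trans _ _ (r * 2^-1)).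
    rewrite -ler_pdivlMl//; apply: (le_trans (ltW yM)); rewrite invfM.
    by rewrite le_eqVlt; apply/orP; left; apply/eqP; ring.
  by rewrite ler_pM2l//; lra.
exists x'; split => //; last exact: lt_le_trans re.
by apply: cU; apply/cubeP; exact: ltW.
Qed.

Lemma open_imageU : open (M @` U).
Proof.
rewrite openE => _ [x Ux <-]; have [d d0 h] := open_image Ux ltr01.
apply/nbhs_ballP; exists d => //= y; rewrite ballE_norm /= => /h[x' [Ux' _ <-]].
by exists x'.
Qed.

Lemma continuous_inv (f : E -> R) : {in U, continuous f} ->
  {in M @` U, continuous (fun y => f (Minv y))}.
Proof.
move=> cf y; rewrite inE => -[x Ux <-]; apply: eps_cont => e e0.
have [d d0 dH] := cont_eps (cf x (mem_set Ux)) e0.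
have [d' d'0 h] := open_image Ux d0.
exists d' => // z /h[x' [Ux' x'x <-]].
by rewrite !MK//; exact/ltW/dH.
Qed.

(** Half-open, so that the cells of a grid are disjoint; they lie between an open ball and a closed
    cube of the same radius. *)
Definition cell c r : set E := [set x | forall i, c 0 i - r <= x 0 i < c 0 i + r].

Lemma cell_cube c r : cell c r `<=` cube c r.
Proof. by move=> x h i; have /andP[h1 h2] := h i; rewrite ler_distl h1 ltW. Qed.

Lemma ball_cell c r : 0 < r -> ball c r `<=` cell c r.
Proof.
move=> r0 x /(ball_coord _ _ r0) h i; have := h i; rewrite ltr_distl => /andP[h1 h2].
by rewrite ltW.
Qed.

Lemma cell_box c r : cell c r = box (fun i => `[c 0 i - r, c 0 i + r[%classic).
Proof. by rewrite eqEsubset; split => x h i; have := h i; rewrite /= in_itv. Qed.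

Lemma mset_cell c r : mset (cell c r).
Proof. by rewrite cell_box; exact: mset_box. Qed.

Lemma vol_cell c r : 0 < r -> vol (cell c r) = ((2 * r) ^+ 3)%:E.
Proof.
move=> r0; rewrite cell_box vol_box//.
rewrite (eq_bigr (fun=> (2 * r)%:E)) => [|i _].
  by rewrite !big_ord_recr big_ord0 /= -!EFinM; congr EFin; ring.
rewrite lebesgue_measure_itv /= lte_fin ifT; last by lra.
by rewrite -EFinD; congr EFin; ring.
Qed.

Lemma image_inv A : A `<=` U -> M @` A = (M @` U) `&` [set y | A (Minv y)].
Proof.
move=> AU; rewrite eqEsubset; split => y.
  move=> [x Ax <-]; split; first by exists x => //; exact: AU.
  by rewrite /= MK//; exact: AU.
by move=> [[x Ux <-]]; rewrite /= MK// => Ax; exists x.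
Qed.

Lemma mset_image_cell c r : cell c r `<=` U -> mset (M @` cell c r).
Proof.
move=> cU; rewrite image_inv//.
have -> : M @` U `&` [set y | cell c r (Minv y)] =
  \bigcap_(i in [set: 'I_3]) (M @` U `&` (fun y => Minv y 0 i) @^-1` `[c 0 i - r, c 0 i + r[).
  rewrite eqEsubset; split => y.
    by move=> [MU h] i _; split => //=; rewrite in_itv; exact: h.
  move=> h; split; first by have [] := h 0 Logic.I.
  by move=> i; have [_] := h i Logic.I; rewrite /= in_itv.
rewrite /mset preimage_bigcap; apply: fin_bigcap_measurable => // i _.
apply: meas3_preim => //; first by apply: mset_open; exact: open_imageU.
apply: meas3_open; first exact: open_imageU.
by apply: (@continuous_inv (fun x => x 0 i)) => x _; exact: continuous_coord.
Qed.

Lemma vol_linear_cube (y0 : E) (L : 'M[R]_3) (rho : R) : L \in unitmx -> 0 <= rho ->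
  let A := [set y | `|(y - y0) *m invmx L| <= rho] in
  mset A /\ vol A = (`|\det L| * (2 * rho) ^+ 3)%:E.
Proof.
move=> uL r0 A.
have uI : invmx L \in unitmx by rewrite unitmx_inv.
have AE : A = (fun y => y - y0) @^-1` ((fun x => x *m invmx L) @^-1` cube 0 rho).
  rewrite eqEsubset; split => y; rewrite /A /=.
    by move=> h; apply/cubeP; rewrite ?subr0.
  by move=> /(cubeP _ _ r0); rewrite subr0.
have m1 : mset ((fun x : E => x *m invmx L) @^-1` cube 0 rho).
  by apply: mset_preimage; [exact: mmap_mulmx|exact: mset_cube].
split; rewrite AE; last first.
  by rewrite vol_shift// vol_linear//; [rewrite vol_cube// -EFinM det_inv normfV invrK|exact: mset_cube].
apply: mset_preimage => // i; under eq_fun do rewrite mxE.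
by apply: measurable_funD => //; exact: measurable_row3_coord.
Qed.

(** The image lies between the linear images of cubes dilated by [1 - 2 * t] and [1 + t], where
    [t = k * r]. For [t <= 2^-1] the cubes of both factors differ from 1 by at most [7 * t]. *)
Lemma vol_image_cell c r : 0 < r -> k * r <= 2^-1 -> cube c r `<=` U -> lin_est (cube c r) ->
  `|fine (vol (M @` cell c r)) - `|\det (D c)| * (2 * r) ^+ 3| <=
    `|\det (D c)| * (2 * r) ^+ 3 * (7 * (k * r)).
Proof.
move=> r0 kr cU ec; have kr0 : 0 < k * r by rewrite mulr_gt0.
have Uc : U c by apply: cU; apply/cubeP; rewrite ?subrr ?normr0 ltW.
have cellU : cell c r `<=` U by apply: subset_trans cU; exact: cell_cube.
have mC := mset_image_cell cellU.
have [|mA volA] := vol_linear_cube (M c) (uD Uc) (rho := r * (1 + k * r)).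
  by rewrite mulr_ge0 ?ltW// addr_gt0.
have [|mB volB] := vol_linear_cube (M c) (uD Uc) (rho := r * (1 - 2 * k * r)).
  by rewrite mulr_ge0 ?(ltW r0)//; lra.
have h1 : (vol (M @` cell c r) <= (`|\det (D c)| * (2 * (r * (1 + k * r))) ^+ 3)%:E)%E.
  rewrite -volA; apply: vol_le => // _ [x cx <-] /=.
  by apply: cube_image_sub => //; exact: cell_cube.
have h2 : ((`|\det (D c)| * (2 * (r * (1 - 2 * k * r))) ^+ 3)%:E <= vol (M @` cell c r))%E.
  rewrite -volB; apply: vol_le => // y /(cube_image_sup r0 kr cU ec)[x xc <-].
  by exists x => //; apply: ball_cell => //; rewrite ballE_norm.
move: h1 h2; have : (0 <= vol (M @` cell c r))%E by exact: measure_ge0.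
case: (vol _) => [a| |] //; rewrite !lee_fin /= => _ h1 h2.
have d0 : 0 <= `|\det (D c)| * (2 * r) ^+ 3.
  by rewrite mulr_ge0// exprn_ge0// mulr_ge0// ltW.
move: h1 h2; have E1 (t : R) : `|\det (D c)| * (2 * (r * t)) ^+ 3 =
    `|\det (D c)| * (2 * r) ^+ 3 * t ^+ 3 by ring.
rewrite !E1; move: d0; set d := `|_| * _ => d0 h1 h2.
rewrite ler_distl; apply/andP; split.
  apply: le_trans h2; rewrite -[X in X - _]mulr1 -mulrBr ler_wpM2l//.
  rewrite -mulrA; set t := k * r in kr kr0 *; rewrite !exprS expr0; nra.
apply: (le_trans h1).
have -> : d + d * (7 * (k * r)) = d * (1 + 7 * (k * r)) by ring.
rewrite ler_wpM2l//.
set t := k * r in kr kr0 *; rewrite !exprS expr0; nra.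
Qed.

(** * Riemann sums on uniform grids *)

Section StepFunctions.
Variables (B n : nat).
Let N : R := n.+1%:R.
Let r : R := (2 * N)^-1.
Let L : nat := (2 * B * n.+1)%N.
Let grid := {ffun 'I_3 -> 'I_L}.

Let N0 : 0 < N. Proof. by rewrite /N ltr0n. Qed.
Let r0 : 0 < r. Proof. by rewrite invr_gt0 mulr_gt0. Qed.

(** Midpoints of the cells of side [1 / N] that tile [-B, B)^3. *)
Definition center (z : grid) : E := \row_i (((z i)%:R + 2^-1) / N - B%:R).

Lemma cell_center (z : grid) x : cell (center z) r x <->
  forall i, (z i)%:R <= (x 0 i + B%:R) * N < (z i)%:R + 1.
Proof.
have E i : (center z 0 i - r <= x 0 i < center z 0 i + r) =
    ((z i)%:R <= (x 0 i + B%:R) * N < (z i)%:R + 1).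
  rewrite mxE /r.
  have -> : ((z i)%:R + 2^-1) / N - B%:R - (2 * N)^-1 = (z i)%:R / N - B%:R.
    by field; rewrite gt_eqF.
  have -> : ((z i)%:R + 2^-1) / N - B%:R + (2 * N)^-1 = ((z i)%:R + 1) / N - B%:R.
    by field; rewrite gt_eqF.
  by rewrite lerBlDr ler_pdivrMr// ltrBrDr ltr_pdivlMr.
by split => h i; have := h i; rewrite E.
Qed.

Lemma cell_exists x : `|x| < B%:R -> exists z, cell (center z) r x.
Proof.
move=> xB; have t i : 0 <= (x 0 i + B%:R) * N < L%:R.
  have := le_lt_trans (coord_norm x i) xB; rewrite ltr_norml => /andP[h1 h2].
  have -> : L%:R = (B%:R + B%:R) * N by rewrite /L !natrM /N; ring.
  by rewrite mulr_ge0 ?(ltW N0)// ?ltr_pM2r//; lra.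
have kP i : exists j : 'I_L, j%:R <= (x 0 i + B%:R) * N < j%:R + 1.
  have /andP[t0 tL] := t i.
  have /andP[h1 h2] := Num.Theory.truncn_itv t0.
  set j := Num.truncn _ in h1 h2; have jL : (j < L)%N.
    by rewrite -(ltr_nat R) (le_lt_trans h1).
  by exists (Ordinal jL); rewrite /= h1 natr1.
have /choice[f fP] := kP.
by exists [ffun i => f i]; apply/cell_center => i; rewrite ffunE.
Qed.

Lemma cell_unique (z z' : grid) x : cell (center z) r x -> cell (center z') r x -> z = z'.
Proof.
move=> /cell_center h /cell_center h'; apply/ffunP => i; apply/val_inj/eqP.
have /andP[h1 h2] := h i; have /andP[h3 h4] := h' i.
have a1 : (z i < (z' i).+1)%N by rewrite -(ltr_nat R) -natr1 (le_lt_trans h1 h4).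
have a2 : (z' i < (z i).+1)%N by rewrite -(ltr_nat R) -natr1 (le_lt_trans h3 h2).
by rewrite !ltnS in a1 a2; rewrite eqn_leq a1 a2.
Qed.

(** The cells to which [vol_image_cell] applies. The others, near the boundary of [U], get the value
    0 in step functions; each point of [U] is in an admissible cell for all large [n]. *)
Definition adm (z : grid) : bool :=
  `[< [/\ cube (center z) r `<=` U, lin_est (cube (center z) r) & k * r <= 2^-1] >].

Definition stepc (f : E -> R) (z : grid) : R := if adm z then f (center z) else 0.

Definition stepf (f : E -> R) x : R := \sum_(z : grid) stepc f z * \1_(cell (center z) r) x.

Lemma stepfE f z x : cell (center z) r x -> stepf f x = stepc f z.
Proof.
move=> zx; rewrite /stepf (bigD1 z)//= indicE mem_set// mulr1 big1 ?addr0// => z' zz'.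
rewrite indicE memNset ?mulr0// => zx'; move/eqP: zz'; apply.
exact: cell_unique zx' zx.
Qed.

Lemma adm_center z : adm z -> U (center z).
Proof. by move=> /asboolP[h _ _]; apply: h; apply/cubeP; rewrite ?subrr ?normr0 ltW. Qed.

Lemma stepc_bound f (A : R) : 0 <= A -> (forall x, U x -> `|f x| <= A) ->
  forall z, `|stepc f z| <= A.
Proof.
move=> A0 fA z; rewrite /stepc; case: ifPn => [/adm_center/fA //|_]; by rewrite normr0.
Qed.

Lemma meas3_indic A V : mset A -> meas3 V (\1_A : E -> R).
Proof.
move=> mA; rewrite /meas3 (_ : _ \o _ = \1_(@row3 R @^-1` A)).
  exact: measurable_indic.
by apply/funext => p; rewrite /= !indicE.
Qed.

Lemma integ_indic A V (a : R) : mset V -> (vol V < +oo)%E -> mset A ->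
  integ V (fun x => a * \1_A x).
Proof.
move=> mV fV mA; apply: integZ => //; apply: (integ_bounded (a := 1)) => //.
  exact: meas3_indic.
by move=> x _; rewrite indicE; case: (_ \in _); rewrite ?normr1 ?normr0.
Qed.

Lemma meas3_stepf V f : meas3 V (stepf f).
Proof.
by apply: meas3_sum => z; apply: meas3M; [exact: meas3_cst|exact: meas3_indic (mset_cell _ _)].
Qed.

Lemma int3_stepf f : mset U -> (vol U < +oo)%E ->
  int3 U (stepf f) = \sum_(z : grid) stepc f z * (2 * r) ^+ 3.
Proof.
move=> mU fU; rewrite int3_sum//; last first.
  by move=> z; exact: integ_indic (mset_cell _ _).
apply: eq_bigr => z _; rewrite /stepc; case: ifPn => [/asboolP[cU _ _]|_]; last first.
  by rewrite mul0r (@eq_int3 _ _ _ (fun=> 0)) ?/int3 ?Rintegral_cst ?mul0r// => x _; rewrite mul0r.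
have h1 : integ U (\1_(cell (center z) r) : E -> R).
  have := @integ_indic (cell (center z) r) U 1 mU fU (mset_cell _ _).
  by apply: eq_integ => // x _; rewrite mul1r.
rewrite int3Z// int3_indic//; [by rewrite vol_cell|exact: mset_cell|].
by apply: subset_trans cU; exact: cell_cube.
Qed.

Definition image_cell (z : grid) : set E :=
  if adm z then M @` cell (center z) r else set0.

Lemma adm_cell z : adm z -> cell (center z) r `<=` U.
Proof. by move=> /asboolP[cU _ _]; apply: subset_trans cU; exact: cell_cube. Qed.

Lemma mset_image_adm z : mset (image_cell z).
Proof.
rewrite /image_cell; case: ifPn => [/adm_cell|_]; first exact: mset_image_cell.
by rewrite /mset preimage_set0.
Qed.

Lemma stepf_image f y : (M @` U) y ->
  stepf f (Minv y) = \sum_(z : grid) stepc f z * \1_(image_cell z) y.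
Proof.
move=> My; apply: eq_bigr => z _; rewrite /stepc /image_cell.
case: ifPn => [/adm_cell cU|_]; last by rewrite !mul0r.
rewrite !indicE; congr (_ * (_ : bool)%:R); rewrite [in RHS]image_inv//.
by apply/idP/idP; rewrite !inE => //= -[].
Qed.

Lemma meas3_stepf_image f : meas3 (M @` U) (fun y => stepf f (Minv y)).
Proof.
apply: (@eq_meas3 _ _ (fun y => \sum_z stepc f z * \1_(image_cell z) y)).
  by move=> y; rewrite inE => My; rewrite stepf_image.
by apply: meas3_sum => z; apply: meas3M; [exact: meas3_cst|exact: meas3_indic (mset_image_adm z)].
Qed.

Lemma int3_stepf_image f : mset (M @` U) -> (vol (M @` U) < +oo)%E ->
  int3 (M @` U) (fun y => stepf f (Minv y)) =
  \sum_(z : grid) stepc f z * fine (vol (M @` cell (center z) r)).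
Proof.
move=> mU fU; rewrite (@eq_int3 _ _ _ (fun y => \sum_(z : grid) stepc f z * \1_(image_cell z) y)).
  2: by move=> y; rewrite inE => /stepf_image.
have mA := mset_image_adm.
rewrite int3_sum//; last by move=> z; exact: integ_indic.
apply: eq_bigr => z _; rewrite /stepc /image_cell; case: ifPn => [/adm_cell cU|_]; last first.
  by rewrite mul0r (@eq_int3 _ _ _ (fun=> 0)) ?/int3 ?Rintegral_cst ?mul0r// => x _; rewrite mul0r.
have mI : mset (M @` cell (center z) r) by exact: mset_image_cell.
have h1 : integ (M @` U) (\1_(M @` cell (center z) r) : E -> R).
  have := @integ_indic (M @` cell (center z) r) (M @` U) 1 mU fU mI.
  by apply: eq_integ => // x _; rewrite mul1r.
by rewrite int3Z// int3_indic//; exact: image_subset.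
Qed.

(** There are (2 B N)^3 cells, each with an error of order N^-4: volume N^-3 times a relative error
    [7 * (k * r)] with [r = (2 * N)^-1]. *)
Lemma stepf_diff f (A Cd : R) : 0 <= A -> (forall x, U x -> `|f x| <= A) ->
  (forall x, U x -> `|\det (D x)| <= Cd) -> 0 <= Cd ->
  mset U -> (vol U < +oo)%E -> mset (M @` U) -> (vol (M @` U) < +oo)%E ->
  `|int3 (M @` U) (fun y => stepf f (Minv y)) - int3 U (stepf (fun x => f x * `|\det (D x)|))|
    <= (2 * B%:R) ^+ 3 * (A * Cd * 7 * k) / (2 * N).
Proof.
move=> A0 fA DC Cd0 mU fU mMU fMU; rewrite int3_stepf_image// int3_stepf// -sumrB.
rewrite (le_trans (ler_norm_sum _ _ _))//.
have r2 : 2 * r = N^-1 by rewrite /r invfM mulrA mulfV ?mul1r// pnatr_eq0.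
apply: (@le_trans _ _ (\sum_(z : grid) A * (Cd * (2 * r) ^+ 3 * (7 * (k * r))))); last first.
  have cg : #|grid|%:R = (2 * B%:R * N) ^+ 3 :> R.
    by rewrite card_ffun !card_ord natrX /L !natrM.
  rewrite sumr_const -[leLHS]mulr_natl cg r2 /r.
  by rewrite le_eqVlt; apply/orP; left; apply/eqP; field; rewrite gt_eqF.
apply: ler_sum => z _; rewrite /stepc; case: ifPn => [az|_]; last first.
  by rewrite !mul0r subrr normr0; do !apply: mulr_ge0 => //; exact: ltW.
have Uz := adm_center az; have /asboolP[cU ce kr] := az.
rewrite -mulrA -mulrBr normrM ler_pM// ?fA//.
apply: (le_trans (vol_image_cell r0 kr cU ce)).
have kr0 : 0 <= 7 * (k * r) by do !apply: mulr_ge0 => //; exact: ltW.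
apply: ler_wpM2r => //; apply: ler_wpM2r; last exact: DC.
by rewrite exprn_ge0// mulr_ge0// ltW.
Qed.
End StepFunctions.

Lemma stepf_cvg B f x : U x -> `|x| < B%:R -> {for x, continuous f} ->
  stepf B n f x @[n --> \oo] --> f x.
Proof.
move=> Ux xB cf; apply/cvgrPdist_le => e e0.
have [d d0 dH] := cont_eps cf e0.
have [r r0 [bU eb]] := est Ux.
(* A point is within half a step of the centre of its cell, and within a full step of every point of
   the closed cube; the bound by [k^-1] gives the last clause of [adm]. *)
have m0 : 0 < Num.min (Num.min d r / 2) k^-1.
  by rewrite lt_min divr_gt0 ?lt_min ?d0// invr_gt0.
have [n0 n0P] := inv_nat_lt m0.
near=> n; have /n0P : (n0 <= n)%N by near: n; exact: nbhs_infty_ge.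
have N0 : 0 < n.+1%:R^-1 :> R by rewrite invr_gt0.
have N2 : 0 <= n.+1%:R^-1 / 2 :> R by rewrite divr_ge0// ltW.
have rE : (2 * n.+1%:R)^-1 = n.+1%:R^-1 / 2 :> R by rewrite invfM mulrC.
have [z zx] := @cell_exists B n x xB.
rewrite (stepfE _ zx).
have /cubeP := cell_cube zx; rewrite rE => /(_ N2).
move: N0 zx; rewrite /stepc; set N : R := n.+1%:R^-1 => N0 zx xz.
rewrite lt_min ltr_pdivlMr// lt_min => /andP[/andP[Nd Nr] Nk].
have cb : cube (center z) (2 * n.+1%:R)^-1 `<=` ball x r.
  move=> y /cubeP; rewrite rE => /(_ N2) yz.
  rewrite ballE_norm /= -(subrK (center z) y) -addrA (le_lt_trans (ler_normD _ _))//.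
  by rewrite -/N in yz; rewrite [`|_ - x|]distrC; lra.
rewrite ifT.
  rewrite distrC; apply/ltW/dH; rewrite distrC; lra.
apply/asboolP; split.
- exact: subset_trans bU.
- by move=> a b c rho /cb ca /cb cc /cb; exact: eb.
- rewrite rE -/N; have : k * N < 1 by rewrite mulrC -ltr_pdivlMr// div1r.
  by move=> h; lra.
Unshelve. all: by end_near. Qed.

Theorem change_of_variables (B : nat) (B' A Cd : R) (f : E -> R) :
  (forall x, U x -> `|x| < B%:R) -> (forall x, U x -> `|M x| <= B') ->
  (forall x, U x -> `|\det (D x)| <= Cd) -> {in U, continuous (fun x => \det (D x))} ->
  (forall x, U x -> `|f x| <= A) -> {in U, continuous f} ->
  int3 (M @` U) (fun y => f (Minv y)) = int3 U (fun x => f x * `|\det (D x)|).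
Proof.
move=> UB MB DC cD fA cf.
have mU : mset U by exact: mset_open.
have fU : (vol U < +oo)%E by apply: (@vol_bounded _ _ B%:R) => // x /UB/ltW.
have mMU : mset (M @` U) by apply: mset_open; exact: open_imageU.
have fMU : (vol (M @` U) < +oo)%E by apply: (@vol_bounded _ _ B') => // _ [x Ux <-]; exact: MB.
have A0 : 0 <= `|A| by [].
have fA' x : U x -> `|f x| <= `|A| by move=> /fA /le_trans -> //; exact: ler_norm.
have DC' x : U x -> `|\det (D x)| <= `|Cd| by move=> /DC /le_trans -> //; exact: ler_norm.
pose fd x := f x * `|\det (D x)|.
have fdA x : U x -> `|fd x| <= `|A| * `|Cd|.
  by move=> Ux; rewrite /fd normrM normr_id ler_pM// ?fA'// DC'.
have cfd : {in U, continuous fd}.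
  move=> x Ux; have cn : `|\det (D y)| @[y --> x] --> `|\det (D x)|.
    exact: (cvg_norm (cD x Ux)).
  exact: cvgM (cf x Ux) cn.
have sb g (a : R) n x : 0 <= a -> (forall x, U x -> `|g x| <= a) -> U x ->
    `|stepf B n g x| <= a.
  move=> a0 ga /UB/(@cell_exists B n)[z zx].
  by rewrite (stepfE _ zx); exact: stepc_bound.
have c1 : int3 (M @` U) (fun y => stepf B n f (Minv y)) @[n --> \oo] -->
    int3 (M @` U) (fun y => f (Minv y)).
  apply: (@int3_dct R _ _ _ (fun=> `|A|)) => //.
  - by move=> n; exact: meas3_stepf_image.
  - by apply: meas3_open; [exact: open_imageU|exact: continuous_inv].
  - exact: integ_cst.
  - by move=> _ [x Ux <-]; rewrite MK//; apply: stepf_cvg; [|exact: UB|exact/cf/mem_set].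
  - by move=> n _ [x Ux <-]; rewrite MK//; exact: sb.
have c2 : int3 U (stepf B n fd) @[n --> \oo] --> int3 U fd.
  apply: (@int3_dct R _ _ _ (fun=> `|A| * `|Cd|)) => //.
  - by move=> n; exact: meas3_stepf.
  - exact: meas3_open.
  - exact: integ_cst.
  - by move=> x Ux; apply: stepf_cvg; [|exact: UB|exact/cfd/mem_set].
  - by move=> n x Ux; apply: sb => //; exact: mulr_ge0.
have c3 : int3 (M @` U) (fun y => stepf B n f (Minv y)) - int3 U (stepf B n fd)
    @[n --> \oo] --> (0 : R).
  pose K := (2 * B%:R) ^+ 3 * (`|A| * `|Cd| * 7 * k).
  have K0 : 0 <= K by rewrite mulr_ge0 ?exprn_ge0 ?mulr_ge0// ltW.
  apply/cvgrPdist_le => e e0.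
  have e1 : 0 < e / (K + 1) by rewrite divr_gt0// ltr_wpDl.
  have [n0 n0P] := inv_nat_lt e1.
  near=> n; have /n0P : (n0 <= n)%N by near: n; exact: nbhs_infty_ge.
  have N0 : 0 < n.+1%:R^-1 :> R by rewrite invr_gt0.
  rewrite sub0r normrN ltr_pdivlMr ?ltr_wpDl// => ne.
  apply: (le_trans (stepf_diff B n A0 fA' DC' (normr_ge0 _) mU fU mMU fMU)).
  rewrite -/K invfM; move: ne N0; set N : R := n.+1%:R^-1 => ne N0.
  apply: le_trans (ltW ne); have -> : K * (2^-1 * N) = N * (K / 2) by ring.
  by rewrite ler_wpM2l ?(ltW N0)//; lra.
have c12 : int3 (M @` U) (fun y => stepf B n f (Minv y)) - int3 U (stepf B n fd)
    @[n --> \oo] --> int3 (M @` U) (fun y => f (Minv y)) - int3 U fd by exact: cvgB.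
have /eqP : int3 (M @` U) (fun y => f (Minv y)) - int3 U fd = 0.
  by rewrite -(cvg_lim (@Rhausdorff R) c12) (cvg_lim (@Rhausdorff R) c3).
by rewrite subr_eq0 => /eqP.
Unshelve. all: by end_near. Qed.
End ChangeOfVariables.

(** * Functions of class C^1 and test functions *)

Section TestFunctions.
Context {R : realType}.
Notation E := ('rV[R]_3).
Notation "''d_' i" := (delta_mx (0 : 'I_1) (i : 'I_3) : E) (at level 0, i at level 2).
Implicit Types (f psi : E -> R) (x y : E) (U : set E).

Lemma MVT_line (g g' : R -> R) (a b : R) : (forall t : R, is_derive t 1 g (g' t)) ->
  exists2 c, `|c - a| <= `|b - a| & g b - g a = g' c * (b - a).
Proof.
move=> dg; have cg t : {for t, continuous g}.
  by have [+ _] := dg t; move=> /derivable1_diffP/differentiable_continuous.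
have mvt u v : u < v -> exists2 c, u <= c <= v & g v - g u = g' c * (v - u).
  move=> uv; have [|c] := @MVT R g g' u v uv (fun t _ => dg t).
    by apply: continuous_subspaceT => t; exact: cg.
  by rewrite in_itv /= => /andP[c1 c2] ->; exists c => //; rewrite (ltW c1) ltW.
have [ab|ba|->] := ltgtP a b; last by exists b; rewrite ?subrr ?mulr0.
  have [c /andP[c1 c2] gE] := mvt _ _ ab; exists c => //.
  by rewrite ger0_norm ?subr_ge0// gtr0_norm ?subr_gt0// lerB.
have [c /andP[c1 c2] gE] := mvt _ _ ba; exists c.
  by rewrite ler0_norm ?subr_le0// ltr0_norm ?subr_lt0//; lra.
by rewrite -opprB gE; ring.
Qed.

Lemma is_derive_along f f' i x t : pd i f f' ->
  is_derive (t : R) 1 (fun h : R => f (h *: 'd_i + x)) (f' (t *: 'd_i + x)).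
Proof.
move=> df; have [d1 d2] := df (t *: 'd_i + x).
have eqf : (fun h : R => h^-1 *: (((fun h : R => f (h *: 'd_i + x)) \o shift t) (h *: 1) -
      (fun h : R => f (h *: 'd_i + x)) t)) =
    (fun h : R => h^-1 *: ((f \o shift (t *: 'd_i + x)) (h *: 'd_i) - f (t *: 'd_i + x))).
  apply/funext => h; congr (_ *: (f _ - _)); rewrite /= /shift /=.
  have -> : h *: (1 : R) = h by rewrite /GRing.scale /= mulr1.
  by rewrite scalerDl addrA.
split; first by move: d1; rewrite /derivable eqf.
by move: d2; rewrite /derive eqf.
Qed.

Lemma pd_increment f f' i x (h : R) : pd i f f' ->
  exists2 c : R, `|c| <= `|h| & f (h *: 'd_i + x) - f x = f' (c *: 'd_i + x) * h.
Proof.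
move=> df; have [c] := @MVT_line _ _ 0 h (fun t => is_derive_along x t df).
by rewrite !subr0 scale0r add0r => ch fE; exists c.
Qed.

(** Move along the coordinate directions in turn and apply the mean value theorem on each segment.
    In the maximum norm the intermediate points stay within [|y - x|] of [x]. *)
Lemma C1_increment f (f' : 'I_3 -> E -> R) x y : (forall i, pd i f (f' i)) ->
  exists2 xi : 'I_3 -> E, forall i, `|xi i - x| <= `|y - x| &
    f y - f x = \sum_i f' i (xi i) * (y 0 i - x 0 i).
Proof.
move=> df; pose h i := y 0 i - x 0 i.
have hle i : `|h i| <= `|y - x| by have := coord_norm (y - x) i; rewrite !mxE.
pose x1 := h 0 *: 'd_0 + x; pose x2 := h 1 *: 'd_1 + x1.
have x3E : h 2%:R *: 'd_(2%:R) + x2 = y.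
  by apply/rowP; apply: ord3P; rewrite !mxE /= /h; ring.
have [c0 c0h e0] := pd_increment x (h 0) (df 0).
have [c1 c1h e1] := pd_increment x1 (h 1) (df 1).
have [c2 c2h e2] := pd_increment x2 (h 2%:R) (df 2%:R).
exists (fun i => if i == 0 then c0 *: 'd_0 + x else if i == 1 then c1 *: 'd_1 + x1
    else c2 *: 'd_(2%:R) + x2).
  have h0 := hle 0; have h1 := hle 1; have h2 := hle 2%:R; have n0 := normr_ge0 (y - x).
  apply: ord3P => /=; apply: norm_le => //; apply: ord3P; rewrite !mxE /=;
    rewrite ?(mulr0, mulr1, add0r, addr0, addrK, subrr, normr0)//.
  - exact: le_trans c0h h0.
  - exact: le_trans c1h h1.
  - exact: le_trans c2h h2.
rewrite sum3E /= -/(h 0) -/(h 1) -/(h 2%:R) -e0 -e1 -e2 x3E /x2 /x1.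
by ring.
Qed.

Lemma C1_diffat f (f' : 'I_3 -> E -> R) x : (forall i, pd i f (f' i)) ->
  (forall i, {for x, continuous (f' i)}) -> diffat f x (\row_i f' i x).
Proof.
move=> df cf e e0; have e3 : 0 < e / 3 by rewrite divr_gt0.
have [d0 d00 h0] := cont_eps (cf 0) e3.
have [d1 d10 h1] := cont_eps (cf 1) e3.
have [d2 d20 h2] := cont_eps (cf 2%:R) e3.
exists (Num.min d0 (Num.min d1 d2)); first by rewrite !lt_min d00 d10.
move=> y; rewrite !lt_min => /and3P[y0 y1 y2].
have [xi xiE ->] := C1_increment x y df.
have -> : dotv (y - x) (\row_i f' i x) = \sum_i f' i x * (y 0 i - x 0 i).
  by apply: eq_bigr => i _; rewrite !mxE mulrC.
rewrite -sumrB (le_trans (ler_norm_sum _ _ _))//.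
have -> : e * `|y - x| = \sum_(i < 3) (e / 3) * `|y - x|.
  by rewrite sumr_const card_ord -[_ *+ 3]mulr_natl; field.
apply: ler_sum => i _; rewrite -mulrBl normrM ler_pM//.
  move: i; apply: ord3P; apply/ltW; [apply: h0|apply: h1|apply: h2];
    exact: le_lt_trans (xiE _) _.
by have := coord_norm (y - x) i; rewrite !mxE.
Qed.

Lemma C1_lip f (f' : 'I_3 -> E -> R) (B : R) : (forall i, pd i f (f' i)) ->
  (forall i x, `|f' i x| <= B) -> forall x y, `|f y - f x| <= 3 * B * `|y - x|.
Proof.
move=> df fB x y; have [xi _ ->] := C1_increment x y df.
rewrite (le_trans (ler_norm_sum _ _ _))//.
have -> : 3 * B * `|y - x| = \sum_(i < 3) B * `|y - x|.
  by rewrite sumr_const card_ord -[RHS]mulr_natl mulrA.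
apply: ler_sum => i _; rewrite normrM ler_pM//.
by have := coord_norm (y - x) i; rewrite !mxE.
Qed.

Lemma bounded_compact_supp f (S : set E) : compact S -> continuous f ->
  (forall x, ~ S x -> f x = 0) -> exists2 B : R, 0 <= B & forall x, `|f x| <= B.
Proof.
move=> cS cf f0; have : compact (f @` S).
  by apply: continuous_compact => //; exact: continuous_subspaceT.
move=> /compact_bounded [M [_ HM]]; exists (`|M| + 1) => // x.
have [Sx|/f0 ->] := pselect (S x); last by rewrite normr0.
apply: HM; first by rewrite ltr_pwDr// ler_norm.
by exists x.
Qed.

Lemma near_pderiv f g i x : (\forall y \near x, f y = g y) -> pderiv i f x = pderiv i g x.
Proof. exact: near_eq_derive. Qed.

Section TestFun.
Variables (U : set E) (psi : E -> R).
Hypothesis tpsi : test_fun U psi.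
Let S := closure [set x | psi x != 0].

Lemma test_supp x : ~ S x -> psi x = 0.
Proof.
move=> Sx; apply/eqP; apply: contrapT => /negP px; apply: Sx.
exact: subset_closure.
Qed.

Lemma test_pd i : pd i psi (pderiv i psi).
Proof. by case: tpsi => /(_ 1%N) h _ _; have [] := CnSP h i. Qed.

Lemma test_pderiv_cont i : continuous (pderiv i psi).
Proof. by case: tpsi => /(_ 1%N) h _ _; have [_] := CnSP h i; exact: Cn_cont. Qed.

Lemma test_cont : continuous psi.
Proof. by case: tpsi => /(_ 0%N) []. Qed.

Lemma test_pderiv_supp i x : ~ S x -> pderiv i psi x = 0.
Proof.
move=> Sx; rewrite (@near_pderiv _ (fun=> 0)); first exact: derive_cst.
have : open (~` S) by rewrite openC; exact: closed_closure.
by rewrite openE => /(_ x Sx); apply: filterS => y; exact: test_supp.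
Qed.

Lemma test_bounded : exists2 B : R, 0 <= B & forall x,
  `|psi x| <= B /\ forall i, `|pderiv i psi x| <= B.
Proof.
have [_ cS _] := tpsi.
have [B B0 hB] := bounded_compact_supp cS test_cont test_supp.
have h i := bounded_compact_supp cS (@test_pderiv_cont i) (@test_pderiv_supp i).
have [B1 B10 hB1] := h 0; have [B2 B20 hB2] := h 1; have [B3 B30 hB3] := h 2%:R.
exists (B + (B1 + B2 + B3)) => [|x]; first by rewrite !addr_ge0.
split; first by rewrite (le_trans (hB x))// lerDl !addr_ge0.
apply: ord3P; [have := hB1 x|have := hB2 x|have := hB3 x]; lra.
Qed.

Lemma test_lip : exists2 C : R, 0 <= C & forall x y, `|psi y - psi x| <= C * `|y - x|.
Proof.
have [B B0 hB] := test_bounded; exists (3 * B); first by rewrite mulr_ge0.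
by apply: C1_lip => [i|i x]; [exact: test_pd|exact: (hB x).2].
Qed.

Lemma test_diffat x : diffat psi x (grad psi x).
Proof. exact: (C1_diffat test_pd (fun i => @test_pderiv_cont i x)). Qed.
End TestFun.

Lemma integ_supp U f : mset U -> (forall x, ~ U x -> f x = 0) -> integ U f -> integ setT f.
Proof.
move=> mU f0; rewrite /integ preimage_setT => /(iffLR (integrable_mkcond _ mU)).
apply: eq_integrable => // p _; rewrite /patch; case: ifPn => // /negP Up.
by rewrite f0// => h; apply: Up; rewrite inE.
Qed.

Lemma int3_supp U f : (forall x, ~ U x -> f x = 0) -> int3 setT f = int3 U f.
Proof.
move=> f0; rewrite /int3 [RHS]Rintegral_mkcond preimage_setT.
apply: eq_Rintegral => p _; rewrite /patch; case: ifPn => // /negP Up.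
by rewrite f0// => h; apply: Up; rewrite inE.
Qed.

(* Difference quotients of a compactly supported function have integral zero
   by translation invariance. *)
Lemma int3_pderiv i f f' (B C : R) : 0 <= B -> pd i f f' -> continuous f -> continuous f' ->
  (forall x, `|f x| <= C) -> (forall x, `|f' x| <= C) ->
  (forall x, B < `|x| -> f x = 0) -> int3 setT f' = 0.
Proof.
move=> B0 df cf cf' fC f'C f0.
have C0 : 0 <= C by exact: le_trans (fC 0).
have mT := @mset_setT R.
have mc g : continuous g -> meas3 setT g.
  by move=> cg; apply: meas3_open; [exact: openT|move=> x _; exact: cg].
(* The difference quotients have steps at most 1, so one cube larger by 1 contains all their
   supports and carries the dominating function. *)
pose K := cube (0 : E) (B + 1).
have mK : mset K by exact: mset_cube.
have fK : (vol K < +oo)%E by rewrite vol_cube ?ltry// addr_ge0.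
have KP x : ~ K x -> B + 1 < `|x|.
  move=> nK; rewrite ltNge; apply/negP => h; apply: nK.
  by apply/cubeP; rewrite ?subr0// addr_ge0.
have iK g : meas3 setT g -> (forall x, `|g x| <= C) -> (forall x, ~ K x -> g x = 0) ->
    integ setT g.
  move=> mg gC g0; apply: (@integ_supp K) => //; apply: (integ_bounded (a := C)) => //.
  exact: meas3S mg.
pose v : E := 'd_i.
have v1 : `|v| <= 1.
  by apply: norm_le => // j; rewrite mxE; case: (_ && _); rewrite ?normr1 ?normr0.
have cs w : continuous (fun x => f (x + w)).
  move=> x; apply: eps_cont => e e0; have [d d0 dH] := cont_eps (cf (x + w)) e0.
  by exists d => // y yx; apply/ltW/dH; rewrite opprD addrACA subrr addr0.
have f0' x : B < `|x| -> f' x = 0.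
  move=> xB; have [_ <-] := df x; have := @near_pderiv f (fun=> 0) i x.
  rewrite /pderiv => ->; first exact: derive_cst.
  apply/nbhs_ballP; exists (`|x| - B); rewrite /= ?subr_gt0// => y.
  rewrite ballE_norm /= => yx; apply: f0.
  have : `|x| <= `|y| + `|y - x|.
    by rewrite -{1}(subrK y x) (le_trans (ler_normD _ _))// distrC addrC.
  by lra.
have hv n x : `|x| <= `|n.+1%:R^-1 *: v + x| + 1.
  have h : `|n.+1%:R^-1 *: v| <= 1.
    rewrite normrZ -[leRHS]mulr1 ler_pM//.
    by rewrite ger0_norm ?invr_ge0// invf_le1 ?ler1n.
  rewrite -{1}(addKr (n.+1%:R^-1 *: v) x) addrC (le_trans (ler_normD _ _))//.
  by rewrite normrN lerD2l.
pose q n x : R := n.+1%:R * (f (n.+1%:R^-1 *: v + x) - f x).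
have qE n x : exists2 c : R, `|c| <= n.+1%:R^-1 & q n x = f' (c *: v + x).
  have [c ch cE] := pd_increment x n.+1%:R^-1 df.
  exists c; first by rewrite (le_trans ch)// ger0_norm ?invr_ge0.
  by rewrite /q cE mulrCA mulfV ?mulr1// pnatr_eq0.
have sE n : (fun x => f (n.+1%:R^-1 *: v + x)) = (fun x => f (x + n.+1%:R^-1 *: v)).
  by apply/funext => x; rewrite addrC.
have mq n : meas3 setT (q n).
  apply: meas3M; first exact: meas3_cst.
  by apply: meas3B; apply: mc => //; rewrite sE; exact: cs.
have q_out n x : ~ K x -> q n x = 0.
  move=> /KP xK; rewrite /q !f0 ?subrr ?mulr0//; first by lra.
  by have := hv n x; lra.
have i_f : integ setT f.
  by apply: iK => //; [exact: mc|move=> x /KP xK; rewrite f0//; lra].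
have q0 n : int3 setT (q n) = 0.
  rewrite int3Z//.
    rewrite int3B// ?sE ?int3_shift ?subrr ?mulr0//; first exact: mc.
    apply: iK => // [|x /KP xK]; first by apply: mc; exact: cs.
    by rewrite addrC f0//; have := hv n x; lra.
  apply: integB => //; rewrite sE; apply: iK => // [|x /KP xK]; first by apply: mc; exact: cs.
  by rewrite addrC f0//; have := hv n x; lra.
have iC : integ setT (fun x => if x \in K then C else 0).
  apply: (@integ_supp K) => //; first by move=> x nK; rewrite memNset.
  by apply: eq_integ (integ_cst C mK fK) => // x xK; rewrite xK.
have cv : int3 setT (q n) @[n --> \oo] --> int3 setT f'.
  apply: (@int3_dct R _ _ _ (fun x => if x \in K then C else 0)) => //.
  - exact: mc.
  - move=> x _; apply/cvgrPdist_le => e e0.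
    have [d d0 dH] := cont_eps (cf' x) e0.
    have [n0 n0P] := inv_nat_lt d0.
    near=> n; have /n0P nd : (n0 <= n)%N by near: n; exact: nbhs_infty_ge.
    have [c cn ->] := qE n x; rewrite distrC; apply/ltW/dH; rewrite addrK normrZ.
    rewrite (le_lt_trans _ nd)//; apply: (le_trans _ cn).
    by rewrite ler_piMr.
  - move=> n x _; case: ifPn => [_|/negP xK]; first by have [c _ ->] := qE n x.
    by rewrite q_out ?normr0// => h; apply: xK; rewrite inE.
rewrite -(cvg_lim (@Rhausdorff R) cv); apply: cvg_lim; first exact: Rhausdorff.
by under eq_fun do rewrite q0; exact: cvg_cst.
Unshelve. all: by end_near. Qed.
End TestFunctions.

(** * Polynomials in three variables *)

Section PolynomialEstimates.
Context {R : realType}.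
Notation E := ('rV[R]_3).
Notation poly3 := (mpoly 3 R).
Implicit Types (p q : poly3) (x y : E) (B : R).

Definition pev p x : R := meval (x 0) p.
Definition pgrad p x : E := \row_i pev (mderiv i p) x.

Let C1_poly p := continuous (pev p) /\ forall i, pd i (pev p) (pev (mderiv i p)).

Let C1_polyC (c : R) : C1_poly (mpolyC 3 c).
Proof.
have e (a : R) : pev (mpolyC 3 a) = fun=> a by apply/funext => x; rewrite /pev mevalC.
rewrite /C1_poly e; split => [|i]; first by move=> x; exact: cst_continuous.
by rewrite mderivC -mpolyC0 e; exact: pd_cst.
Qed.

Let C1_polyX j : C1_poly (mpolyX R (mnm1 j)).
Proof.
have e : pev (mpolyX R (mnm1 j)) = fun x => x 0 j by apply/funext => x; rewrite /pev mevalXU.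
rewrite /C1_poly e; split => [|i]; first exact: continuous_coord.
have := @pd_coord R i j id (fun=> 1) 1 0 (fun t => is_derive_id t 1).
congr pd; apply/funext => x; first by rewrite /= mul1r addr0.
rewrite /pev mderivX mnm1E mevalZ mevalX eq_sym !mulr1; case: eqVneq => [->|_]; last by rewrite mul0r.
by rewrite big1 ?mulr1// => k _; rewrite mnmBE subnn expr0.
Qed.

Let C1_polyD p q : C1_poly p -> C1_poly q -> C1_poly (p + q).
Proof.
have e a b : pev (a + b) = fun x => pev a x + pev b x by apply/funext => x; rewrite /pev mevalD.
move=> [cp dp] [cq dq]; rewrite /C1_poly e; split => [x|i].
  by apply: continuousD; [exact: cp|exact: cq].
by rewrite mderivD e; exact: pdD.
Qed.

Let C1_polyM p q : C1_poly p -> C1_poly q -> C1_poly (p * q).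
Proof.
have e a b : pev (a * b) = fun x => pev a x * pev b x by apply/funext => x; rewrite /pev mevalM.
move=> [cp dp] [cq dq]; rewrite /C1_poly e; split => [x|i].
  by apply: continuousM; [exact: cp|exact: cq].
have := pdM (dp i) (dq i); congr pd; apply/funext => x.
by rewrite /pev mderivM mevalD !mevalM addrC [_ * meval _ q]mulrC.
Qed.

Let C1_poly_all p : C1_poly p.
Proof.
elim/mpolyind: p => [|c m p _ _ hp]; first by rewrite -mpolyC0; exact: C1_polyC.
apply: C1_polyD => //.
rewrite -mul_mpolyC; apply: C1_polyM; first exact: C1_polyC.
rewrite mpolyXE_id; apply: big_ind => [|p1 p2|i _]; first exact: C1_polyC.
  exact: C1_polyM.
elim: (m i) => [|k ih]; first by rewrite expr0; exact: C1_polyC.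
by rewrite exprS; apply: C1_polyM => //; exact: C1_polyX.
Qed.

Lemma continuous_pev p : continuous (pev p).
Proof. exact: (C1_poly_all p).1. Qed.

Lemma pd_pev p i : pd i (pev p) (pev (mderiv i p)).
Proof. exact: (C1_poly_all p).2. Qed.

Lemma pev_diffat p x : diffat (pev p) x (pgrad p x).
Proof. exact: (C1_diffat (pd_pev p) (fun i => @continuous_pev (mderiv i p) x)). Qed.

Lemma pev_bounded B p : exists2 C, 0 <= C & forall x, `|x| <= B -> `|pev p x| <= C.
Proof.
have : compact (pev p @` [set x : E | `|x| <= B]).
  apply: continuous_compact; first by apply: continuous_subspaceT; exact: continuous_pev.
  apply: bounded_closed_compact; first exact: (@bounded_normE _ _ B).
  rewrite (_ : [set x : E | `|x| <= B] = (fun x : E => `|x|) @^-1` [set t | t <= B])//.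
  by apply: (@preimage_closed _ _ (fun x : E => `|x|)) (@closed_le _ B) => x _; exact: norm_continuous.
move=> /compact_bounded [M [_ HM]]; exists (`|M| + 1) => // x xB.
by apply: HM; [rewrite ltr_pwDr// ler_norm|exists x].
Qed.

Let pderiv_pev_bounded B p : exists2 C, 0 <= C & forall i x, `|x| <= B -> `|pev (mderiv i p) x| <= C.
Proof.
have [a a0 ha] := pev_bounded B (mderiv 0 p); have [b b0 hb] := pev_bounded B (mderiv 1 p).
have [c c0 hc] := pev_bounded B (mderiv 2%:R p); exists (a + b + c); first by rewrite !addr_ge0.
by apply: ord3P => x xB; [have := ha x xB|have := hb x xB|have := hc x xB]; lra.
Qed.

Let norm_near_le x x' y (r : R) : `|x| <= r -> `|x'| <= r -> `|y - x'| <= `|x - x'| -> `|y| <= 3 * r.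
Proof.
move=> xr xr' h; rewrite -(subrK x' y) (le_trans (ler_normD _ _))//.
by have := ler_normB x x'; lra.
Qed.

Lemma pev_lip B p : exists2 L, 0 <= L &
  forall x y, `|x| <= B -> `|y| <= B -> `|pev p x - pev p y| <= L * `|x - y|.
Proof.
have [C C0 HC] := pderiv_pev_bounded (3 * B) p; exists (3 * C) => [|x y xB yB]; first exact: mulr_ge0.
have [xi xiE ->] := C1_increment y x (pd_pev p).
rewrite (le_trans (ler_norm_sum _ _ _))//.
have -> : 3 * C * `|x - y| = \sum_(i < 3) C * `|x - y|.
  by rewrite sumr_const card_ord -[RHS]mulr_natl mulrA.
apply: ler_sum => i _; rewrite normrM ler_pM//; first exact: HC (norm_near_le xB yB (xiE i)).
by have := coord_norm (x - y) i; rewrite !mxE.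
Qed.

(** The intermediate points may leave the ball of radius [B] but stay in that of radius [3 * B], and
    they lie within [3 * rho] of [y]; three coordinates then make the constant [9 * L]. *)
Lemma pev_remainder B p : exists2 C, 0 <= C & forall x x' y (rho : R),
  `|x| <= B -> `|x'| <= B -> `|y| <= B -> `|x - y| <= rho -> `|x' - y| <= rho ->
  `|pev p x - pev p x' - dotv (x - x') (pgrad p y)| <= C * rho * `|x - x'|.
Proof.
have [a a0 ha] := pev_lip (3 * B) (mderiv 0 p); have [b b0 hb] := pev_lip (3 * B) (mderiv 1 p).
have [c c0 hc] := pev_lip (3 * B) (mderiv 2%:R p); pose L := a + b + c.
have L0 : 0 <= L by rewrite !addr_ge0.
have HL i x y : `|x| <= 3 * B -> `|y| <= 3 * B ->
    `|pev (mderiv i p) x - pev (mderiv i p) y| <= L * `|x - y|.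
  move=> xB yB; have := ha _ _ xB yB; have := hb _ _ xB yB; have := hc _ _ xB yB.
  by have := normr_ge0 (x - y); move: i; apply: ord3P; rewrite /L; nra.
exists (9 * L) => [|x x' y rho xB x'B yB xr x'r]; first exact: mulr_ge0.
have [xi xiE ->] := C1_increment x' x (pd_pev p).
have -> : dotv (x - x') (pgrad p y) = \sum_i pev (mderiv i p) y * (x 0 i - x' 0 i).
  by apply: eq_bigr => i _; rewrite !mxE mulrC.
rewrite -sumrB (le_trans (ler_norm_sum _ _ _))//.
have -> : 9 * L * rho * `|x - x'| = \sum_(i < 3) L * (3 * rho) * `|x - x'|.
  by rewrite sumr_const card_ord -[RHS]mulr_natl; ring.
apply: ler_sum => i _; rewrite -mulrBl normrM ler_pM//; last first.
  by have := coord_norm (x - x') i; rewrite !mxE.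
have B0 : 0 <= B := le_trans (normr_ge0 _) yB.
rewrite (le_trans (HL i _ y (norm_near_le xB x'B (xiE i)) _))//; first by lra.
rewrite ler_wpM2l// -(subrK x' (xi i)) -addrA (le_trans (ler_normD _ _))//.
have := xiE i; have : `|x - x'| <= `|x - y| + `|x' - y|.
  by rewrite [`|x' - y|]distrC -[x in leLHS](subrK y) -addrA ler_normD.
by lra.
Qed.

Lemma msize_mderiv i p k : (mmeasure mdeg p <= k.+1)%N ->
  (mmeasure mdeg (mderiv i p) <= k)%N.
Proof.
move=> pk; rewrite mmeasureE; apply/bigmax_leqP_seq => m mp _.
have : mcoeff (mnm_add m (mnm1 i)) p != 0.
  by apply: contraTneq mp => h; rewrite mcoeff_msupp mcoeff_deriv h mul0rn eqxx.
rewrite -mcoeff_msupp => /(mmeasure_mnm_lt mdeg) h.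
have hd : mdeg (mnm_add m (mnm1 i)) = (mdeg m).+1 by rewrite mdegD mdeg1 addn1.
rewrite -ltnS; apply: leq_trans pk; apply: leq_trans h.
by rewrite ltnS -hd.
Qed.
End PolynomialEstimates.

(** * Tetrahedra and their faces *)

Section Tetrahedron.
Variable R : realType.
Notation E := 'rV[R]_3.
Implicit Types (K : 'M[R]_(4, 3)) (x y : E).

(** Homogeneous coordinates: with a 1 appended to each point, barycentric coordinates solve a square
    linear system, invertible exactly for affinely independent vertices. *)
Definition homog (m : nat) (A : 'M[R]_(m, 3)) : 'M[R]_(m, 3 + 1) := row_mx A (const_mx 1).

Definition vertex_mx K : 'M[R]_(3 + 1) := homog K.

Lemma mul_homog m (c : 'M[R]_(1, m)) (A : 'M[R]_(m, 3)) :
  c *m homog A = row_mx (c *m A) (const_mx (\sum_i c 0 i)).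
Proof.
rewrite /homog mul_mx_row; congr row_mx; apply/matrixP => i j; rewrite !mxE.
by rewrite (ord1 i); apply: eq_bigr => l _; rewrite mxE mulr1.
Qed.

Definition bary K x : 'rV[R]_(3 + 1) := homog x *m invmx (vertex_mx K).

Lemma vertex_mx_unit K : Defs.nondegenerate K -> vertex_mx K \in unitmx.
Proof.
move=> nK; rewrite -row_free_unit; apply: inj_row_free => v.
rewrite mul_homog -[0 in RHS](@row_mx0 _ 1 3 1) => /eq_row_mx[vK /rowP/(_ 0)].
by rewrite !mxE => s0; apply: nK.
Qed.

Section Nondegenerate.
Variable K : 'M[R]_(4, 3).
Hypothesis nK : Defs.nondegenerate K.
Let V : 'M[R]_(3 + 1, 3) := K.

Lemma bary_sum x : bary K x *m V = x /\ \sum_i bary K x 0 i = 1.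
Proof.
have := mulmxKV (vertex_mx_unit nK) (homog x).
rewrite -/(bary K x) mul_homog => /eq_row_mx[-> /rowP/(_ 0)].
by rewrite !mxE.
Qed.

Lemma bary_mul (c : 'rV[R]_(3 + 1)) : \sum_i c 0 i = 1 -> bary K (c *m V) = c.
Proof.
move=> c1; rewrite /bary -[in RHS](mulmxK (vertex_mx_unit nK) c); congr (_ *m _).
by rewrite /vertex_mx mul_homog c1.
Qed.

Lemma tetP x : tet K x <-> forall i, 0 <= bary K x 0 i.
Proof.
split=> [[c [[c0 c1] ->]] i|h]; first by rewrite bary_mul.
by exists (bary K x); have [e1 e2] := bary_sum x; rewrite /barycentric e1 e2.
Qed.

Lemma baryB x y i :
  bary K x 0 i - bary K y 0 i = ((x - y) *m usubmx (invmx (vertex_mx K))) 0 i.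
Proof.
have e (A : 'M[R]_(3 + 1)) z : homog z *m A = z *m usubmx A + const_mx 1 *m dsubmx A.
  by rewrite /homog -{1}(vsubmxK A) mul_row_col.
by rewrite /bary !e mulmxBl !mxE; ring.
Qed.

Lemma bary_lip : exists2 C : R, 0 <= C &
  forall x y i, `|bary K x 0 i - bary K y 0 i| <= C * `|x - y|.
Proof.
pose A : 'M[R]_(3, 3 + 1) := usubmx (invmx (vertex_mx K)).
exists (\sum_i \sum_j `|A i j|); first by rewrite !sumr_ge0// => i _; rewrite sumr_ge0.
move=> x y i; rewrite baryB mxE (le_trans (ler_norm_sum _ _ _))// mulr_suml.
apply: ler_sum => j _; rewrite normrM mulrC ler_pM//; last exact: coord_norm.
by rewrite (bigD1 i)//= ler_wpDr// sumr_ge0.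
Qed.

Lemma continuous_bary i : continuous (fun x => bary K x 0 i).
Proof.
have [C C0 H] := bary_lip => x; apply: eps_cont => e e0.
exists (e / (C + 1)) => [|y yx]; first by rewrite divr_gt0// ltr_wpDl.
rewrite (le_trans (H _ _ _))// (le_trans (ler_wpM2l C0 (ltW yx)))// mulrA ler_pdivrMr ?ltr_wpDl//.
by rewrite mulrDr mulr1 mulrC lerDl ltW.
Qed.

Lemma closed_tet : closed (tet K).
Proof.
rewrite (_ : tet K = \bigcap_(i in setT) [set x | 0 <= bary K x 0 i]).
  apply: closed_bigI => i _; apply: (@preimage_closed _ _ (fun x => bary K x 0 i)) (@closed_ge _ 0).
  by move=> x _; exact: continuous_bary.
apply/seteqP; split=> x.
  by move=> /tetP h i _; exact: h.
by move=> h; apply/tetP => i; exact: h.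
Qed.

Lemma tet_interior x : (forall i, 0 < bary K x 0 i) -> (tet K)° x.
Proof.
move=> h; rewrite /interior; near=> y; apply/tetP => i; apply: ltW; move: i; near: y.
apply: filter_forall => i; apply: (@continuous_bary i x [set t | 0 < t]).
by apply: (@open_nbhs_nbhs R^o); split; [exact: open_gt|exact: h].
Unshelve. all: by end_near. Qed.

Lemma tet_boundary x : tet K x -> ~ (tet K)° x -> exists i, bary K x 0 i = 0.
Proof.
move=> /tetP Kx nK'; apply: contrapT => /forallNP h; apply: nK'; apply: tet_interior => i.
by rewrite lt_neqAle Kx andbT eq_sym; apply/eqP; exact: h.
Qed.

Lemma tet_bary_le1 x i : tet K x -> bary K x 0 i <= 1.
Proof.
move=> /tetP h; have [_ <-] := bary_sum x; rewrite (bigD1 i)//= lerDl.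
by apply: sumr_ge0.
Qed.

Lemma tet_bounded : exists2 B : R, 0 <= B & forall x, tet K x -> `|x| <= B.
Proof.
exists (\sum_i \sum_j `|V i j|); first by rewrite !sumr_ge0// => i _; rewrite sumr_ge0.
move=> x Kx; apply: norm_le => [|j]; first by rewrite !sumr_ge0// => i _; rewrite sumr_ge0.
have [<- _] := bary_sum x; rewrite mxE (le_trans (ler_norm_sum _ _ _))//.
apply: ler_sum => i _; rewrite (bigD1 j)//= ler_wpDr ?sumr_ge0// normrM ler_piMl//.
by rewrite ger0_norm; [exact: tet_bary_le1|exact: (iffLR (tetP x))].
Qed.

(* Two barycentric coordinates parametrize a face. *)
Lemma face_lip i : exists j k, exists2 C : R, 0 <= C &
  forall x y (r : R), bary K x 0 i = 0 -> bary K y 0 i = 0 ->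
  `|bary K x 0 j - bary K y 0 j| <= r -> `|bary K x 0 k - bary K y 0 k| <= r ->
  `|x - y| <= C * r.
Proof.
pose S : R := \sum_i \sum_j `|V i j|.
have S0 : 0 <= S by rewrite !sumr_ge0// => l _; rewrite sumr_ge0.
exists (lift i 0), (lift i 1), (2 * S); first by rewrite mulr_ge0.
move=> x y r xi yi jr kr; pose d := bary K x - bary K y.
have r0 : 0 <= r := le_trans (normr_ge0 _) jr.
have [xE x1] := bary_sum x; have [yE y1] := bary_sum y.
have dE m : d 0 m = bary K x 0 m - bary K y 0 m by rewrite /d mxE [X in _ + X]mxE.
have di : d 0 i = 0 by rewrite dE xi yi subrr.
have dj : `|d 0 (lift i 0)| <= r by rewrite dE.
have dk : `|d 0 (lift i 1)| <= r by rewrite dE.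
have d1 : \sum_m d 0 m = 0.
  have -> : \sum_m d 0 m = \sum_m bary K x 0 m - \sum_m bary K y 0 m.
    by rewrite -sumrB; apply: eq_bigr => m _.
  by rewrite x1 y1 subrr.
(* Coordinate differences sum to 0 and the one at [i] vanishes, so the remaining one is minus the
   sum of two; hence the 2. *)
have dm m : `|d 0 m| <= 2 * r.
  case: (unliftP i m) => [m' ->|->]; last by rewrite di normr0 mulr_ge0.
  move: d1; rewrite (bigD1_ord i)//= di add0r sum3E => d1.
  move: m'; apply: ord3P; rewrite ?(le_trans dj) ?(le_trans dk)//; [by lra|by lra|].
  have -> : d 0 (lift i 2%:R) = - d 0 (lift i 0) - d 0 (lift i 1) by move: d1; lra.
  by rewrite (le_trans (ler_normB _ _))// normrN; move: dj dk; lra.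
rewrite -xE -yE -mulmxBl -/d; apply: norm_le => [|l]; first by rewrite !mulr_ge0.
rewrite mxE (le_trans (ler_norm_sum _ _ _))// mulrAC mulrC mulr_suml.
apply: ler_sum => m _; rewrite normrM mulrC ler_pM//.
by rewrite (bigD1 l)//= ler_wpDr// sumr_ge0.
Qed.
End Nondegenerate.
End Tetrahedron.

(** * Null sets and Lipschitz surfaces *)

Section NullSets.
Variable R : realType.
Notation E := 'rV[R]_3.

(** The outer form, which asks no measurability of [A] itself: images of faces are reached only
    through covers. *)
Definition null (A : set E) := exists N, [/\ mset N, vol N = 0%E & A `<=` N].

Lemma null_sub A B : A `<=` B -> null B -> null A.
Proof. by move=> AB [N [mN N0 BN]]; exists N; split => // x /AB/BN. Qed.

Lemma vol_setU_le (A B : set E) : mset A -> mset B -> (vol (A `|` B) <= vol A + vol B)%E.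
Proof. by move=> mA mB; rewrite /vol preimage_setU; exact: measureU2. Qed.

Lemma cover_seq (I : eqType) (s : seq I) (A : I -> set E) (v : R) :
  (forall i, mset (A i)) -> (forall i, (vol (A i) <= v%:E)%E) ->
  exists N, [/\ mset N, forall i, i \in s -> A i `<=` N & (vol N <= ((size s)%:R * v)%:E)%E].
Proof.
move=> mA vA; elim: s => [|i s [N [mN sN vN]]].
  exists set0; split => //; rewrite ?mul0r /mset /vol preimage_set0 ?measure0//.
exists (A i `|` N); split.
- exact: mset_setU.
- by move=> j; rewrite inE => /orP[/eqP -> x|/sN h x /h]; [left|right].
- rewrite (le_trans (vol_setU_le _ _))// -natr1 mulrDl mul1r addrC EFinD.
  by apply: leeD.
Qed.

Lemma null_seq (I : eqType) (s : seq I) (A : I -> set E) :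
  (forall i, i \in s -> null (A i)) -> null [set x | exists2 i, i \in s & A i x].
Proof.
elim: s => [|i s ih] h.
  by exists set0; split; rewrite ?/mset ?/vol ?preimage_set0 ?measure0// => x [].
have [N [mN N0 AN]] := h i (mem_head _ _).
have [|N' [mN' N0' AN']] := ih; first by move=> j js; apply: h; rewrite inE js orbT.
exists (N `|` N'); split; first exact: mset_setU.
  apply/eqP; rewrite eq_le measure_ge0 andbT (le_trans (vol_setU_le _ _))//.
  by rewrite N0 N0' adde0.
move=> x [j]; rewrite inE => /orP[/eqP -> /AN|js jx]; first by left.
by right; apply: AN'; exists j.
Qed.

(** The functions [a] and [b] parametrize [S] by the unit square. About m^2 parameter cells of side
    1 / m have images inside cubes of radius L / m, so the total volume is of order 1 / m. *)
Lemma lip_surface_null (S : set E) (F : E -> E) (a b : E -> R) (L : R) : 0 <= L ->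
  (forall x, S x -> 0 <= a x <= 1 /\ 0 <= b x <= 1) ->
  (forall x y (r : R), S x -> S y -> `|a x - a y| <= r -> `|b x - b y| <= r -> `|F x - F y| <= L * r) ->
  null (F @` S).
Proof.
move=> L0 ab FL.
have step n : exists N, [/\ mset N, F @` S `<=` N & (vol N <= (32 * L ^+ 3 * n.+1%:R^-1)%:E)%E].
  set m : R := n.+1%:R; have m0 : 0 < m by rewrite ltr0n.
  pose near (i : nat) t := i%:R <= t * m < i%:R + 1.
  (* There are [n.+2] intervals because the parameter value 1 starts an interval of its own. An
     empty cell gets a cube about the image of the default point 0, which only enlarges the
     cover. *)
  pose cell (p : 'I_n.+2 * 'I_n.+2) := [set x | [/\ S x, near p.1 (a x) & near p.2 (b x)]].
  pose A p := cube (F (xget 0 (cell p))) (L / m).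
  have r0 : 0 <= L / m by rewrite divr_ge0// ltW.
  have [|p|N [mN sN vN]] := @cover_seq _ (enum predT) A ((2 * (L / m)) ^+ 3).
  - by move=> p; exact: mset_cube.
  - by rewrite vol_cube.
  exists N; split => //.
    have tr t : 0 <= t <= 1 -> exists i : 'I_n.+2, near i t.
      move=> /andP[t0 t1]; have h := Num.Theory.truncn_itv (mulr_ge0 t0 (ltW m0)).
      have lt : (Num.truncn (t * m) < n.+2)%N.
        rewrite ltnS -(ler_nat R); apply: (@le_trans _ _ (t * m)); first by case/andP: h.
        by rewrite ler_piMl// ltW.
      by exists (Ordinal lt); rewrite /near natr1.
    move=> _ [x Sx <-]; have [/tr[i ai] /tr[j bj]] := ab x Sx.
    apply: (sN (i, j)); rewrite ?mem_enum//.
    have [Sy ay byy] : cell (i, j) (xget 0 (cell (i, j))).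
      by apply: (@xgetPex _ 0 (cell (i, j))); exists x.
    apply/cubeP => //; apply: FL => //; rewrite -(@ler_pM2r _ m)// mulVf ?gt_eqF//.
      rewrite -[X in _ * X](ger0_norm (ltW m0)) -normrM mulrBl ler_norml.
      by move: ai ay; rewrite /near/=; lra.
    rewrite -[X in _ * X](ger0_norm (ltW m0)) -normrM mulrBl ler_norml.
    by move: bj byy; rewrite /near/=; lra.
  rewrite (le_trans vN)// lee_fin -cardE card_prod card_ord.
  have -> : (n.+2 * n.+2)%:R = (m + 1) ^+ 2 by rewrite expr2 natrM -natr1.
  have m1 : 1 <= m by rewrite ler1n.
  have -> : 32 * L ^+ 3 / m = (2 * m) ^+ 2 * (2 * (L / m)) ^+ 3.
    by field; rewrite gt_eqF.
  apply: ler_wpM2r; first by rewrite exprn_ge0// mulr_ge0.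
  by rewrite ler_sqr ?nnegrE; lra.
have /choice[N NP] := step.
have mN' : mset (\bigcap_n N n).
  rewrite /mset preimage_bigcap; apply: bigcap_measurable => // n _.
  by have [] := NP n.
exists (\bigcap_n N n); split => //.
- apply/eqP; rewrite eq_le measure_ge0 andbT; apply/lee_addgt0Pr => e e0.
  rewrite add0e; have [n0 n0P] : exists n0 : nat, 32 * L ^+ 3 * n0.+1%:R^-1 <= e.
    have c0 : 0 < 32 * L ^+ 3 + 1 by rewrite ltr_wpDl// mulr_ge0// exprn_ge0.
    have [n0 /(_ n0 (leqnn _)) n0P] := inv_nat_lt (divr_gt0 e0 c0).
    exists n0; move: n0P; rewrite ltr_pdivlMr// => /ltW; apply: le_trans.
    by rewrite mulrC ler_wpM2l ?invr_ge0// lerDl.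
  have [mN _ vN] := NP n0.
  apply: le_trans (_ : vol (N n0) <= _)%E.
    by apply: vol_le => // x; apply.
  by rewrite (le_trans vN)// lee_fin.
- by move=> y Fy n _; have [_ h _] := NP n; exact: h.
Qed.
End NullSets.

(** * Functions on a mesh *)

Section Mesh.
Variable R : realType.
Notation E := 'rV[R]_3.

(** Stands for a maximum over the finite mesh: the property survives enlarging the constant, so
    constants may be added up. *)
Lemma seq_bound (I : eqType) (s : seq I) (P : I -> R -> Prop) :
  (forall i a b, i \in s -> 0 <= a -> a <= b -> P i a -> P i b) ->
  (forall i, i \in s -> exists2 a, 0 <= a & P i a) ->
  exists2 a, 0 <= a & forall i, i \in s -> P i a.
Proof.
elim: s => [|i s ih] mP hP; first by exists 0.
have [||a a0 aP] := ih; first by move=> j b c js; apply: mP; rewrite inE js orbT.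
  by move=> j js; apply: hP; rewrite inE js orbT.
have [b b0 bP] := hP i (mem_head _ _).
exists (a + b) => [|j]; first by rewrite addr_ge0.
rewrite inE => /orP[/eqP ->|js]; first by apply: mP bP; rewrite ?mem_head// lerDr.
by apply: mP (aP _ js); rewrite ?inE ?js ?orbT// lerDl.
Qed.

(* No continuity of [g] is needed: the end points of each gap belong to the
   closed pieces. *)
Lemma chain_lip (I : eqType) (s : seq I) (A : I -> set R) (g : R -> R) (L : R) :
  (forall i, i \in s -> closed (A i)) ->
  (forall i t t', i \in s -> A i t -> A i t' -> `|g t' - g t| <= L * `|t' - t|) ->
  forall a b, a <= b -> (forall t, a < t -> t < b -> exists2 i, i \in s & A i t) ->
  `|g b - g a| <= L * (b - a).
Proof.
elim: s => [|i s ih] cA lA a b ab cov.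
  have -> : a = b.
    apply/eqP; rewrite eq_le ab /= leNgt; apply/negP => ab'.
    have [] := cov ((a + b) / 2); [by lra|by lra|by []].
  by rewrite !subrr normr0 mulr0.
have st j : j \in s -> j \in i :: s by rewrite inE => ->; rewrite orbT.
have {}ih := ih (fun j js => cA j (st j js)) (fun j t t' js => lA j t t' (st j js)).
(* Piece [i] is not visited before [inf S] nor after [sup S], so the induction hypothesis applies
   there. Between the two, both ends belong to [A i], whose own estimate bridges the gap whatever
   happens in between. *)
pose S := A i `&` [set t | a < t < b].
have [S0|/set0P S0] := eqVneq S set0.
  apply: ih => // t ta tb; have [j] := cov _ ta tb.
  rewrite inE => /orP[/eqP -> jt|js jt]; last by exists j.
  by exfalso; have : S t by [split => //=; rewrite ta tb]; rewrite S0.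
have cl c : closure S c -> A i c.
  have -> : A i = closure (A i) by apply/closure_id; exact: cA (mem_head _ _).
  by apply: closureS => t [].
have uS : has_ubound S by exists b => t [_ /andP[_ /ltW]].
have lS : has_lbound S by exists a => t [_ /andP[/ltW]].
have c2 := cl _ (closure_sup S0 uS).
have c1 : A i (inf S).
  apply: cl => B /nbhs_ballP[e e0 eB]; have [t St tl] := inf_adherent e0 (conj S0 lS).
  exists t; split => //; apply: eB; rewrite /ball /= distrC ger0_norm; first by lra.
  by rewrite subr_ge0; exact: ge_inf.
have [t0 St0] := S0; have [_ /andP[t0a t0b]] := St0.
have i1 : inf S <= t0 by exact: ge_inf.
have i2 : t0 <= sup S by exact: ub_le_sup.
have a1 : a <= inf S by apply: lb_le_inf => // t [_ /andP[/ltW]].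
have b2 : sup S <= b by apply: ge_sup => // t [_ /andP[_ /ltW]].
have h1 : `|g (inf S) - g a| <= L * (inf S - a).
  apply: ih => // t ta tb; have [|j] := cov _ ta; first by lra.
  rewrite inE => /orP[/eqP -> jt|js jt]; last by exists j.
  exfalso; have : S t by split => //=; rewrite ta; lra.
  by move=> /(ge_inf lS); lra.
have h2 : `|g b - g (sup S)| <= L * (b - sup S).
  apply: ih => // t ta tb; have [||j] := cov t; [by lra|by []|].
  rewrite inE => /orP[/eqP -> jt|js jt]; last by exists j.
  exfalso; have : S t by split => //=; rewrite tb andbT; lra.
  by move=> /(ub_le_sup uS); lra.
have h3 := lA i _ _ (mem_head _ _) c1 c2.
rewrite (ger0_norm (_ : 0 <= sup S - inf S)) in h3; last by lra.
have -> : g b - g a = (g b - g (sup S)) + ((g (sup S) - g (inf S)) + (g (inf S) - g a)) by ring.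
have -> : L * (b - a) = L * (b - sup S) + (L * (sup S - inf S) + L * (inf S - a)) by ring.
rewrite (le_trans (ler_normD _ _))// lerD// (le_trans (ler_normD _ _))//.
by rewrite lerD.
Qed.

Variable T : seq 'M[R]_(4, 3).
Hypothesis nT : forall K, K \in T -> Defs.nondegenerate K.

(** The open set where piecewise polynomials are locally polynomials. It misses only parts of faces
    of the region, so integrals may be restricted to it. *)
Definition inner : set E := [set x | exists2 K, K \in T & (tet K)° x].

Lemma innerE : inner = \bigcup_(K in [set` T]) (tet K)°.
Proof. by []. Qed.

Lemma open_inner : open inner.
Proof. by rewrite innerE; apply: bigcup_open => K _; exact: open_interior. Qed.

Lemma inner_Omega : inner `<=` Omega_hat T.
Proof. by move=> x [K KT]; apply: interiorS => y Ky; exists K. Qed.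

Lemma Omega_region : Omega_hat T `<=` region T.
Proof. exact: interior_subset. Qed.

Lemma region_bounded : exists2 B : R, 0 <= B & forall x, region T x -> `|x| <= B.
Proof.
have [|K KT|B B0 BP] := @seq_bound _ T (fun K B => forall x, tet K x -> `|x| <= B).
- by move=> K a b _ _ ab h x /h /le_trans; apply.
- exact: tet_bounded (nT KT).
- by exists B => // x [K KT /BP]; apply.
Qed.

Lemma closed_region : closed (region T).
Proof.
rewrite (_ : region T = \bigcup_(K in [set` T]) tet K)//; apply: closed_bigcup.
  exact: finite_seq.
by move=> K /nT; exact: closed_tet.
Qed.

Lemma compact_region : compact (region T).
Proof.
have [B B0 h] := region_bounded.
apply: bounded_closed_compact; last exact: closed_region.
exact: bounded_normE h.
Qed.

Lemma null_image_faces (F : E -> E) (L : R) : 0 <= L ->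
  (forall K, K \in T -> forall x y, tet K x -> tet K y -> `|F x - F y| <= L * `|x - y|) ->
  null (F @` (region T `\` inner)).
Proof.
move=> L0 FL.
apply: (@null_sub R _ [set y | exists2 K, K \in T &
    [set y | exists2 i, i \in enum 'I_(3 + 1) & (F @` (tet K `&` [set x | bary K x 0 i = 0])) y] y]).
  move=> y [x [[K KT Kx] nx] <-]; exists K => //.
  have [|i xi] := tet_boundary (nT KT) Kx; first by move=> h; apply: nx; exists K.
  by exists i; rewrite ?mem_enum//; exists x.
apply: null_seq => K KT; apply: null_seq => i _.
have [j [k [C C0 H]]] := face_lip (nT KT) i.
apply: (@lip_surface_null _ _ _ (fun x => bary K x 0 j) (fun x => bary K x 0 k) (L * C)).
- exact: mulr_ge0.
- move=> x [Kx _]; have h := iffLR (tetP (nT KT) x) Kx; rewrite !h /=.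
  by rewrite !(tet_bary_le1 (nT KT)).
- move=> x y r [Kx xi] [Ky yi] h1 h2; apply: (le_trans (FL _ KT _ _ Kx Ky)).
  by rewrite -mulrA ler_wpM2l//; exact: H.
Qed.
End Mesh.

(** * Differentiability and piecewise polynomials *)

Section DiffAt.
Variable R : realType.
Notation E := 'rV[R]_3.
Implicit Types (f psi : E -> R) (M : E -> E).

Lemma diffat_cont f x G : diffat f x G -> {for x, continuous f}.
Proof.
move=> df; apply: eps_cont => e e0.
have [d d0 dH] := df 1 ltr01.
pose c : R := 1 + \sum_i `|G 0 i|; have c1 : 1 <= c by rewrite lerDl sumr_ge0.
have c0 : 0 < c by exact: lt_le_trans c1.
exists (Num.min d (e / c)); first by rewrite lt_min d0 divr_gt0.
move=> y; rewrite lt_min => /andP[yd]; rewrite ltr_pdivlMr// => /ltW; apply: le_trans.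
have -> : f y - f x = (f y - f x - dotv (y - x) G) + dotv (y - x) G by rewrite subrK.
rewrite (le_trans (ler_normD _ _))// mulrDr mulr1 lerD//.
  by rewrite (le_trans (dH _ yd))// mul1r.
rewrite mulr_sumr (le_trans (ler_norm_sum _ _ _))// ler_sum// => i _.
by rewrite normrM ler_wpM2r// coord_norm.
Qed.

Lemma near_continuous f (g : E -> R) x : (\forall y \near x, f y = g y) -> {for x, continuous g} ->
  {for x, continuous f}.
Proof.
move=> fg cg; have fx := nbhs_singleton fg; apply: eps_cont => e e0.
have [d d0 dH] := cont_eps cg e0.
have /nbhs_ballP[r r0 rH] := fg.
exists (Num.min d r) => [|y]; first by rewrite lt_min d0.
by rewrite lt_min => /andP[yd yr]; rewrite fx rH ?ballE_norm//=; exact/ltW/dH.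
Qed.

Lemma dotv_row (v : E) (D : 'M[R]_3) j : (v *m D) 0 j = dotv v (\row_i D i j).
Proof. by rewrite mxE; apply: eq_bigr => i _; rewrite mxE. Qed.

Lemma dotv_bound (G : E) : exists2 c, 0 <= c & forall v, `|dotv v G| <= c * `|v|.
Proof.
exists (\sum_i `|G 0 i|); first exact: sumr_ge0.
move=> v; rewrite mulr_suml (le_trans (ler_norm_sum _ _ _))//.
by apply: ler_sum => i _; rewrite normrM mulrC ler_wpM2l// coord_norm.
Qed.

Lemma mulmx_bound (D : 'M[R]_3) : exists2 c, 0 <= c & forall v : E, `|v *m D| <= c * `|v|.
Proof.
exists (\sum_i \sum_j `|D i j|); first by rewrite sumr_ge0// => i _; rewrite sumr_ge0.
move=> v; apply: norm_le => [|j].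
  by rewrite mulr_ge0// sumr_ge0// => i _; rewrite sumr_ge0.
rewrite mxE (le_trans (ler_norm_sum _ _ _))// mulr_suml.
apply: ler_sum => i _; rewrite normrM mulrC ler_pM ?coord_norm//.
by rewrite (bigD1 j)//= lerDl sumr_ge0.
Qed.

Lemma dotvBl (a b G : E) : dotv (a - b) G = dotv a G - dotv b G.
Proof. by rewrite /dotv -sumrB; apply: eq_bigr => i _; rewrite !mxE mulrBl. Qed.

Lemma dotv_trmx (v g : E) (D : 'M[R]_3) : dotv (v *m D) g = dotv v (g *m D^T).
Proof.
rewrite /dotv; under eq_bigr do rewrite mxE mulr_suml.
rewrite exchange_big; apply: eq_bigr => i _ /=; rewrite mxE mulr_sumr.
by apply: eq_bigr => j _; rewrite mxE; ring.
Qed.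

Lemma diffat_vec M x (D : 'M[R]_3) :
  (forall j, diffat (fun y => M y 0 j) x (\row_i D i j)) -> forall e : R, 0 < e ->
  exists2 d : R, 0 < d &
    forall y, `|y - x| < d -> `|M y - M x - (y - x) *m D| <= e * `|y - x|.
Proof.
move=> dM e e0; have [d0 d00 H0] := dM 0 _ e0; have [d1 d10 H1] := dM 1 _ e0.
have [d2 d20 H2] := dM 2%:R _ e0.
exists (Num.min d0 (Num.min d1 d2)); first by rewrite !lt_min d00 d10.
move=> y; rewrite !lt_min => /and3P[y0 y1 y2].
apply: norm_le => [|j]; first by rewrite mulr_ge0// ltW.
have -> : (M y - M x - (y - x) *m D) 0 j = M y 0 j - M x 0 j - ((y - x) *m D) 0 j.
  by rewrite 4!mxE.
rewrite dotv_row.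
by move: j; apply: ord3P; [exact: H0|exact: H1|exact: H2].
Qed.

Lemma diffat_comp psi M x g (D : 'M[R]_3) : diffat psi (M x) g ->
  (forall j, diffat (fun y => M y 0 j) x (\row_i D i j)) ->
  diffat (fun y => psi (M y)) x (g *m D^T).
Proof.
move=> dpsi /diffat_vec dM e e0.
have [s s0 sH] := dotv_bound g; have [c c0 cH] := mulmx_bound D.
have c1 : 0 < 2 * (c + 1) by rewrite mulr_gt0// ltr_wpDl.
have s1 : 0 < 2 * (s + 1) by rewrite mulr_gt0// ltr_wpDl.
have [d1 d10 H1] := dpsi _ (divr_gt0 e0 c1).
(* The error is split in halves: the remainder of [psi] along an increment of size at most [c + 1]
   times that of [y], which uses [e2 <= 1], and the remainder of [M] paired with [g]. *)
pose e2 := Num.min 1 (e / (2 * (s + 1))).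
have e20 : 0 < e2 by rewrite lt_min ltr01 divr_gt0.
have [d2 d20 H2] := dM _ e20.
exists (Num.min d2 (d1 / (2 * (c + 1)))) => [|y]; first by rewrite lt_min d20 divr_gt0.
rewrite lt_min => /andP[yd2]; rewrite ltr_pdivlMr// => yd1.
have {}H2 := H2 y yd2; set n := `|y - x| in yd1 H2 *.
have n0 : 0 <= n by exact: normr_ge0.
have [e21 e22] : e2 <= 1 /\ e2 * (2 * (s + 1)) <= e.
  by rewrite -ler_pdivlMr// !ge_min !lexx orbT.
have My : `|M y - M x| <= (c + 1) * n.
  rewrite -(subrK ((y - x) *m D) (M y - M x)) (le_trans (ler_normD _ _))// mulrDl mul1r addrC.
  by rewrite lerD// (le_trans H2)// ler_piMl.
have {}H1 : `|psi (M y) - psi (M x) - dotv (M y - M x) g| <= e / 2 * n.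
  have -> : e / 2 * n = e / (2 * (c + 1)) * ((c + 1) * n).
    by field; rewrite gt_eqF// ltr_wpDl.
  rewrite (le_trans (H1 _ _))//; last by rewrite ler_wpM2l// divr_ge0// ltW.
  by rewrite (le_lt_trans My)// (le_lt_trans _ yd1)//; nra.
have {}H2 : `|dotv (M y - M x - (y - x) *m D) g| <= e / 2 * n.
  rewrite (le_trans (sH _))// (le_trans (ler_wpM2l s0 H2))// mulrA ler_wpM2r//; nra.
have -> : psi (M y) - psi (M x) - dotv (y - x) (g *m D^T) =
    (psi (M y) - psi (M x) - dotv (M y - M x) g) + dotv (M y - M x - (y - x) *m D) g.
  by rewrite (dotvBl (M y - M x)) dotv_trmx; ring.
by rewrite (le_trans (ler_normD _ _))//; lra.
Qed.

(** Componentwise [diffat] is Frechet differentiability in epsilon form; uniqueness of the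
    differential identifies the matrix. *)
Lemma jacobian_eq M x (D : 'M[R]_3) :
  (forall j, diffat (fun y => M y 0 j) x (\row_i D i j)) -> jacobian M x = D.
Proof.
move=> /diffat_vec h; have [c c0 Dc] := mulmx_bound D.
have c1 : 0 < c + 1 by rewrite ltr_wpDl.
have cD : continuous (mulmxr D : E -> E).
  move=> z A /nbhs_ballP[e e0 eA]; apply/nbhs_ballP.
  exists (e / (c + 1)) => [|y]; first exact: divr_gt0.
  rewrite ballE_norm /= ltr_pdivlMr// => yz; apply: eA; rewrite ballE_norm /=.
  rewrite -mulmxBl (le_lt_trans (Dc _))//; apply: le_lt_trans yz.
  by rewrite mulrC ler_wpM2l// lerDl.
have dE : 'd M x = mulmxr D :> (E -> E).
  apply: diff_unique => //; apply/eqaddoP => e e0.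
  have [d d0 dH] := h _ e0.
  apply/nbhs_ballP; exists d => // y; rewrite ballE_norm /= subr0 => yd.
  have := dH (y + x); rewrite addrK => /(_ yd).
  by rewrite -[M _ - _ - _]addrA -opprD.
by apply/row_matrixP => i; rewrite !rowE mul_rV_lin1 dE.
Qed.

Lemma near_diffat f (g : E -> R) x G : (\forall y \near x, f y = g y) -> diffat g x G -> diffat f x G.
Proof.
move=> fg dg e e0; have fx := nbhs_singleton fg; have [d d0 dH] := dg e e0.
have /nbhs_ballP[r r0 rH] := fg.
exists (Num.min d r) => [|y]; first by rewrite lt_min d0.
by rewrite lt_min => /andP[yd yr]; rewrite fx rH ?ballE_norm//=; exact: dH.
Qed.

Lemma diffat_derive f x G i : diffat f x G -> is_derive x ('e_i : E) f (G 0 i).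
Proof.
move=> df; set v := 'e_i : E.
have v1 : `|v| <= 1.
  by apply: norm_le => // j; rewrite mxE; case: (_ && _); rewrite ?normr1 ?normr0.
apply: is_derive_eps => e e0; have [d d0 dH] := df e e0; exists d => // h hd.
have hv : `|h *: v| <= `|h| by rewrite normrZ ler_piMr.
have := dH (h *: v + x); rewrite addrK => /(_ (le_lt_trans hv hd)).
have -> : dotv (h *: v) G = G 0 i * h.
  rewrite [RHS]mulrC /dotv (bigD1 i)//= !mxE !eqxx mulr1 big1 ?addr0// => j ji.
  by rewrite !mxE (negbTE ji) andbF mulr0 mul0r.
by move=> /le_trans; apply; rewrite ler_wpM2l// ltW.
Qed.

Lemma diffat_grad f x G : diffat f x G -> G = grad f x.
Proof.
move=> df; apply/rowP => i; rewrite mxE; have [_ <-] := diffat_derive i df.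
by [].
Qed.

Lemma pderiv_pev f p (A : set E) x i : (forall x, A° x -> f x = pev p x) -> A° x ->
  pderiv i f x = pev (mderiv i p) x.
Proof.
move=> fp Ax; rewrite (@near_pderiv _ f (pev p)).
  by rewrite (pd_pderiv (pd_pev p i)).
by apply: filterS fp _; apply: open_nbhs_nbhs; split => //; exact: open_interior.
Qed.
End DiffAt.

(** * Elementwise polynomial functions *)

Section Map.
Variable R : realType.
Notation E := 'rV[R]_3.
Variable T : seq 'M[R]_(4, 3).
Hypothesis nT : forall K, K \in T -> Defs.nondegenerate K.
Notation U := (inner T).

(* Unlike [pw_poly], no degree is fixed: this class is stable under products,
   so it contains the minors of the Jacobian matrix. *)
Definition lpoly (f : E -> R) := forall K, K \in T ->
  exists p : mpoly 3 R, forall x, (tet K)° x -> f x = pev p x.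

Lemma lpoly_cst c : lpoly (fun=> c).
Proof. by move=> K KT; exists (mpolyC 3 c) => x _; rewrite /pev mevalC. Qed.

Lemma lpolyD f g : lpoly f -> lpoly g -> lpoly (fun x => f x + g x).
Proof.
move=> hf hg K KT; have [p pE] := hf K KT; have [q qE] := hg K KT.
by exists (p + q) => x Kx; rewrite pE// qE// /pev mevalD.
Qed.

Lemma lpolyM f g : lpoly f -> lpoly g -> lpoly (fun x => f x * g x).
Proof.
move=> hf hg K KT; have [p pE] := hf K KT; have [q qE] := hg K KT.
by exists (p * q) => x Kx; rewrite pE// qE// /pev mevalM.
Qed.

Lemma lpoly_sum (I : Type) (s : seq I) (P : pred I) (F : I -> E -> R) :
  (forall i, lpoly (F i)) -> lpoly (fun x => \sum_(i <- s | P i) F i x).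
Proof.
move=> hF; elim: s => [|i s ih].
  by under eq_fun do rewrite big_nil; exact: lpoly_cst.
under eq_fun do rewrite big_cons; case: (P i) => //; exact: lpolyD.
Qed.

Lemma lpoly_prod (I : Type) (s : seq I) (P : pred I) (F : I -> E -> R) :
  (forall i, lpoly (F i)) -> lpoly (fun x => \prod_(i <- s | P i) F i x).
Proof.
move=> hF; elim: s => [|i s ih].
  by under eq_fun do rewrite big_nil; exact: lpoly_cst.
under eq_fun do rewrite big_cons; case: (P i) => //; exact: lpolyM.
Qed.

Lemma lpoly_det n (A : E -> 'M[R]_n) : (forall i j, lpoly (fun x => A x i j)) ->
  lpoly (fun x => \det (A x)).
Proof.
move=> hA; rewrite /determinant; apply: lpoly_sum => s; apply: lpolyM; first exact: lpoly_cst.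
by apply: lpoly_prod.
Qed.

Lemma lpoly_near f x : lpoly f -> U x -> exists p, \forall y \near x, f y = pev p y.
Proof.
move=> hf [K /hf[p pE] Kx]; exists p; apply: filterS pE _.
by apply: open_nbhs_nbhs; split => //; exact: open_interior.
Qed.

Lemma lpoly_cont f : lpoly f -> {in U, continuous f}.
Proof.
move=> hf x; rewrite inE => /(lpoly_near hf)[p fp].
exact: near_continuous fp (@continuous_pev R p x).
Qed.

Lemma lpoly_bounded f : lpoly f -> exists2 A, 0 <= A & forall x, U x -> `|f x| <= A.
Proof.
move=> hf; have [B B0 HB] := region_bounded nT.
have [|K KT|A A0 HA] := @seq_bound R _ T (fun K A => forall x, (tet K)° x -> `|f x| <= A).
- by move=> K a b _ _ ab h x /h /le_trans; apply.
- have [p pE] := hf K KT; have [A A0 HA] := pev_bounded B p.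
  exists A => // x Kx; rewrite pE//; apply: HA.
  by apply: HB; exists K => //; exact: interior_subset.
- by exists A => // x [K KT Kx]; exact: HA Kx.
Qed.

Lemma lpoly_diffat f x : lpoly f -> U x -> diffat f x (grad f x).
Proof.
move=> hf Ux; have [p fp] := lpoly_near hf Ux.
have dfx := near_diffat fp (pev_diffat p x).
by have <- := diffat_grad dfx.
Qed.

Lemma lpoly_pderiv f i : lpoly f -> lpoly (pderiv i f).
Proof.
move=> hf K /[dup] KT /hf[p pE]; exists (mderiv i p) => x Kx.
exact: pderiv_pev pE Kx.
Qed.

End Map.

(** * Elementwise polynomial maps *)

Section PolynomialMap.
Variable R : realType.
Notation E := 'rV[R]_3.
Variables (T : seq 'M[R]_(4, 3)) (M : E -> E) (k : nat).
Hypothesis nT : forall K, K \in T -> Defs.nondegenerate K.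
Hypothesis polyM : forall K, K \in T -> polyv_on k (tet K) M.
Notation U := (inner T).

Lemma map_pev K : K \in T -> exists p : 'I_3 -> mpoly 3 R,
  forall x, tet K x -> forall j, M x 0 j = pev (p j) x.
Proof.
move=> /polyM h; have /choice[p pP] : forall j, exists p, forall x, tet K x -> M x 0 j = pev p x.
  by move=> j; have [p [_ pE]] := h j; exists p.
by exists p => x Kx j; exact: pP.
Qed.

Lemma jacobian_pev K (p : 'I_3 -> mpoly 3 R) x :
  (forall x, tet K x -> forall j, M x 0 j = pev (p j) x) -> (tet K)° x ->
  jacobian M x = \matrix_(i, j) pev (mderiv i (p j)) x.
Proof.
move=> pE Kx; apply: jacobian_eq => j.
have -> : \row_i (\matrix_(i, j) pev (mderiv i (p j)) x) i j = pgrad (p j) x.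
  by apply/rowP => i; rewrite !mxE.
apply: near_diffat (pev_diffat (p j) x).
apply: filterS (_ : \forall y \near x, tet K y); first by move=> y Ky; exact: pE.
exact: Kx.
Qed.

Lemma lpoly_jac i j : lpoly T (fun x => jacobian M x i j).
Proof.
move=> K /map_pev[p pE]; exists (mderiv i (p j)) => x Kx.
by rewrite (jacobian_pev pE Kx) mxE.
Qed.

Lemma map_lip : exists2 L, 0 <= L &
  forall K, K \in T -> forall x y, tet K x -> tet K y -> `|M x - M y| <= L * `|x - y|.
Proof.
have [B B0 HB] := region_bounded nT.
apply: (@seq_bound R _ T (fun K L => forall x y, tet K x -> tet K y -> `|M x - M y| <= L * `|x - y|)).
  by move=> K a b _ _ ab h x y Kx Ky; rewrite (le_trans (h _ _ Kx Ky))// ler_wpM2r.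
move=> K KT; have [p pE] := map_pev KT.
have [|j _|L L0 HL] := @seq_bound R _ (enum 'I_3) (fun j L => forall x y, `|x| <= B -> `|y| <= B ->
    `|pev (p j) x - pev (p j) y| <= L * `|x - y|).
- by move=> j a b _ _ ab h x y xB yB; rewrite (le_trans (h _ _ xB yB))// ler_wpM2r.
- exact: pev_lip.
exists L => // x y Kx Ky; apply: norm_le => [|j]; first exact: mulr_ge0.
have -> : (M x - M y) 0 j = M x 0 j - M y 0 j by rewrite !mxE.
by rewrite !pE//; apply: HL; [rewrite mem_enum|apply: HB; exists K..].
Qed.

(** The constant is uniform over the mesh while the radius depends on the point, because the ball
    must stay inside one element. *)
Lemma map_lin_est : exists2 C, 0 <= C & forall x, U x ->
  exists2 r, 0 < r & ball x r `<=` U /\ lin_est M (jacobian M) C (ball x r).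
Proof.
have [B B0 HB] := region_bounded nT.
have [|K KT|C C0 H] := @seq_bound R _ T (fun K C => lin_est M (jacobian M) C (tet K)°).
- move=> K a b _ _ ab h x x' y rho Kx Kx' Ky xr x'r.
  rewrite (le_trans (h _ _ _ _ Kx Kx' Ky xr x'r))// ler_wpM2r// ler_wpM2r//.
  exact: le_trans xr.
- have [p pE] := map_pev KT.
  have [|j _|C C0 HC] := @seq_bound R _ (enum 'I_3) (fun j C => forall x x' y (rho : R),
    `|x| <= B -> `|x'| <= B -> `|y| <= B -> `|x - y| <= rho -> `|x' - y| <= rho ->
    `|pev (p j) x - pev (p j) x' - dotv (x - x') (pgrad (p j) y)| <= C * rho * `|x - x'|).
  + move=> j a b _ _ ab h x x' y rho xB x'B yB xr x'r.
    rewrite (le_trans (h _ _ _ _ xB x'B yB xr x'r))// ler_wpM2r// ler_wpM2r//.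
    exact: le_trans xr.
  + exact: pev_remainder.
  have KB z : (tet K)° z -> `|z| <= B by move=> /interior_subset Kz; apply: HB; exists K.
  exists C => // x x' y rho Kx Kx' Ky xr x'r.
  have rho0 : 0 <= rho by exact: le_trans xr.
  apply: norm_le => [|j]; first by rewrite !mulr_ge0.
  have -> : (M x - M x' - (x - x') *m jacobian M y) 0 j =
      M x 0 j - M x' 0 j - ((x - x') *m jacobian M y) 0 j by rewrite 4!mxE.
  rewrite dotv_row (jacobian_pev pE Ky) !pE//; [|exact: interior_subset..].
  have -> : \row_i (\matrix_(i, j) pev (mderiv i (p j)) y) i j = pgrad (p j) y.
    by apply/rowP => i; rewrite !mxE.
  by apply: HC; rewrite ?mem_enum//; exact: KB.
- exists C => // x [K KT Kx]; have op := @open_interior _ (tet K).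
  have /nbhs_ballP[r r0 rK] : nbhs x (tet K)° by apply: open_nbhs_nbhs.
  exists r => //; split; first by move=> y /rK Ky; exists K.
  by move=> a b c rho /rK Ka /rK Kb /rK Kc; exact: (H K KT).
Qed.

Variables (delta : R).
Hypothesis delta0 : 0 < delta.
Hypothesis detM : forall K, K \in T -> forall x, (tet K)° x -> delta <= \det (jacobian M x).

Lemma inner_det x : U x -> delta <= \det (jacobian M x).
Proof. by move=> [K KT]; exact: detM. Qed.

Lemma inner_det0 x : U x -> 0 < \det (jacobian M x).
Proof. by move=> /inner_det; exact: lt_le_trans. Qed.

Lemma inner_unit x : U x -> jacobian M x \in unitmx.
Proof. by move=> /inner_det0 d0; rewrite unitmxE unitfE gt_eqF. Qed.

(** Cramer's rule: the entries of the adjugate are elementwise polynomials, hence bounded, and the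
    determinant is at least [delta]. *)
Lemma inner_inv : exists2 C, 0 <= C & forall x (v : E), U x -> `|v *m invmx (jacobian M x)| <= C * `|v|.
Proof.
have lc i j : lpoly T (fun x => \adj (jacobian M x) i j).
  rewrite /adjugate; under eq_fun do rewrite mxE /cofactor.
  apply: lpolyM; first exact: lpoly_cst.
  apply: lpoly_det => a b; under eq_fun do rewrite 2!mxE.
  exact: lpoly_jac.
have [|ij _|C C0 H] := @seq_bound R _ (enum {: 'I_3 * 'I_3})
    (fun ij C => forall x, U x -> `|\adj (jacobian M x) ij.1 ij.2| <= C).
- by move=> i a b _ _ ab h x /h /le_trans; apply.
- exact: lpoly_bounded.
exists (3 * (C / delta)) => [|x v Ux]; first by rewrite mulr_ge0// divr_ge0// ltW.
have d0 := inner_det0 Ux.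
apply: norm_le => [|j]; first by rewrite !mulr_ge0// invr_ge0 ltW.
rewrite mxE (le_trans (ler_norm_sum _ _ _))//.
have -> : 3 * (C / delta) * `|v| = \sum_(i < 3) `|v| * (C / delta).
  by rewrite sumr_const card_ord -[RHS]mulr_natl; ring.
apply: ler_sum => i _; rewrite normrM ler_pM ?coord_norm//.
rewrite /invmx inner_unit// mxE normrM mulrC ler_pM//.
  by apply: (H (i, j)); rewrite ?mem_enum.
rewrite normfV gtr0_norm// lef_pV2 ?posrE//; exact: inner_det.
Qed.
End PolynomialMap.

(** * Pull-back of test functions *)

Section Pullback.
Variable R : realType.
Notation E := 'rV[R]_3.
Variables (T : seq 'M[R]_(4, 3)) (M Minv : E -> E) (k : nat).
Hypothesis nT : forall K, K \in T -> Defs.nondegenerate K.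
Hypothesis polyM : forall K, K \in T -> polyv_on k (tet K) M.
Hypothesis contM : {within region T, continuous M}.
Hypothesis MK : forall x, region T x -> Minv (M x) = x.
Notation U := (inner T).
Notation O := (Omega_hat T).
Notation Om := (Omega T M).

Lemma compact_closed_image (A : set E) : closed A -> A `<=` region T -> closed (M @` A).
Proof.
move=> cA AT; apply: compact_closed; first exact: norm_hausdorff.
apply: continuous_compact.
  exact: continuous_subspaceW contM.
exact: subclosed_compact (compact_region nT) AT.
Qed.

(** Across faces [M] is merely continuous, so [Om] is written as a countable union of compact
    images, those of the points at distance at least [1 / n.+1] from the complement of the
    domain. *)
Lemma mset_Omega : mset Om.
Proof.
pose C n := [set x : E | forall y, `|y - x| < n.+1%:R^-1 -> O y].
have CO n : C n `<=` O by move=> x; apply; rewrite subrr normr0 invr_gt0.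
have -> : Om = \bigcup_n (M @` C n).
  apply/seteqP; split => y.
    move=> [x Ox <-]; have /nbhs_ballP[r r0 rO] : nbhs x O.
      by apply: open_nbhs_nbhs; split => //; exact: open_interior.
    have [n /(_ n (leqnn _)) nr] := inv_nat_lt r0.
    exists n => //; exists x => // z zx; apply: rO; rewrite ballE_norm /=.
    exact: lt_trans nr.
  by move=> [n _ [x /CO Ox <-]]; exists x.
apply: mset_bigcup => // n; apply: mset_closed; apply: compact_closed_image.
  exact: closed_inner.
by move=> x /CO /Omega_region.
Qed.

Lemma null_faces : null (region T `\` U).
Proof.
have := @null_image_faces R T nT id 1 ler01; rewrite image_id; apply.
by move=> K KT x y _ _; rewrite mul1r.
Qed.

Lemma null_map_faces : null (M @` (region T `\` U)).
Proof. by have [L L0 /(null_image_faces nT L0)] := map_lip nT polyM. Qed.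

Lemma image_inner_Omega : M @` U `<=` Om.
Proof. by apply: image_subset; exact: inner_Omega. Qed.

Lemma null_Omega : null (Om `\` M @` U).
Proof.
apply: null_sub null_map_faces => y [[x Ox <-] nUx]; exists x => //.
split; first exact: Omega_region.
by move=> Ux; apply: nUx; exists x.
Qed.

Lemma null_Omega_hat : null (O `\` U).
Proof. by apply: null_sub null_faces => x [/Omega_region]. Qed.

Variable psi : E -> R.
Hypothesis tpsi : test_fun Om psi.

Definition pullback (x : E) : R := if x \in region T then psi (M x) else 0.

Lemma pullbackE x : region T x -> pullback x = psi (M x).
Proof. by move=> Tx; rewrite /pullback mem_set. Qed.

Lemma pullback_bounded : exists2 A, 0 <= A & forall x, `|pullback x| <= A.
Proof.
have [A A0 H] := test_bounded tpsi; exists A => // x; rewrite /pullback.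
by case: ifP; rewrite ?normr0//; have [] := H (M x).
Qed.

(** The preimage of the compact support is compact, by continuity on the closed region, and lies in
    the open domain, by injectivity; so it keeps a positive distance from the complement. *)
Lemma pullback_supp : exists2 r : R, 0 < r & forall x y, pullback x != 0 -> `|y - x| < r -> O y.
Proof.
have [_ cS SOm] := tpsi; set S := closure _ in cS SOm.
pose W := region T `&` [set x | S (M x)].
have cW : compact W.
  apply: subclosed_compact (compact_region nT) _ => //; last by move=> x [].
  rewrite closure_id; apply/seteqP; split; first exact: subset_closure.
  move=> x clx; have Tx : region T x.
    by apply: (closed_region nT); apply: closureS clx => z [].
  split => //; apply: contrapT => nSx.
  have nS : nbhs (M x) (~` S).
    by apply: open_nbhs_nbhs; split => //; apply: closed_openC; exact: closed_closure.
  have := iffLR (subspace_continuousP _ M) contM x Tx _ nS.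
  by move=> /clx[z [[Tz Sz]]] /(_ Tz).
have WO : W `<=` O.
  move=> x [Tx /SOm[z Oz zx]]; have <- : z = x.
    by rewrite -(MK Tx) -zx MK//; exact: Omega_region.
  by [].
have : \forall r \near 0^'+, W `<=` [set x | forall y, `|y - x| < r -> O y].
  move/compact_near_coveringP: cW; apply => x /WO Ox.
  have /nbhs_ballP[d d0 dO] : nbhs x O by apply: open_nbhs_nbhs; split => //; exact: open_interior.
  exists (ball x (d / 2), [set r | r < d / 2]).
    split => /=; first by apply: nbhsx_ballx; rewrite divr_gt0.
    by apply: nbhs_right_lt; rewrite divr_gt0.
  move=> [z r] /= [xz rd] y yz; apply: dO; rewrite ballE_norm /=.
  rewrite ballE_norm /= in xz.
  have -> : y - x = (y - z) + (z - x) by rewrite addrA subrK.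
  by rewrite (le_lt_trans (ler_normD _ _))//; lra.
move=> h; have [r [r0 rW]] : exists r, 0 < r /\ W `<=` [set x | forall y, `|y - x| < r -> O y].
  near (0 : R)^'+ => r; exists r; split; first by near: r; exact: nbhs_right_gt.
  by near: r; exact: h.
exists r => // x y; rewrite /pullback; case: ifPn => [|_]; last by rewrite eqxx.
rewrite inE => Tx px; apply: rW; split => //=; exact: subset_closure.
Unshelve. all: by end_near. Qed.

Lemma continuous_line (x v : E) : continuous (fun t : R => x + t *: v).
Proof.
move=> t A /nbhs_ballP[e e0 eA]; apply/nbhs_ballP.
have v1 : 0 < `|v| + 1 by rewrite ltr_wpDl.
exists (e / (`|v| + 1)) => [|t']; first exact: divr_gt0.
rewrite /ball /= ltr_pdivlMr// => tt'; apply: eA; rewrite ballE_norm /=.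
rewrite opprD addrACA subrr add0r -scalerBl normrZ distrC.
by apply: le_lt_trans tt'; rewrite ler_wpM2l// lerDl.
Qed.

Lemma pullback_lip : exists r L, [/\ 0 < r, 0 <= L &
  forall x y, `|y - x| < r -> `|pullback y - pullback x| <= L * `|y - x|].
Proof.
have [r r0 rO] := pullback_supp.
have [L L0 HL] := map_lip nT polyM; have [C C0 HC] := test_lip tpsi.
exists r, (C * L); split => //; first exact: mulr_ge0.
(* By symmetry one end may be taken where the pull-back does not vanish. The segment then stays
   within [r] of it, hence in the domain, and the closed elements cover it as [chain_lip]
   requires. *)
suff H x y : pullback x != 0 -> `|y - x| < r -> `|pullback y - pullback x| <= C * L * `|y - x|.
  move=> x y yx; have [x0|] := eqVneq (pullback x) 0; last by move=> /H; apply.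
  have [y0|/H] := eqVneq (pullback y) 0.
    by rewrite x0 y0 subrr normr0 !mulr_ge0.
  by rewrite distrC [`|y - x|]distrC; apply; rewrite distrC.
move=> px yx; pose g t := pullback (x + t *: (y - x)).
have := @chain_lip R _ T (fun K => [set t : R | tet K (x + t *: (y - x))]) g (C * L * `|y - x|).
have -> : `|pullback y - pullback x| = `|g 1 - g 0|.
  by rewrite /g scale1r scale0r addr0 subrKC.
have [a b c d] : [/\ True, True, True & True] by [].
move=> /(_ _ _ 0 1 ler01); rewrite subr0 mulr1; apply.
- move=> K KT; apply: (@preimage_closed _ _ (fun t : R => x + t *: (y - x)) (tet K)).
    move=> t _; exact: continuous_line.
  exact: closed_tet (nT KT).
- move=> K t t' KT Kt Kt'; rewrite /g !pullbackE; [|by exists K..].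
  rewrite (le_trans (HC _ _))// -!mulrA ler_wpM2l//.
  rewrite (le_trans (HL K KT _ _ Kt' Kt))// ler_wpM2l//.
  by rewrite opprD addrACA subrr add0r -scalerBl normrZ mulrC.
- move=> t t0 t1; have /Omega_region[K KT Kt] : O (x + t *: (y - x)).
    apply: (rO x) => //; rewrite addrC addKr normrZ (le_lt_trans _ yx)//.
    by rewrite ler_piMl// gtr0_norm// ltW.
  by exists K.
Qed.

Lemma pullback_diffat x : U x -> diffat pullback x (grad psi (M x) *m (jacobian M x)^T).
Proof.
move=> Ux; apply: (@near_diffat _ _ (fun x => psi (M x))).
  apply: filterS (_ : \forall y \near x, O y); first by move=> y /Omega_region /pullbackE.
  by apply: open_nbhs_nbhs; split; [exact: open_interior|exact: inner_Omega].
apply: diffat_comp; first exact: (test_diffat tpsi).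
have cj j : lpoly T (Defs.comp M j).
  by move=> K /(map_pev polyM)[p pE]; exists (p j) => z /interior_subset Kz; exact: pE.
have -> : jacobian M x = \matrix_(i, j) pderiv i (Defs.comp M j) x.
  apply: jacobian_eq => j; rewrite (_ : \row__ _ = grad (Defs.comp M j) x); first exact: lpoly_diffat (cj j) Ux.
  by apply/rowP => i; rewrite !mxE.
move=> j; rewrite (_ : \row__ _ = grad (Defs.comp M j) x); first exact: lpoly_diffat (cj j) Ux.
by apply/rowP => i; rewrite !mxE.
Qed.

Lemma pullback_approx : exists (w : nat -> E -> R) D,
  [/\ forall n, test_fun O (w n),
      forall n x, O x -> `|w n x| <= D,
      forall n i x, O x -> `|pderiv i (w n) x| <= D,
      forall x, O x -> w n x @[n --> \oo] --> pullback x &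
      forall i x, U x ->
        pderiv i (w n) x @[n --> \oo] --> (grad psi (M x) *m (jacobian M x)^T) 0 i].
Proof.
have [A A0 HA] := pullback_bounded; have [r [L [r0 L0 HL]]] := pullback_lip.
have [r' r'0 Hr'] := pullback_supp; have [B B0 HB] := region_bounded nT.
apply: (@test_fun_grad_approx _ _ _ _ U A L (Num.min r r') (Num.bound B)) => //.
- by rewrite lt_min r0.
- by move=> x /Omega_region /HB /le_trans; apply; rewrite ltW// archi_boundP.
- by move=> x y; rewrite lt_min => /andP[yx _]; exact: HL.
- by move=> y x wy; rewrite lt_min => /andP[_]; exact: Hr'.
- exact: inner_Omega.
- exact: pullback_diffat.
Qed.
End Pullback.

(** * Bounded continuous functions *)

Section BoundedContinuous.
Variable R : realType.
Notation E := 'rV[R]_3.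
Implicit Types (U V : set E) (f g h : E -> R).

(** On an open set of finite volume this class is measurable, integrable and dominated by constants,
    and it is closed under the operations that form the integrands. *)
Definition bcont U f := {in U, continuous f} /\ exists A, forall x, U x -> `|f x| <= A.

Lemma bcont_cst U (c : R) : bcont U (fun=> c).
Proof. by split; [move=> x _; exact: cst_continuous|exists `|c|]. Qed.

Lemma bcontD U f g : bcont U f -> bcont U g -> bcont U (fun x => f x + g x).
Proof.
move=> [cf [A fA]] [cg [B gB]]; split.
  by move=> x Ux; apply: continuousD; [exact: cf|exact: cg].
by exists (A + B) => x Ux; rewrite (le_trans (ler_normD _ _))// lerD ?fA ?gB.
Qed.

Lemma bcontM U f g : bcont U f -> bcont U g -> bcont U (fun x => f x * g x).
Proof.
move=> [cf [A fA]] [cg [B gB]]; split.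
  by move=> x Ux; apply: continuousM; [exact: cf|exact: cg].
by exists (A * B) => x Ux; rewrite normrM ler_pM ?fA ?gB.
Qed.

Lemma bcont_sum U (I : Type) (s : seq I) (F : I -> E -> R) :
  (forall i, bcont U (F i)) -> bcont U (fun x => \sum_(i <- s) F i x).
Proof.
move=> hF; elim: s => [|i s ih].
  by under eq_fun do rewrite big_nil; exact: bcont_cst.
by under eq_fun do rewrite big_cons; exact: bcontD.
Qed.

Lemma bcont_meas3 U f : open U -> bcont U f -> meas3 U f.
Proof. by move=> oU [cf _]; exact: meas3_open. Qed.

Lemma bcont_integ U f : open U -> (vol U < +oo)%E -> bcont U f -> integ U f.
Proof.
move=> oU fU [cf [A fA]]; apply: integ_bounded fA => //; first exact: mset_open.
exact: meas3_open.
Qed.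

Lemma bcont_mul_integ U h f : open U -> integ U h -> bcont U f -> integ U (fun x => h x * f x).
Proof.
move=> oU hi [cf [A fA]]; apply: integ_mulb fA => //; first exact: mset_open.
exact: meas3_open.
Qed.

Lemma test_bcont U V psi : test_fun V psi -> bcont U psi.
Proof.
move=> tpsi; split; first by move=> x _; exact: (test_cont tpsi).
by have [A _ H] := test_bounded tpsi; exists A => x _; have [] := H x.
Qed.

Lemma pderiv_test_bcont U V psi i : test_fun V psi -> bcont U (pderiv i psi).
Proof.
move=> tpsi; split; first by move=> x _; exact: (test_pderiv_cont tpsi).
by have [A _ H] := test_bounded tpsi; exists A => x _; have [] := H x.
Qed.

Lemma int3_mul_lim U h (s : nat -> E -> R) f (C : R) : mset U -> integ U h ->
  (forall n, meas3 U (s n)) -> meas3 U f -> (forall n x, U x -> `|s n x| <= C) ->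
  (forall x, U x -> s n x @[n --> \oo] --> f x) ->
  int3 U (fun x => h x * s n x) @[n --> \oo] --> int3 U (fun x => h x * f x).
Proof.
move=> mU hi ms mf sC sf.
have mh := integ_meas3 hi.
apply: (@int3_dct R U _ _ (fun x => C * `|h x|)) => //.
- by move=> n; exact: meas3M.
- exact: meas3M.
- by apply: integZ => //; exact: integ_norm.
- by move=> x Ux; apply: cvgM; [exact: cvg_cst|exact: sf].
- by move=> n x Ux; rewrite normrM mulrC ler_wpM2r// sC.
Qed.

Lemma int3_restrict U V f : mset U -> mset V -> V `<=` U -> null (U `\` V) ->
  integ U f -> int3 U f = int3 V f.
Proof.
move=> mU mV VU [N [mN N0 UVN]]; apply: int3_null => //.
by apply: vol0_sub UVN _ => //; exact: mset_setD.
Qed.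

Lemma integ_restrict U V f (a : R) : mset U -> (vol U < +oo)%E -> meas3 U f ->
  null (U `\` V) -> (forall x, V x -> `|f x| <= a) -> integ U f.
Proof.
move=> mU fU mf [N [mN N0 UVN]] fa.
have UN x : U x -> ~ N x -> V x by move=> Ux nN; apply: contrapT => nV; exact: nN (UVN x _).
have nN : (leb3 R).-negligible (@row3 R @^-1` N) by apply/negligibleP.
(* With a constant sequence, dominated convergence gives integrability from a bound that holds only
   almost everywhere. *)
have [|||||fi _ _] := @dominated_convergence _ _ _ (leb3 R) _ mU (fun _ p => (f (row3 p))%:E)
  (fun p => (f (row3 p))%:E) (fun=> a%:E).
- by move=> _; apply/measurable_EFinP.
- by apply/measurable_EFinP.
- by apply: aeW => p _; exact: cvg_cst.
- exact: integ_cst.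
- apply: negligibleS nN => p /= /existsNP[n] /not_implyP[Up] h; apply: contrapT => Np.
  by apply: h; rewrite lee_fin; apply: fa; exact: UN.
- exact: fi.
Qed.

Lemma L2_restrict U V f (a : R) : mset U -> (vol U < +oo)%E -> meas3 U f ->
  null (U `\` V) -> (forall x, V x -> `|f x| <= a) -> L2 U f.
Proof.
move=> mU fU mf nUV fa; split => //.
have : integ U (fun x => f x * f x).
  apply: (@integ_restrict U V _ (a * a)) => //; first exact: meas3M.
  by move=> x Vx; rewrite normrM ler_pM ?fa.
by [].
Qed.

Lemma meas3_ext0 U V f : mset V -> open V -> V `<=` U -> mset U ->
  {in V, continuous f} -> meas3 U (fun x => if x \in V then f x else 0).
Proof.
move=> mV oV VU mU cf; apply: meas3_preimage => a.
have mVa : mset (V `&` [set x | a < f x]).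
  rewrite (_ : [set x | _] = f @^-1` `]a, +oo[%classic).
    by apply: meas3_preim => //; exact: meas3_open.
  by apply/seteqP; split => x /=; rewrite in_itv /= andbT.
have [a0|a0] := leP 0 a.
  rewrite (_ : _ `&` _ = V `&` [set x | a < f x])//; apply/seteqP; split => x /=.
    by case: ifPn => [|_ [_]]; [rewrite inE => Vx []|rewrite ltNge a0].
  by move=> [Vx ax]; rewrite mem_set//; split => //; exact: VU.
rewrite (_ : _ `&` _ = (V `&` [set x | a < f x]) `|` (U `\` V)).
  by apply: mset_setU => //; exact: mset_setD.
apply/seteqP; split => x /=.
  by case: ifPn => [|]; rewrite ?inE ?notin_setE => Vx [Ux ax]; [left|right].
case=> -[h1 h2]; first by rewrite mem_set//; split => //; exact: VU.
by rewrite memNset.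
Qed.

(** The degenerate case of Cauchy-Schwarz: the integral of [(f + t g)^2] is [2 t B + t^2 A],
    negative at [t = - B / (A + 1)] unless [B = 0]. The 1 guards against [A = 0]. *)
Lemma int3_sqr0_orth U f g : mset U -> integ U (fun x => f x * f x) ->
  integ U (fun x => f x * g x) -> integ U (fun x => g x * g x) ->
  int3 U (fun x => f x * f x) = 0 -> int3 U (fun x => f x * g x) = 0.
Proof.
move=> mU iff ifg igg ff0; set B := int3 U _; set A := int3 U (fun x => g x * g x).
have A0 : 0 <= A by apply: int3_ge0 => x _; rewrite -expr2 sqr_ge0.
have q t : 0 <= 2 * t * B + t ^+ 2 * A.
  have -> : 2 * t * B + t ^+ 2 * A = int3 U (fun x => (f x + t * g x) * (f x + t * g x)).
    rewrite -[LHS]add0r -ff0 -int3Z// -int3Z// addrA -int3D//; [|exact: integZ..|].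
      rewrite -int3D//; [|by apply: integD => //; exact: integZ|exact: integZ].
      by apply: eq_int3 => x _; ring.
    exact: integZ.
  by apply: int3_ge0 => x _; rewrite -expr2 sqr_ge0.
have := q (- B / (A + 1)).
have -> : 2 * (- B / (A + 1)) * B + (- B / (A + 1)) ^+ 2 * A =
  - (B ^+ 2 * ((A + 2) / (A + 1) ^+ 2)) by field; rewrite gt_eqF// ltr_wpDl.
rewrite oppr_ge0 pmulr_lle0; last by rewrite divr_gt0 ?exprn_gt0 ?ltr_wpDl.
by move=> B0; apply/eqP; rewrite -sqrf_eq0 eq_le B0 sqr_ge0.
Qed.
End BoundedContinuous.

(** * Elementwise integration by parts *)

Section IntegrationByParts.
Variable R : realType.
Notation E := 'rV[R]_3.
Variable T : seq 'M[R]_(4, 3).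
Hypothesis nT : forall K, K \in T -> Defs.nondegenerate K.
Notation U := (inner T).
Notation O := (Omega_hat T).

Lemma lpoly_bcont f : lpoly T f -> bcont U f.
Proof.
move=> hf; split; first exact: lpoly_cont.
by have [A _ H] := lpoly_bounded nT hf; exists A.
Qed.

Lemma mset_inner : mset U.
Proof. by apply: mset_open; exact: open_inner. Qed.

Lemma mset_Omega_hat : mset O.
Proof. by apply: mset_open; exact: open_interior. Qed.

Lemma vol_Omega_hat : (vol O < +oo)%E.
Proof.
have [B B0 HB] := region_bounded nT.
by apply: (@vol_bounded _ _ B mset_Omega_hat) => x /Omega_region /HB.
Qed.

Lemma vol_inner : (vol U < +oo)%E.
Proof.
have [B B0 HB] := region_bounded nT.
by apply: (@vol_bounded _ _ B mset_inner) => x /inner_Omega /Omega_region /HB.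
Qed.

Lemma inner_pderiv f psi i : lpoly T f -> test_fun U psi ->
  int3 U (fun x => pderiv i f x * psi x + f x * pderiv i psi x) = 0.
Proof.
move=> lf tpsi; have [_ _ SU] := tpsi; set S := closure _ in SU.
have lf' := lpoly_pderiv i lf.
pose F x := if x \in U then f x * psi x else 0.
pose F' x := if x \in U then pderiv i f x * psi x + f x * pderiv i psi x else 0.
have cM (a b : E -> R) : continuous a -> continuous b -> continuous (fun x => a x * b x).
  by move=> ca cb x; apply: continuousM; [exact: ca|exact: cb].
have cD (a b : E -> R) : continuous a -> continuous b -> continuous (fun x => a x + b x).
  by move=> ca cb x; apply: continuousD; [exact: ca|exact: cb].
(* The product extended by 0 is C^1 on the whole space: near a point of an element it is a
   polynomial times [psi], and off the support of [psi] it is locally 0. *)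
have loc (x : E) : exists g g', [/\ pd i g g', continuous g, continuous g',
    \forall y \near x, F y = g y & \forall y \near x, F' y = g' y].
  have [Ux|nUx] := pselect (U x).
    have nU : \forall y \near x, U y by apply: open_nbhs_nbhs; split => //; exact: open_inner.
    have [K KT Kx] := Ux; have [p pE] := lf K KT.
    have nK : \forall y \near x, (tet K)° y.
      by apply: open_nbhs_nbhs; split => //; exact: open_interior.
    exists (fun y => pev p y * psi y),
      (fun y => pev p y * pderiv i psi y + psi y * pev (mderiv i p) y); split.
    - exact: pdM (pd_pev p i) (test_pd tpsi i).
    - by apply: cM; [exact: continuous_pev|exact: (test_cont tpsi)].
    - have c1 := cM _ _ (@continuous_pev _ p) (@test_pderiv_cont _ _ _ tpsi i).
      have c2 := cM _ _ (test_cont tpsi) (@continuous_pev _ (mderiv i p)).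
      exact: cD c1 c2.
    - apply: filterS2 nU nK => y Uy Ky; by rewrite /F mem_set// pE.
    - apply: filterS2 nU nK => y Uy Ky; rewrite /F' mem_set// pE//.
      by rewrite (pderiv_pev i pE Ky); ring.
  have nS : \forall y \near x, ~ S y.
    apply: open_nbhs_nbhs; split; last by move=> /SU.
    by apply: closed_openC; exact: closed_closure.
  exists (fun=> 0), (fun=> 0); split.
  - exact: pd_cst.
  - by move=> y; exact: cst_continuous.
  - by move=> y; exact: cst_continuous.
  - by apply: filterS nS => y nSy; rewrite /F (test_supp nSy) mulr0; case: ifP.
  - apply: filterS nS => y nSy.
    by rewrite /F' (test_supp nSy) (test_pderiv_supp i nSy) !mulr0 addr0; case: ifP.
have [A A0 HA] := lpoly_bounded nT lf; have [A' A'0 HA'] := lpoly_bounded nT lf'.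
have [B B0 HB] := test_bounded tpsi; have [r r0 Hr] := region_bounded nT.
have FF' : int3 setT F' = 0.
  apply: (@int3_pderiv R i F F' r (A * B + A' * B)) => //.
  - move=> x; have [g [g' [dg _ _ Fg Fg']]] := loc x.
    have -> : F' x = g' x by exact: (nbhs_singleton Fg').
    apply: near_eq_is_derive (dg x).
    by apply: filterS Fg => y ->.
  - by move=> x; have [g [g' [_ cg _ Fg _]]] := loc x; exact: near_continuous Fg (cg x).
  - by move=> x; have [g [g' [_ _ cg _ Fg]]] := loc x; exact: near_continuous Fg (cg x).
  - move=> x; rewrite /F; case: ifPn; last by rewrite normr0 addr_ge0// mulr_ge0.
    rewrite inE => Ux; rewrite normrM -[leLHS]addr0 lerD ?mulr_ge0// ler_pM ?HA//.
    by have [] := HB x.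
  - move=> x; rewrite /F'; case: ifPn; last by rewrite normr0 addr_ge0// mulr_ge0.
    have [b1 b2] := HB x.
    by rewrite inE => Ux; rewrite (le_trans (ler_normD _ _))// addrC !normrM lerD ?ler_pM ?HA ?HA'.
  - by move=> x rx; rewrite /F memNset// => /inner_Omega/Omega_region/Hr; rewrite leNgt rx.
rewrite -[RHS]FF' (@int3_supp _ U); last by move=> x nUx; rewrite /F' memNset.
by apply: eq_int3 => x xU; rewrite /F' xU.
Qed.

Variable dh : E -> E.
Hypothesis ldh : forall i, lpoly T (Defs.comp dh i).

Definition pw_div (x : E) : R := \sum_i pderiv i (Defs.comp dh i) x.

Lemma lpoly_pw_div : lpoly T pw_div.
Proof. by apply: lpoly_sum => i; exact: lpoly_pderiv. Qed.

Lemma pw_div_by_parts psi : test_fun U psi ->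
  int3 U (fun x => dotv (dh x) (grad psi x)) = - int3 U (fun x => pw_div x * psi x).
Proof.
move=> tpsi; have oU := @open_inner R T; have mU := mset_inner; have fU := vol_inner.
have c1 i : bcont U (fun x => pderiv i (Defs.comp dh i) x * psi x).
  by apply: bcontM (test_bcont _ tpsi); exact/lpoly_bcont/lpoly_pderiv.
have c2 i : bcont U (fun x => Defs.comp dh i x * pderiv i psi x).
  by apply: bcontM (pderiv_test_bcont _ _ tpsi); exact/lpoly_bcont.
rewrite (@eq_int3 _ _ _ (fun x => \sum_i Defs.comp dh i x * pderiv i psi x)); last first.
  by move=> x _; apply: eq_bigr => i _; rewrite mxE.
rewrite (@eq_int3 _ _ (fun x => pw_div x * psi x)
  (fun x => \sum_i pderiv i (Defs.comp dh i) x * psi x)); last first.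
  by move=> x _; rewrite mulr_suml.
rewrite !int3_sum//; [|by move=> i; exact: bcont_integ..].
apply/eqP; rewrite -addr_eq0 -big_split big1// => i _ /=; rewrite addrC -int3D//.
- exact: inner_pderiv.
- exact: bcont_integ.
- exact: bcont_integ.
Qed.

Variable gh : E -> R.
Hypothesis dgh : is_wdiv O dh gh.

Lemma integ_wdiv : integ U gh.
Proof.
have [_ L2g _] := dgh; apply: integS (mset_Omega_hat) _ _; first exact: mset_inner.
  exact: inner_Omega.
by apply: L2_integ => //; [exact: mset_Omega_hat|exact: vol_Omega_hat].
Qed.

Lemma wdiv_inner w : test_fun O w ->
  int3 U (fun x => dotv (dh x) (grad w x)) = - int3 U (fun x => gh x * w x).
Proof.
move=> tw; have [L2d L2g h] := dgh; have mO := mset_Omega_hat; have fO := vol_Omega_hat.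
have oO : open O := @open_interior _ _.
have R0 f : integ O f -> int3 O f = int3 U f.
  apply: int3_restrict => //; [exact: mset_inner|exact: inner_Omega|exact: null_Omega_hat].
rewrite -!R0.
- exact: h.
- by apply: bcont_mul_integ (test_bcont _ tw) => //; exact: L2_integ.
- apply: (@eq_integ _ _ (fun x => \sum_i Defs.comp dh i x * pderiv i w x)) => //.
    by move=> x _; apply: eq_bigr => i _; rewrite mxE.
  apply: integ_sum => // i; apply: bcont_mul_integ (pderiv_test_bcont _ _ tw) => //.
  exact: L2_integ.
Qed.

(** Test functions supported in the open elements see only the polynomial pieces. Density extends
    the identity to all bounded continuous [s] on [U], among them the pull-backs, whose supports
    cross the faces. *)
Lemma wdiv_pw_div s : bcont U s ->
  int3 U (fun x => gh x * s x) = int3 U (fun x => pw_div x * s x).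
Proof.
move=> cs; have [scont [A sA]] := cs; have oU := @open_inner R T; have mU := mset_inner.
have [B B0 HB] := region_bounded nT.
have [|psi [C [tpsi psiC psis]]] := @test_fun_density R U s A (Num.bound B) oU _ sA scont.
  by move=> x /inner_Omega /Omega_region /HB /le_trans; apply; rewrite ltW// archi_boundP.
have lim h : integ U h ->
    int3 U (fun x => h x * psi n x) @[n --> \oo] --> int3 U (fun x => h x * s x).
  move=> hi; apply: (int3_mul_lim mU hi _ _ psiC psis).
    by move=> n; apply: bcont_meas3 (test_bcont _ (tpsi n)).
  exact: bcont_meas3.
have h1 := lim _ integ_wdiv.
have h2 : int3 U (fun x => gh x * psi n x) @[n --> \oo] --> int3 U (fun x => pw_div x * s x).
  rewrite (_ : (fun n => _) = (fun n => int3 U (fun x => pw_div x * psi n x))).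
    by apply: lim; apply: bcont_integ (lpoly_bcont lpoly_pw_div) => //; exact: vol_inner.
  apply/funext => n; apply: oppr_inj; rewrite -pw_div_by_parts// -wdiv_inner//.
  have [t1 t2 t3] := tpsi n; split => //; exact: subset_trans t3 (@inner_Omega _ _).
by rewrite -(cvg_lim (@Rhausdorff R) h1) (cvg_lim (@Rhausdorff R) h2).
Qed.
End IntegrationByParts.

(** * The divergence of a Piola transform *)

Lemma dotvZl (R : realType) (c : R) (a b : 'rV[R]_3) : dotv (c *: a) b = c * dotv a b.
Proof. by rewrite /dotv mulr_sumr; apply: eq_bigr => i _; rewrite mxE mulrA. Qed.

Section PiolaDivergence.
Variable R : realType.
Notation E := 'rV[R]_3.
Variables (T : seq 'M[R]_(4, 3)) (M Minv : E -> E) (k : nat) (delta : R).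
Hypothesis nT : forall K, K \in T -> Defs.nondegenerate K.
Hypothesis polyM : forall K, K \in T -> polyv_on k (tet K) M.
Hypothesis contM : {within region T, continuous M}.
Hypothesis MK : forall x, region T x -> Minv (M x) = x.
Hypothesis delta0 : 0 < delta.
Hypothesis detM : forall K, K \in T -> forall x, (tet K)° x -> delta <= \det (jacobian M x).
Notation U := (inner T).
Notation O := (Omega_hat T).
Notation Om := (Omega T M).
Notation D := (jacobian M).

Lemma MK_inner x : U x -> Minv (M x) = x.
Proof. by move=> /inner_Omega/Omega_region/MK. Qed.

Lemma unit_jacobian x : U x -> D x \in unitmx.
Proof. exact: (inner_unit delta0 detM). Qed.

Lemma det_jacobian_gt0 x : U x -> 0 < \det (D x).
Proof. exact: (inner_det0 delta0 detM). Qed.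

Lemma inner_est : exists2 C, 0 < C &
  (forall x, U x -> exists2 r, 0 < r & ball x r `<=` U /\ lin_est M D C (ball x r)) /\
  (forall x (v : E), U x -> `|v *m invmx (D x)| <= C * `|v|).
Proof.
have [C1 C10 H1] := map_lin_est nT polyM; have [C2 C20 H2] := inner_inv nT polyM delta0 detM.
exists (C1 + C2 + 1); first by rewrite ltr_wpDl// addr_ge0.
split=> [x /H1[r r0 [rU rE]]|x v Ux].
  exists r => //; split => // a b c rho ra rb rc ac bc.
  rewrite (le_trans (rE _ _ _ _ ra rb rc ac bc))// ler_wpM2r// ler_wpM2r//.
    exact: le_trans ac.
  by lra.
by rewrite (le_trans (H2 _ _ Ux))// ler_wpM2r//; lra.
Qed.

Lemma open_image_inner : open (M @` U).
Proof.
have [C C0 [H1 H2]] := inner_est.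
exact: open_imageU C0 H1 unit_jacobian H2.
Qed.

Lemma mset_image_inner : mset (M @` U).
Proof. by apply: mset_open; exact: open_image_inner. Qed.

Lemma Omega_bounded : exists2 B, 0 <= B & forall y, Om y -> `|y| <= B.
Proof.
have cR : compact (M @` region T) by apply: continuous_compact => //; exact: compact_region.
have [B [_ HB]] := compact_bounded cR.
exists (`|B| + 1) => // y [x Ox <-]; apply: HB; first by rewrite ltr_pwDr// ler_norm.
by exists x => //; exact: Omega_region.
Qed.

Lemma vol_Omega : (vol Om < +oo)%E.
Proof.
have [B B0 HB] := Omega_bounded.
exact: vol_bounded (mset_Omega nT contM) HB.
Qed.

Lemma bcont_det : bcont U (fun x => \det (D x)).
Proof. by apply: lpoly_bcont => //; apply: lpoly_det => i j; exact: (lpoly_jac polyM). Qed.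

Lemma inner_change_of_variables f : bcont U f ->
  int3 (M @` U) (fun y => f (Minv y)) = int3 U (fun x => f x * \det (D x)).
Proof.
move=> [cf [A fA]]; have [C C0 [H1 H2]] := inner_est; have [cd [Cd dCd]] := bcont_det.
have [B B0 HB] := region_bounded nT; have [B' B'0 HB'] := Omega_bounded.
rewrite (@change_of_variables R U M Minv D C _ C0 H1 _ H2 MK_inner (Num.bound (B + 1)) B' A Cd f)//.
- apply: eq_int3 => x; rewrite inE => Ux; rewrite gtr0_norm//.
  exact: det_jacobian_gt0.
- exact: open_inner.
- exact: unit_jacobian.
- move=> x /inner_Omega/Omega_region/HB h.
  by apply: le_lt_trans h (lt_trans _ (archi_boundP _)); [rewrite ltrDl|rewrite addr_ge0].
- by move=> x Ux; apply: HB'; exact/image_inner_Omega/imageP.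
Qed.

Lemma bcont_inv f : bcont U f -> bcont (M @` U) (fun y => f (Minv y)).
Proof.
move=> [cf [A fA]]; have [C C0 [H1 H2]] := inner_est; split.
  apply: (continuous_inv C0 H1) => //; [|exact: MK_inner].
  exact: unit_jacobian.
by exists A => _ [x Ux <-]; rewrite MK_inner//; exact: fA.
Qed.

Lemma bcont_comp psi : continuous psi -> (exists A, forall x, `|psi x| <= A) ->
  bcont U (fun x => psi (M x)).
Proof.
move=> cpsi [A pA]; split; last by exists A.
move=> x; rewrite inE => Ux; have Tx := Omega_region (inner_Omega Ux).
have cM : M @ x --> M x.
  move=> B MB; have := iffLR (subspace_continuousP _ M) contM x Tx B MB.
  have nT' : nbhs x (region T).
    apply: filterS (@Omega_region _ _) _.
    by apply: open_nbhs_nbhs; split; [exact: open_interior|exact: inner_Omega].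
  by move=> h; apply: filterS2 nT' h => z Tz; apply.
by apply: (@continuous_comp _ _ _ M psi); [exact: cM|exact: cpsi].
Qed.

Lemma bcont_pullback psi : test_fun Om psi -> bcont U (pullback T M psi).
Proof.
move=> tpsi; split; last by have [A _ H] := pullback_bounded tpsi; exists A.
move=> x; rewrite inE => Ux; exact: (diffat_cont (pullback_diffat polyM tpsi Ux)).
Qed.

Lemma bcont_det_inv : bcont U (fun x => (\det (D x))^-1).
Proof.
have [cd _] := bcont_det; split.
  move=> x Ux; apply: (@continuous_comp _ _ _ (fun x => \det (D x)) (@GRing.inv R)); first exact: cd.
  by apply: inv_continuous; rewrite gt_eqF//; apply: det_jacobian_gt0; rewrite inE in Ux.
exists delta^-1 => x Ux; have d0 := det_jacobian_gt0 Ux.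
by rewrite normfV gtr0_norm// lef_pV2 ?posrE//; exact: (inner_det detM).
Qed.

Variables (J dh : E -> E) (gh : E -> R).
Hypothesis ldh : forall i, lpoly T (Defs.comp dh i).
Hypothesis dgh : is_wdiv O dh gh.
Hypothesis mJ : forall i, meas3 Om (Defs.comp J i).
Hypothesis JE : forall x, U x -> J (M x) = piola M dh x.

Lemma bcont_piola i : bcont U (Defs.comp (piola M dh) i).
Proof.
have -> : Defs.comp (piola M dh) i = fun x => (\det (D x))^-1 * \sum_j Defs.comp dh j x * D x j i.
  by apply/funext => x; rewrite /Defs.comp /piola !mxE.
apply: bcontM; first exact: bcont_det_inv.
apply: bcont_sum => j; apply: lpoly_bcont => //; apply: lpolyM => //; exact: (lpoly_jac polyM).
Qed.

Lemma J_bounded i : exists A, forall y, (M @` U) y -> `|Defs.comp J i y| <= A.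
Proof.
have [_ [A HA]] := bcont_piola i; exists A => _ [x Ux <-].
by rewrite /Defs.comp JE//; exact: HA.
Qed.

(** The Piola formula bounds [J] on the image of the open elements only; the values elsewhere are
    arbitrary but live on a null set. *)
Lemma L2v_J : L2v Om J.
Proof.
move=> i; have [A HA] := J_bounded i.
exact: L2_restrict (mset_Omega nT contM) vol_Omega (mJ i) (null_Omega nT polyM) HA.
Qed.

Lemma Omega_restrict f : integ Om f -> int3 Om f = int3 (M @` U) f.
Proof.
apply: int3_restrict; [exact: mset_Omega|exact: mset_image_inner|exact: image_inner_Omega|].
exact: (null_Omega nT polyM).
Qed.

(** The factor [1 / det] of the Piola transform cancels in the change of variables, and its matrix,
    moved across the dot product, turns [grad psi] into the gradient of the pull-back. *)
Lemma ipv_J_grad psi : test_fun Om psi ->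
  ipv Om J (grad psi) = - int3 U (fun x => pw_div dh x * pullback T M psi x).
Proof.
move=> tpsi; have mO := mset_Omega nT contM; have fO := vol_Omega.
have bg i : bcont U (fun x => pderiv i psi (M x)).
  apply: bcont_comp; first exact: (@test_pderiv_cont _ _ _ tpsi i).
  by have [A _ HA] := test_bounded tpsi; exists A => x; have [] := HA x.
have bp := bcont_pullback tpsi.
rewrite /ipv Omega_restrict; last first.
  apply: (@eq_integ _ _ (fun y => \sum_i Defs.comp J i y * pderiv i psi y)) => //.
    by move=> x _; apply: eq_bigr => i _; rewrite mxE.
  apply: integ_sum => // i; have [A _ HA] := test_bounded tpsi.
  apply: (integ_mulb (a := A)) => //; first exact: L2_integ (L2v_J i).
    by apply: meas3S (@mset_setT R) _ _ => //; apply: bcont_meas3 (pderiv_test_bcont _ _ tpsi); exact: openT.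
  by move=> x _; have [] := HA x.
pose G x := grad psi (M x) *m (D x)^T.
have bG i : bcont U (fun x => G x 0 i).
  rewrite /G; under eq_fun do rewrite mxE; apply: bcont_sum => j.
  apply: bcontM; first by under eq_fun do rewrite mxE; exact: bg.
  by under eq_fun do rewrite mxE; apply: lpoly_bcont => //; exact: (lpoly_jac polyM).
have bdG : bcont U (fun x => dotv (dh x) (G x)).
  by apply: bcont_sum => i; apply: bcontM => //; exact: (lpoly_bcont nT (ldh i)).
pose F x := (\det (D x))^-1 * dotv (dh x) (G x).
transitivity (int3 (M @` U) (fun y => F (Minv y))).
  apply: eq_int3 => y; rewrite inE => -[x Ux <-].
  by rewrite /F MK_inner// JE// /piola dotvZl dotv_trmx.
rewrite (@inner_change_of_variables F); last exact: bcontM bcont_det_inv bdG.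
rewrite (@eq_int3 _ _ _ (fun x => dotv (dh x) (G x))); last first.
  move=> x; rewrite inE => Ux; rewrite /F mulrAC mulVf ?mul1r// gt_eqF//.
  exact: det_jacobian_gt0.
(* Back from [q] to [gh]: the approximations of the pull-back cross the faces, where only the weak
   divergence of [dh] can be tested. *)
rewrite -(wdiv_pw_div nT ldh dgh)//.
have [w [C [tw wC dwC wl dwl]]] := pullback_approx nT polyM contM MK tpsi.
have mU := @mset_inner R T; have oU := @open_inner R T.
have l1 : int3 U (fun x => dotv (dh x) (grad (w n) x)) @[n --> \oo] -->
    int3 U (fun x => dotv (dh x) (G x)).
  have e n : int3 U (fun x => dotv (dh x) (grad (w n) x)) =
      \sum_i int3 U (fun x => Defs.comp dh i x * pderiv i (w n) x).
    rewrite -int3_sum//.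
      by apply: eq_int3 => x _; apply: eq_bigr => i _; rewrite mxE.
    move=> i; apply: bcont_integ => //; first exact: vol_inner.
    by apply: bcontM; [exact: (lpoly_bcont nT (ldh i))|exact: pderiv_test_bcont (tw n)].
  rewrite (_ : int3 U _ = \sum_i int3 U (fun x => Defs.comp dh i x * G x 0 i)); last first.
    rewrite -int3_sum// => i; apply: bcont_integ => //; first exact: vol_inner.
    by apply: bcontM => //; exact: (lpoly_bcont nT (ldh i)).
  have li i : int3 U (fun x => Defs.comp dh i x * pderiv i (w n) x) @[n --> \oo] -->
      int3 U (fun x => Defs.comp dh i x * G x 0 i).
    apply: (int3_mul_lim (C := C)) => //.
    - by apply: bcont_integ => //; [exact: vol_inner|exact: (lpoly_bcont nT (ldh i))].
    - by move=> n; apply: bcont_meas3 => //; exact: pderiv_test_bcont (tw n).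
    - exact: bcont_meas3.
    - by move=> n x /inner_Omega; exact: dwC.
    - by move=> x Ux; exact: dwl.
  rewrite (eq_cvg _ _ e) sum3E; under eq_cvg do rewrite sum3E.
  by apply: cvgD; [apply: cvgD|]; exact: li.
have l2 : int3 U (fun x => gh x * w n x) @[n --> \oo] -->
    int3 U (fun x => gh x * pullback T M psi x).
  apply: (int3_mul_lim (C := C)) => //.
  - exact: integ_wdiv dgh.
  - by move=> n; apply: bcont_meas3 => //; exact: test_bcont (tw n).
  - exact: bcont_meas3.
  - by move=> n x /inner_Omega; exact: wC.
  - by move=> x /inner_Omega; exact: wl.
rewrite -(cvg_lim (@Rhausdorff R) l1); apply: cvg_lim; first exact: Rhausdorff.
rewrite (_ : (fun n => _) = (fun n => - int3 U (fun x => gh x * w n x))); first exact: cvgN.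
by apply/funext => n; exact: wdiv_inner.
Qed.

(** [wdiv] is a choice with default 0, so the discrete equation carries information about [J] only
    once a weak divergence is known to exist. The witness is given the value 0 outside the image of
    the open elements. *)
Lemma wdiv_J_exists : exists g0, is_wdiv Om J g0.
Proof.
have lq := lpoly_pw_div ldh; set q := pw_div dh in lq *.
have mO := mset_Omega nT contM; have fO := vol_Omega.
pose f x := q x * (\det (D x))^-1.
have bf : bcont U f by apply: bcontM bcont_det_inv; exact: (lpoly_bcont nT).
have [cf [A fA]] := bcont_inv bf.
have A0 y : (M @` U) y -> 0 <= A by move=> /fA; exact: le_trans.
pose g0 y := if y \in M @` U then f (Minv y) else 0.
have mg0 : meas3 Om g0.
  exact: meas3_ext0 mset_image_inner open_image_inner (@image_inner_Omega R T M) mO _.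
have g0A y : Om y -> `|g0 y| <= `|A|.
  rewrite /g0; case: ifPn => [|_ _]; last by rewrite normr0.
  by rewrite inE => My _; rewrite (le_trans (fA _ My))// ler_norm.
have L2g0 : L2 Om g0 by exact: L2_bounded g0A.
exists g0; split; [exact: L2v_J|exact: L2g0|] => psi tpsi; rewrite ipv_J_grad//; congr (- _).
have [B _ HB] := test_bounded tpsi.
rewrite /ip Omega_restrict; last first.
  apply: (integ_mulb (a := B)) => //; first exact: L2_integ.
    apply: meas3S (@mset_setT R) _ _ => //.
    by apply: bcont_meas3 (test_bcont _ tpsi); exact: openT.
  by move=> x _; have [] := HB x.
pose F x := f x * pullback T M psi x.
transitivity (int3 (M @` U) (fun y => F (Minv y))); last first.
  apply: eq_int3 => y; rewrite inE => -[x Ux <-].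
  rewrite /F /g0 mem_set; last by exists x.
  rewrite MK_inner// pullbackE//; exact/Omega_region/inner_Omega.
rewrite (@inner_change_of_variables F); last exact: bcontM bf (bcont_pullback tpsi).
apply: eq_int3 => x; rewrite inE => Ux; rewrite /F /f.
have d0 := det_jacobian_gt0 Ux; rewrite -/q.
by field; rewrite gt_eqF.
Qed.

Lemma is_wdiv_wdiv_J : is_wdiv Om J (wdiv Om J).
Proof. by have [g0 hg] := wdiv_J_exists; apply: (@xgetPex _ _ [set g | is_wdiv Om J g]); exists g0. Qed.

Lemma pw_poly_pw_div m : pw_polyv T m.+1 dh -> pw_poly T m (pw_div dh).
Proof.
move=> pdh K KT; have h i := pdh K KT i.
have /choice[p pP] := h; exists (\sum_i mderiv i (p i)); split.
  rewrite (leq_trans (mmeasure_sum _ _ _ _))//; apply/bigmax_leqP => i _.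
  by apply: msize_mderiv; have [] := pP i.
move=> x Kx; have -> : meval (x 0) (\sum_i mderiv i (p i)) = \sum_i pev (mderiv i (p i)) x.
  by rewrite raddf_sum.
apply: eq_bigr => i _; apply: pderiv_pev Kx => z Kz.
by have [_ pE] := pP i; exact: pE.
Qed.

Lemma wdiv_J_eq0 m : pw_polyv T m.+1 dh ->
  (forall s, S_space T M Minv m s -> ip Om (wdiv Om J) s = 0) -> is_wdiv Om J (fun=> 0).
Proof.
move=> pdh hS; have lq := lpoly_pw_div ldh; set q := pw_div dh in lq *.
have mO := mset_Omega nT contM; have fO := vol_Omega; have mMU := mset_image_inner.
have oU := @open_inner R T; have fU := vol_inner nT; have mU := @mset_inner R T.
have bq : bcont U q by exact: (lpoly_bcont nT).
have [L2J L2g gP] := is_wdiv_wdiv_J; set g := wdiv Om J in hS L2g gP.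
have ig : integ Om g by exact: L2_integ.
have igU : integ (M @` U) g by apply: integS mO _ ig => //; exact: image_inner_Omega.
have [cq [A qA]] := bq.
have [cqi [A' qA']] := bcont_inv bq.
(* Outside the open elements [q] is not controlled; the value 0 there keeps [sh] bounded and
   measurable on the mesh domain. *)
pose sh x := if x \in U then q x else 0.
pose s y := sh (Minv y).
have sE y : Om y -> s y = if y \in M @` U then q (Minv y) else 0.
  move=> [x Ox <-]; have Tx := Omega_region Ox; rewrite /s /sh MK//.
  have -> // : (x \in U) = (M x \in M @` U).
  apply/idP/idP; rewrite !inE; first by exists x.
  by move=> [z Uz zx]; rewrite -(MK Tx) -zx MK_inner.
have ms : meas3 Om s.
  apply: (@eq_meas3 _ _ (fun y => if y \in M @` U then q (Minv y) else 0)).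
    by move=> y; rewrite inE => /sE.
  exact: meas3_ext0 mset_image_inner open_image_inner (@image_inner_Omega R T M) mO _.
have sA y : `|s y| <= `|A|.
  rewrite /s /sh; case: ifPn => [|_]; last by rewrite normr0.
  by rewrite inE => /qA h; rewrite (le_trans h)// ler_norm.
have s0 : int3 (M @` U) (fun y => g y * s y) = 0.
  rewrite -Omega_restrict; last exact: (integ_mulb (a := `|A|)).
  apply: hS; exists sh; split => //.
    apply: (@L2_bounded _ _ _ `|A|).
    - exact: mset_Omega_hat.
    - exact: vol_Omega_hat.
    - apply: meas3_ext0 => //; [exact: inner_Omega|exact: mset_Omega_hat].
    - move=> x _; rewrite /sh; case: ifPn => [|_]; last by rewrite normr0.
      by rewrite inE => /qA h; rewrite (le_trans h)// ler_norm.
  move=> K KT; have [p [pm pE]] := pw_poly_pw_div pdh KT; exists p; split => // x Kx.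
  by rewrite /sh mem_set; [exact: pE|exists K].
have [B B0 HB] := Omega_bounded.
(* The relation between [g] and [q] is known only against test functions. Approximating [q o M^-1]
   on the open image by such functions carries it to the pair whose integral the discrete equation
   annihilates. *)
have [|psi [C [tpsi psiC psis]]] := @test_fun_density R (M @` U) (fun y => q (Minv y)) A'
    (Num.bound B) open_image_inner _ qA' cqi.
  move=> y /image_inner_Omega/HB/le_trans; apply; by rewrite ltW// archi_boundP.
have tpsiO n : test_fun Om (psi n).
  by have [t1 t2 t3] := tpsi n; split => //; exact: subset_trans t3 (@image_inner_Omega _ _ _).
have l1 : int3 (M @` U) (fun y => g y * psi n y) @[n --> \oo] -->
    int3 (M @` U) (fun y => g y * q (Minv y)).
  apply: (int3_mul_lim (C := C)) => //.
    by move=> n; apply: bcont_meas3 (test_bcont _ (tpsi n)); exact: open_image_inner.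
  exact: meas3_open open_image_inner cqi.
have l2 : int3 U (fun x => q x * pullback T M (psi n) x) @[n --> \oo] -->
    int3 U (fun x => q x * q x).
  apply: (int3_mul_lim (C := C)) => //.
  - exact: bcont_integ.
  - by move=> n; apply: bcont_meas3 => //; exact: bcont_pullback.
  - exact: bcont_meas3.
  - move=> n x Ux; rewrite pullbackE; last exact/Omega_region/inner_Omega.
    by apply: psiC; exists x.
  - move=> x Ux; have := psis (M x) (imageP _ Ux); rewrite MK_inner//.
    by under eq_fun do rewrite -(pullbackE _ _ (Omega_region (inner_Omega Ux))).
have q0 : int3 U (fun x => q x * q x) = 0.
  rewrite -(cvg_lim (@Rhausdorff R) l2).
  have -> : (fun n => int3 U (fun x => q x * pullback T M (psi n) x)) =
      (fun n => int3 (M @` U) (fun y => g y * psi n y)).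
    apply/funext => n; apply: oppr_inj; rewrite -ipv_J_grad// gP// /ip Omega_restrict//.
    have [b _ Hb] := test_bounded (tpsiO n).
    apply: (integ_mulb (a := b)) => //; last by move=> x _; have [] := Hb x.
    apply: meas3S (@mset_setT R) _ _ => //.
    by apply: bcont_meas3 (test_bcont _ (tpsiO n)); exact: openT.
  rewrite (cvg_lim (@Rhausdorff R) l1) -[RHS]s0; apply: eq_int3 => y; rewrite inE => -[x Ux <-].
  by rewrite /s MK_inner// /sh mem_set.
split; first exact: L2v_J.
  apply: (@L2_bounded _ _ _ 0) => //; first exact: meas3_cst.
  by move=> x _; rewrite normr0.
move=> chi tchi; rewrite ipv_J_grad//.
have bp := bcont_pullback tchi.
rewrite (@int3_sqr0_orth _ U q)//; try by apply: bcont_integ => //; exact: bcontM.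
rewrite /ip (@eq_int3 _ _ _ (fun=> 0)); last by move=> x _; rewrite mul0r.
by rewrite /int3 Rintegral_cst// mul0r.
Qed.
End PiolaDivergence.

Theorem lemma3p7 (R : realType) (k : nat) (hk : (2 <= k)%N)
    (sigma tau C delta : R) (hdelta : 0 < delta)
    (h : R) (T : seq 'M[R]_(4, 3)) (hT : admissible_mesh sigma tau h T)
    (M Minv : 'rV[R]_3 -> 'rV[R]_3)
    (hM : admissible_map k C delta T M Minv)
    (Re alpha gamma : R) (hRe : 0 < Re) (halpha : 0 < alpha) (hgamma : 0 < gamma)
    (B f g : 'rV[R]_3 -> 'rV[R]_3)
    (hB : Linftyv (Omega T M) B)
    (hf : L2v (Omega T M) f) (hg : L2v (Omega T M) g)
    (u : 'rV[R]_3 -> 'rV[R]_3) (p : 'rV[R]_3 -> R)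
    (J : 'rV[R]_3 -> 'rV[R]_3) (phi : 'rV[R]_3 -> R)
    (hu : V_space T M Minv k u) (hp : Q_space T M Minv (k - 1) p)
    (hJ : D_space T M Minv (k - 1) J) (hphi : S_space T M Minv (k - 2) phi)
    (hsol : let Om := Omega T M in
      forall (v : 'rV[R]_3 -> 'rV[R]_3) (q : 'rV[R]_3 -> R)
             (d : 'rV[R]_3 -> 'rV[R]_3) (s : 'rV[R]_3 -> R),
      V_space T M Minv k v -> Q_space T M Minv (k - 1) q ->
      D_space T M Minv (k - 1) d -> S_space T M Minv (k - 2) s ->
      [/\ trilin Om u u v + Re^-1 * ipm Om (wgrad Om u) (wgrad Om v)
            + gamma * ip Om (wdiv Om u) (wdiv Om v) - ip Om p (wdiv Om v)
            - alpha * ipv Om (fun x => crossv (J x) (B x)) v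
          = ipv Om f v,
          ipv Om J d - ip Om phi (wdiv Om d)
            - ipv Om (fun x => crossv (u x) (B x)) d
          = ipv Om g d,
          - ip Om (wdiv Om u) q = 0 &
          - ip Om (wdiv Om J) s = 0]) :
  is_wdiv (Omega T M) J (fun=> 0).
Proof.
have [nT _ _ _ _ _ _] := hT; have [contM polyM MK _ _ detM] := hM.
have [dh [[gh dgh] pdh mJ JE]] := hJ.
(* By [2 <= k] the truncated subtractions are genuine, and [k - 2] is the degree left after one
   derivative. *)
have kE1 : (k - 1)%N = (k - 2).+1 by rewrite -subSn// subSS.
rewrite kE1 in pdh.
apply: (@wdiv_J_eq0 R T M Minv k delta nT polyM contM MK hdelta detM J dh gh _ dgh mJ _ (k - 2) pdh).
- by move=> i K /pdh/(_ i)[r [_ rE]]; exists r.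
- move=> x [K KT Kx]; have Tx : region T x by exists K => //; exact: interior_subset.
  have Jx : (M @` (tet K)°) (M x) by exists x.
  by rewrite (JE K KT _ Jx) (MK x Tx).
(* The solution itself fills the other three test slots, so that only [s] varies. *)
- move=> s hs; have [_ _ _] := hsol u p J s hu hp hJ hs.
  by move/eqP; rewrite oppr_eq0 => /eqP.
Qed.
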